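(* Let $K\ge 1$, $K'\ge 0$, let $p\ge 1$ be an integer, and let $F(z)=\sum_{k=1}^p |z|^{2(k-1)}G_{p-k+1}(z)$ be a poly $(K,K')$-elliptic harmonic mapping in $\mathbb{D}$ (so each $G_{p-k+1}$, $k\in\{1,\dots,p\}$, is a $(K,K')$-elliptic harmonic mapping in $\mathbb{D}$) such that $F(0)=0$ and such that, for real constants $M_{p-k+1}$ ($2\le k\le p$) and $\Lambda_p$: (i) $\lambda_{G_{p-k+1}}(0)=1$ and $G_{p-k+1}(0)=0$ for all $k\in\{1,\dots,p\}$; (ii) $|G_{p-k+1}(z)|\le M_{p-k+1}$ for all $k\in\{2,\dots,p\}$ and $\lambda_{G_p}(z)\le\Lambda_p$, for all $z\in\mathbb{D}$. Put $\Lambda_p'=\frac{1}{2}\left(K\Lambda_p+\sqrt{K^2\Lambda_p^2+4K'}\right)$, $K_1(M)=\min\left\{\sqrt{2M^2-1},\ \frac{4M}{\pi}\right\}$ and $$\phi(r)=\sum_{k=2}^p r^{2(k-1)}\left((2k-1)K_1(M_{p-k+1})+\sqrt{2M_{p-k+1}^2-2}\left(\frac{2(k-1)r}{\sqrt{1-r^2}}+\frac{r\sqrt{4-3r^2+r^4}}{(1-r^2)^{3/2}}\right)\right).$$ Then $F$ is univalent in $\mathbb{D}_{r_1}$, where $r_1$ is the unique root in $(0,1)$ of the equation $$\frac{\Lambda_p'(1-\Lambda_p' r)}{\Lambda_p'-r}-\phi(r)=0.$$ Furthermore, $F(\mathbb{D}_{r_1})$ contains a schlicht disk with radius $$R_1=\Lambda_p'^2r_1+(\Lambda_p'^3-\Lambda_p')\log\left(1-\frac{r_1}{\Lambda_p'}\right)-\sum_{k=2}^p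 r_1^{2k-1}\left(K_1(M_{p-k+1})+\sqrt{2M_{p-k+1}^2-2}\,\frac{r_1}{\sqrt{1-r_1^2}}\right).$$ When $K=1$, $K'=0$ and $M_{p-k+1}=1$ for $k=2,\dots,p$, the result is sharp, i.e. neither the univalence radius $r_1$ nor the schlicht disk radius $R_1$ can be replaced by a larger number.
   Context: $\mathbb{D}_r=\{z\in\mathbb{C}:|z|<r\}$, $\mathbb{D}=\mathbb{D}_1$. For a continuously differentiable complex-valued $f$ put $\Lambda_f(z)=|f_z(z)|+|f_{\bar z}(z)|$, $\lambda_f(z)=\big||f_z(z)|-|f_{\bar z}(z)|\big|$, $J_f(z)=|f_z(z)|^2-|f_{\bar z}(z)|^2$. Univalent means injective. A mapping $f$ is ACL in $\mathbb{D}$ if for every closed rectangle $R\subset\mathbb{D}$ with sides parallel to the axes, $f$ is absolutely continuous on almost every horizontal and almost every vertical line in $R$; $f\in ACL^2$ if moreover its partial derivatives are locally $L^2$ in $\mathbb{D}$. A sense-preserving continuous mapping $f:\mathbb{D}\to\mathbb{C}$ is $(K,K')$-elliptic ($K\ge1$, $K'\ge0$) if (1) $f$ is $ACL^2$ in $\mathbb{D}$ and $J_f\ne0$ a.e. in $\mathbb{D}$; and (2) $\Lambda_f^2\le KJ_f+K'$ a.e. in $\mathbb{D}$. (For a continuously differentiable $f$, which is automatically $ACL^2$, sense-preserving is taken to mean $J_f\ge 0$, so that $J_f>0$ a.e.) A harmonic mapping is a twice continuously differentiable complex-valued $f$ with $\Delta f=4f_{z\bar z}=0$. A poly $(K,K')$-elliptic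 harmonic mapping in $\mathbb{D}$ is a mapping of the form $F(z)=\sum_{k=1}^p|z|^{2(k-1)}G_{p-k+1}(z)$ with each $G_{p-k+1}$ a $(K,K')$-elliptic harmonic mapping in $\mathbb{D}$. A schlicht disk contained in $F(\mathbb{D}_r)$ is a disk which is the univalent image under $F$ of some region in $\mathbb{D}_r$. In the sharpness assertion the schlicht disk is understood to be centred at $F(0)=0$. Empty sums are $0$.
   Formalization: The existence and uniqueness of the root r_1 is asserted except when p=1 and Λ_p'=1 (that is, p=K=Λ_p=1, K'=0), where the equation reads 1=0 and has no root, e.g. for F(z)=z; the other claims are stated for every root in (0,1). *)

(* Defs.v *)
From HB Require Import structures.
From mathcomp Require Import all_boot all_order all_algebra.
From mathcomp Require Import complex.
From mathcomp Require Import all_classical all_reals all_analysis.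

Set Implicit Arguments.
Unset Strict Implicit.
Unset Printing Implicit Defensive.

Import Order.TTheory GRing.Theory Num.Theory.
Import numFieldNormedType.Exports.
Local Open Scope classical_set_scope.
Local Open Scope ring_scope.
Local Open Scope complex_scope.

(* The norm of the numFieldType R[i] takes values in R[i]; Normc.normc is the
   same modulus with values in R.  R[i] is a normed module over itself, not over
   R, so real partial derivatives are taken componentwise. *)
HB.instance Definition _ (R : realType) := NormedModule.copy R[i] R[i]^o.

Section Plane.
Variable R : realType.
Local Notation C := R[i].
Implicit Types (f F : C -> C) (z w : C).

Definition disk w (r : R) : set C := [set z | Normc.normc (z - w) < r].
Definition unit_disk : set C := disk 0 1.

Definition pdx f z : C :=
  derive1 (fun t : R => complex.Re (f (t +i* complex.Im z))) (complex.Re z) +i*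
  derive1 (fun t : R => complex.Im (f (t +i* complex.Im z))) (complex.Re z).
Definition pdy f z : C :=
  derive1 (fun t : R => complex.Re (f (complex.Re z +i* t))) (complex.Im z) +i*
  derive1 (fun t : R => complex.Im (f (complex.Re z +i* t))) (complex.Im z).

Definition has_partials f z : Prop :=
  [/\ derivable (fun t : R => complex.Re (f (t +i* complex.Im z))) (complex.Re z) 1,
      derivable (fun t : R => complex.Im (f (t +i* complex.Im z))) (complex.Re z) 1,
      derivable (fun t : R => complex.Re (f (complex.Re z +i* t))) (complex.Im z) 1 &
      derivable (fun t : R => complex.Im (f (complex.Re z +i* t))) (complex.Im z) 1].

Definition C1 f : Prop := forall z, unit_disk z ->
  [/\ has_partials f z, {for z, continuous (pdx f)} & {for z, continuous (pdy f)}].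
Definition C2 f : Prop := [/\ C1 f, C1 (pdx f) & C1 (pdy f)].

Definition dz f z : C := (pdx f z - 'i%C * pdy f z) / 2.
Definition dzbar f z : C := (pdx f z + 'i%C * pdy f z) / 2.

Definition Lambda f z : R := Normc.normc (dz f z) + Normc.normc (dzbar f z).
Definition lambda f z : R := `|Normc.normc (dz f z) - Normc.normc (dzbar f z)|.
Definition jacobian f z : R :=
  Normc.normc (dz f z) ^+ 2 - Normc.normc (dzbar f z) ^+ 2.

Definition laplacian f z : C := 4 * dzbar (dz f) z.
Definition harmonic f : Prop :=
  C2 f /\ forall z, unit_disk z -> laplacian f z = 0.

(* Area measure lives on R * R; the point (x, y) stands for x + iy. *)
Local Notation area := (@lebesgue_measure R \x @lebesgue_measure R)%E.
Definition ae_disk (P : C -> Prop) : Prop :=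
  {ae area, forall q, unit_disk (q.1 +i* q.2) -> P (q.1 +i* q.2)}.

Definition abs_cont (a b : R) (g : R -> C) : Prop :=
  forall e : R, 0 < e -> exists2 d : R, 0 < d &
    forall (n : nat) (s t : 'I_n -> R),
      (forall i, [/\ a <= s i, s i <= t i & t i <= b]) ->
      trivIset [set: 'I_n] (fun i => `]s i, t i[%classic) ->
      \sum_(i < n) (t i - s i) < d ->
      \sum_(i < n) Normc.normc (g (t i) - g (s i)) < e.

Definition rect_in_disk (a b c d : R) : Prop :=
  [/\ a < b, c < d &
      forall x y, a <= x <= b -> c <= y <= d -> unit_disk (x +i* y)].

Definition ACL f : Prop := forall a b c d, rect_in_disk a b c d ->
  {ae @lebesgue_measure R, forall y, c <= y <= d ->
     abs_cont a b (fun x => f (x +i* y))} /\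
  {ae @lebesgue_measure R, forall x, a <= x <= b ->
     abs_cont c d (fun y => f (x +i* y))}.

Definition L2_on (A : set (R * R)) (u : C -> R) : Prop :=
  measurable_fun A (fun q : R * R => u (q.1 +i* q.2)) /\
  area.-integrable A (fun q : R * R => (u (q.1 +i* q.2) ^+ 2)%:E).

Definition locally_L2 (g : C -> C) : Prop :=
  forall a b c d, rect_in_disk a b c d ->
    L2_on (`[a, b] `*` `[c, d]) (fun z => complex.Re (g z)) /\
    L2_on (`[a, b] `*` `[c, d]) (fun z => complex.Im (g z)).

Definition ACL2 f : Prop := [/\ ACL f, locally_L2 (pdx f) & locally_L2 (pdy f)].

(* The right notion for continuously differentiable f, the only case in which
   it is used (see elliptic_harmonic). *)
Definition sense_preserving f : Prop :=
  forall z, unit_disk z -> 0 <= jacobian f z.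

Definition elliptic (K K' : R) f : Prop :=
  [/\ forall z, unit_disk z -> {for z, continuous f}, sense_preserving f,
      ACL2 f,
      ae_disk (fun z => jacobian f z != 0) &
      ae_disk (fun z => Lambda f z ^+ 2 <= K * jacobian f z + K')].

Definition elliptic_harmonic (K K' : R) f : Prop :=
  harmonic f /\ elliptic K K' f.

Definition poly_elliptic_harmonic (K K' : R) (p : nat) (G : nat -> C -> C) F :
    Prop :=
  (forall k, (1 <= k <= p)%N -> elliptic_harmonic K K' (G (p - k + 1)%N)) /\
  (forall z, unit_disk z ->
    F z = \sum_(1 <= k < p.+1) (Normc.normc z ^+ (2 * (k - 1)))%:C * G (p - k + 1)%N z).

Definition landau_class (K K' : R) (p : nat) (M : nat -> R) (Lp : R)
    (G : nat -> C -> C) F : Prop :=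
  [/\ poly_elliptic_harmonic K K' p G F,
      F 0 = 0,
      forall k, (1 <= k <= p)%N ->
        lambda (G (p - k + 1)%N) 0 = 1 /\ G (p - k + 1)%N 0 = 0,
      forall k, (2 <= k <= p)%N -> forall z, unit_disk z ->
        Normc.normc (G (p - k + 1)%N z) <= M (p - k + 1)%N &
      forall z, unit_disk z -> lambda (G p) z <= Lp].

Definition univalent_on (A : set C) F : Prop := set_inj A F.

Definition region (A : set C) : Prop := [/\ A !=set0, open A & connected A].

(* Since a region is nonempty, rho is necessarily positive. *)
Definition schlicht_disk F (A : set C) w (rho : R) : Prop :=
  exists U : set C, [/\ region U, U `<=` A, univalent_on U F &
                        F @` U = disk w rho].

Definition Lambda' (K K' L : R) : R :=
  (K * L + Num.sqrt (K ^+ 2 * L ^+ 2 + 4 * K')) / 2.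

Definition K1 (M : R) : R :=
  Num.min (Num.sqrt (2 * M ^+ 2 - 1)) (4 * M / pi).

Definition phi (p : nat) (M : nat -> R) (r : R) : R :=
  \sum_(2 <= k < p.+1) r ^+ (2 * (k - 1)) *
    ((2 * k - 1)%:R * K1 (M (p - k + 1)%N) +
     Num.sqrt (2 * M (p - k + 1)%N ^+ 2 - 2) *
       ((2 * (k - 1))%:R * r / Num.sqrt (1 - r ^+ 2) +
        r * Num.sqrt (4 - 3 * r ^+ 2 + r ^+ 4) / (1 - r ^+ 2) `^ (3 / 2))).

(* For p = 1 and L' = 1 the left-hand side is identically 1 on (0, 1), so there
   is no root; this is the only such case for L' = Lambda' K K' Lp, Lp >= 1. *)
Definition radius_root (p : nat) (M : nat -> R) (L' r : R) : Prop :=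
  0 < r < 1 /\ L' * (1 - L' * r) / (L' - r) - phi p M r = 0.

Definition R1 (p : nat) (M : nat -> R) (L' r : R) : R :=
  L' ^+ 2 * r + (L' ^+ 3 - L') * ln (1 - r / L') -
  \sum_(2 <= k < p.+1) r ^+ (2 * k - 1) *
    (K1 (M (p - k + 1)%N) +
     Num.sqrt (2 * M (p - k + 1)%N ^+ 2 - 2) * (r / Num.sqrt (1 - r ^+ 2))).

End Plane.

(* Main.v *)
Require Import Defs.
From HB Require Import structures.
From mathcomp Require Import all_boot all_order all_algebra.
From mathcomp Require Import complex.
From mathcomp Require Import all_classical all_reals all_analysis.
From mathcomp Require Import measurable_realfun.
From mathcomp Require Import ring lra.

(* Idea.  On a smaller disk every harmonic mapping is a C^1-limit of harmonic
   polynomials p + conj q, so all coefficient estimates reduce to finite sums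
   over roots of unity: Parseval's inequality gives
   sum (|a_n|^2 + |b_n|^2) <= M^2, a mean of |cos| gives
   |a_1| + |b_1| <= 4M/pi, and Cauchy-Schwarz turns these into growth and
   Lipschitz bounds for the mappings G_{p-k+1}, k >= 2.
   For G_p, ellipticity bounds Lambda_{G_p} by L = Lambda_p'.  In a fixed
   direction u, with c unimodular such that Re (c (u dz G_p + conj u dzbar G_p))
   is at least 1 at 0, this real part is that of a holomorphic function bounded
   by L, so the Schwarz-Pick lemma bounds it below by L(1 - Lr)/(L - r) on
   |z| <= r.  Integrating along segments,
     Re (c (F z2 - F z1)) >= (L(1 - Lr)/(L - r) - phi r) |z2 - z1|,
   and radially |F z| >= R_1(|z|); univalence follows, and a continuation
   argument along rays shows that the disk of radius R_1(r_1) is covered.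
   The extremal mapping has G_p(z) = L^2 z + (L^3 - L) Log(1 - z/L) and
   G_{p-k+1}(z) = -z for k >= 2; on the real axis F(x) = R_1(x), whose
   maximum is at r_1. *)

Set Implicit Arguments.
Unset Strict Implicit.
Unset Printing Implicit Defensive.

Import Order.TTheory GRing.Theory Num.Theory.
Import numFieldNormedType.Exports.
Local Open Scope classical_set_scope.
Local Open Scope ring_scope.
Local Open Scope complex_scope.
Local Notation "x ^*" := (conjc x) : ring_scope.

(** The difficulty in approximating lies in the derivatives: closeness to a polynomial must control
    [dz] and [dzbar] with constants independent of the degree. The coefficient estimates supply
    this, being uniform over all harmonic polynomials with a given bound on a circle. An
    approximating polynomial loses a little in the radius, in the bound and in [lambda] at 0. Each
    estimate is therefore proved with a slack [e], which then decreases to 0 in an expression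
    continuous in [e]. Ellipticity holds only almost everywhere, whereas Schwarz-Pick needs a bound
    at every point; continuity of the partial derivatives bridges the gap. [Lambda'] is the larger
    root of the quadratic inequality that ellipticity imposes on [Lambda]. In [phi] and [R1], the
    number 2M^2 - 2 bounds the sum over n >= 2 of (|a_n| + |b_n|)^2, the normalization at 0 having
    used up its share; the factors beside it come from the sums over n >= 2 of n^2 r^(2n-2) and of
    r^(2n). *)

Notation nc := Normc.normc.

(** * The complex modulus *)

Section Modulus.
Variable R : realType.
Local Notation C := R[i].
Implicit Types z w : C.

Lemma ncE z : (nc z)%:C = `|z| :> C.
Proof. by case: z => a b; rewrite normc_def. Qed.

Lemma nc_ge0 z : 0 <= nc z.
Proof. by rewrite -ler0c ncE. Qed.

Lemma ncD z w : nc (z + w) <= nc z + nc w.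
Proof. exact: le_normcD. Qed.

Lemma ncN z : nc (- z) = nc z.
Proof. exact: normcN. Qed.

Lemma ncM z w : nc (z * w) = nc z * nc w.
Proof. exact: Normc.normcM. Qed.

Lemma nc0 : nc (0 : C) = 0.
Proof. exact: Normc.normc0. Qed.

Lemma nc1 : nc (1 : C) = 1.
Proof. exact: Normc.normc1. Qed.

Lemma ncV z : nc z^-1 = (nc z)^-1.
Proof. exact: Normc.normcV. Qed.

Lemma nc_eq0 z : (nc z == 0) = (z == 0).
Proof.
apply/eqP/eqP => [|->]; first exact: Normc.eq0_normc.
exact: nc0.
Qed.

Lemma nc_gt0 z : (0 < nc z) = (z != 0).
Proof. by rewrite lt_def nc_ge0 andbT nc_eq0. Qed.

Lemma ncX z n : nc (z ^+ n) = nc z ^+ n.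
Proof. by elim: n => [|n IH]; rewrite ?expr0 ?nc1// !exprS ncM IH. Qed.

Lemma ncB z w : nc (z - w) = nc (w - z).
Proof. by rewrite -ncN opprB. Qed.

Lemma ncJ z : nc z^* = nc z.
Proof. by case: z => a b /=; rewrite sqrrN. Qed.

Lemma ncR (x : R) : nc x%:C = `|x|.
Proof. by rewrite /= expr0n addr0 sqrtr_sqr. Qed.

Lemma nc_sqr z : nc z ^+ 2 = complex.Re z ^+ 2 + complex.Im z ^+ 2.
Proof. by case: z => a b /=; rewrite sqr_sqrtr// addr_ge0// sqr_ge0. Qed.

Lemma mulcJ z : z * z^* = (nc z ^+ 2)%:C.
Proof.
rewrite nc_sqr; case: z => a b; apply/eqP; rewrite eq_complex /=.
by apply/andP; split; apply/eqP; ring.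
Qed.

Lemma Re_le_nc z : `|complex.Re z| <= nc z.
Proof. by rewrite -sqrtr_sqr; case: z => a b /=; rewrite ler_sqrt ?addr_ge0 ?sqr_ge0// lerDl sqr_ge0. Qed.

Lemma Im_le_nc z : `|complex.Im z| <= nc z.
Proof. by rewrite -sqrtr_sqr; case: z => a b /=; rewrite ler_sqrt ?addr_ge0 ?sqr_ge0// lerDr sqr_ge0. Qed.

Lemma nc_le_ReIm z : nc z <= `|complex.Re z| + `|complex.Im z|.
Proof.
have -> : z = (complex.Re z)%:C + (complex.Im z)%:C * 'i%C :> C.
  by rewrite [LHS]complexE mulrC.
apply: (le_trans (ncD _ _)); rewrite ncM !ncR.
have -> : nc ('i%C : C) = 1 by rewrite /= expr0n expr1n add0r sqrtr1.
by rewrite mulr1 lerD//; case: z => a b /=; simpc.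
Qed.

Lemma nc_sum (I : Type) (r : seq I) (P : pred I) (f : I -> C) :
  nc (\sum_(i <- r | P i) f i) <= \sum_(i <- r | P i) nc (f i).
Proof.
elim/big_ind2 : _ => [|x1 x2 y1 y2 h1 h2|//]; first by rewrite nc0.
by apply: (le_trans (ncD _ _)); rewrite lerD.
Qed.

Lemma ncBD z w : nc z - nc w <= nc (z - w).
Proof. by rewrite lerBlDr -{1}(subrK w z) ncD. Qed.

Lemma nc_dist z w : `|nc z - nc w| <= nc (z - w).
Proof. by rewrite ler_norml ncBD andbT lerNl opprB ncB ncBD. Qed.

Lemma nc_rotate z : exists2 c : C, nc c = 1 & c * z = (nc z)%:C.
Proof.
have [->|z0] := eqVneq z 0.
  by exists 1; rewrite ?nc1// mulr0 nc0.
have nz0 : nc z != 0 by rewrite nc_eq0.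
exists (z^* * ((nc z)^-1)%:C).
  by rewrite ncM ncJ ncR ger0_norm ?invr_ge0 ?nc_ge0// mulfV.
by rewrite mulrAC (mulrC _ z) mulcJ -rmorphM/= expr2 mulfK.
Qed.

Lemma reD z w : complex.Re (z + w) = complex.Re z + complex.Re w.
Proof. by case: z; case: w. Qed.

Lemma reN z : complex.Re (- z) = - complex.Re z.
Proof. by case: z. Qed.

Lemma reB z w : complex.Re (z - w) = complex.Re z - complex.Re w.
Proof. by rewrite reD reN. Qed.

Lemma reJ z : complex.Re z^* = complex.Re z.
Proof. by case: z. Qed.

Lemma reMr (x : R) z : complex.Re (x%:C * z) = x * complex.Re z.
Proof. by case: z => a b /=; rewrite mul0r subr0. Qed.

Lemma imMr (x : R) z : complex.Im (x%:C * z) = x * complex.Im z.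
Proof. by case: z => a b /=; rewrite mul0r addr0. Qed.

Lemma conjcMr (x : R) z : (x%:C * z)^* = x%:C * z^*.
Proof. by case: z => a b /=; apply/eqP; rewrite eq_complex /= !mul0r !subr0 !addr0 mulrN !eqxx. Qed.

Lemma rcD (x y : R) : (x + y)%:C = x%:C + y%:C :> C.
Proof. exact: rmorphD. Qed.

Lemma rcB (x y : R) : (x - y)%:C = x%:C - y%:C :> C.
Proof. exact: rmorphB. Qed.

Lemma rcM (x y : R) : (x * y)%:C = x%:C * y%:C :> C.
Proof. exact: rmorphM. Qed.

Lemma rcN (x : R) : (- x)%:C = - x%:C :> C.
Proof. by rewrite -sub0r rcB sub0r. Qed.

Lemma rcV (x : R) : (x^-1)%:C = (x%:C)^-1 :> C.
Proof.
have [->|x0] := eqVneq x 0; first by rewrite !invr0.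
have x0' : x%:C != 0 :> C by rewrite eq_complex /= negb_and x0.
by apply: (mulfI x0'); rewrite -rcM !mulfV.
Qed.

Lemma rcX (x : R) n : (x ^+ n)%:C = x%:C ^+ n :> C.
Proof. exact: rmorphXn. Qed.

Lemma rc_nat n : (n%:R : R)%:C = n%:R :> C.
Proof. exact: rmorph_nat. Qed.

Lemma rc_sum (I : Type) (r : seq I) (P : pred I) (f : I -> R) :
  (\sum_(i <- r | P i) f i)%:C = \sum_(i <- r | P i) (f i)%:C :> C.
Proof. exact: (big_morph _ rcD (erefl _)). Qed.

Lemma conjD z w : (z + w)^* = z^* + w^*.
Proof. exact: rmorphD. Qed.

Lemma conjM z w : (z * w)^* = z^* * w^*.
Proof. exact: rmorphM. Qed.

Lemma conjB z w : (z - w)^* = z^* - w^*.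
Proof. exact: rmorphB. Qed.

Lemma conjX z n : (z ^+ n)^* = z^* ^+ n.
Proof. exact: rmorphXn. Qed.

Lemma conj_sum (I : Type) (r : seq I) (P : pred I) (f : I -> C) :
  (\sum_(i <- r | P i) f i)^* = \sum_(i <- r | P i) (f i)^*.
Proof. exact: (big_morph _ conjD (conjc0 R)). Qed.

Lemma conjR (x : R) : (x%:C : C)^* = x%:C.
Proof. exact: conjc_real. Qed.

Lemma conj_nat n : (n%:R : C)^* = n%:R.
Proof. exact: conjc_nat. Qed.

Lemma imD z w : complex.Im (z + w) = complex.Im z + complex.Im w.
Proof. by case: z; case: w. Qed.

Lemma imN z : complex.Im (- z) = - complex.Im z.
Proof. by case: z. Qed.

Lemma Re_le_ncW z : complex.Re z <= nc z.
Proof. exact: le_trans (ler_norm _) (Re_le_nc _). Qed.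

Lemma unit_direction z : exists2 u : C, nc u = 1 & z = (nc z)%:C * u.
Proof.
have [c c1 cz] := nc_rotate z; exists c^*; rewrite ?ncJ//.
by rewrite -cz mulrAC mulcJ c1 expr1n mul1r.
Qed.

(** Reduces a bound on a modulus to real-valued functions, for which the mean value theorem and the
    maximum principle are available. *)
Lemma nc_le_Re z (B : R) :
  (forall c : C, nc c = 1 -> complex.Re (c * z) <= B) -> nc z <= B.
Proof. by move=> h; have [c c1 cz] := nc_rotate z; have := h c c1; rewrite cz. Qed.

(** Balls in [C] have radii in [C]; a positive complex number is real, so that radii and tolerances
    can be traded for real ones. *)
Lemma continuous_epsP (f : C -> C) z : {for z, continuous f} <->
  forall e : R, 0 < e -> exists2 d : R, 0 < d &
    forall w, nc (w - z) < d -> nc (f w - f z) < e.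
Proof.
split=> [/cvgrPdist_lt cf e e0|h].
  have e0' : (0 : C) < e%:C by rewrite ltcR.
  have /nbhs_ballP[d /= d0 hd] := cf _ e0'.
  have [dr dE] : exists dr : R, d = dr%:C.
    by apply/complex_realP; rewrite realE ltW.
  exists dr; first by rewrite -ltcR -dE.
  move=> w wz; rewrite ncB -ltcR ncE; apply: hd.
  by rewrite /ball /= /ball_ /= -ncE ncB dE ltcR.
apply/(@cvgrPdist_lt C C _ (nbhs z) (nbhs_filter z) f (f z)) => e e0.
have [er eE] : exists er : R, e = er%:C.
  by apply/complex_realP; rewrite realE ltW.
have er0 : 0 < er by rewrite -ltcR -eE.
have [d d0 hd] := h _ er0.
apply/nbhs_ballP; exists d%:C; first by rewrite /= ltcR.
move=> w; rewrite /ball /= /ball_ /= -ncE ltcR ncB => /hd.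
by rewrite eE -ncE ltcR ncB.
Qed.

Lemma continuousR_epsP (f : C -> R) z : {for z, continuous f} <->
  forall e : R, 0 < e -> exists2 d : R, 0 < d &
    forall w, nc (w - z) < d -> `|f w - f z| < e.
Proof.
split=> [/cvgrPdist_lt cf e e0|h].
  have /nbhs_ballP[d /= d0 hd] := cf _ e0.
  have [dr dE] : exists dr : R, d = dr%:C.
    by apply/complex_realP; rewrite realE ltW.
  exists dr; first by rewrite -ltcR -dE.
  move=> w wz; rewrite distrC; apply: hd.
  by rewrite /ball /= /ball_ /= -ncE ncB dE ltcR.
apply/(@cvgrPdist_lt R R _ (nbhs z) (nbhs_filter z) f (f z)) => e e0.
have [d d0 hd] := h _ e0.
apply/nbhs_ballP; exists d%:C; first by rewrite /= ltcR.
by move=> w; rewrite /ball /= /ball_ /= -ncE ltcR ncB distrC => /hd.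
Qed.

Lemma nbhs_diskP z (A : set C) :
  nbhs z A <-> exists2 d : R, 0 < d & forall w, nc (w - z) < d -> A w.
Proof.
split=> [|[d d0 hd]].
  move=> /nbhs_ballP[d /= d0 hd].
  have [dr dE] : exists dr : R, d = dr%:C.
    by apply/complex_realP; rewrite realE ltW.
  exists dr; first by rewrite -ltcR -dE.
  by move=> w wz; apply: hd; rewrite /ball /= /ball_ /= -ncE ncB dE ltcR.
apply/nbhs_ballP; exists d%:C; first by rewrite /= ltcR.
by move=> w; rewrite /ball /= /ball_ /= -ncE ltcR ncB => /hd.
Qed.

End Modulus.

(** * Compactness of closed disks *)

Section Compactness.
Variable R : realType.
Local Notation C := R[i].

Lemma Complex_continuous : continuous (fun q : R * R => q.1 +i* q.2 : C).
Proof.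
move=> q A /nbhs_diskP[d d0 hd].
have d20 : 0 < d / 2 by rewrite divr_gt0.
have h1 : \forall q' \near q, `|q'.1 - q.1| < d / 2.
  have /cvgrPdist_lt/(_ _ d20) : (fun q' : R * R => q'.1) @ q --> q.1 by exact: cvg_fst.
  by apply: filterS => q' /=; rewrite distrC.
have h2 : \forall q' \near q, `|q'.2 - q.2| < d / 2.
  have /cvgrPdist_lt/(_ _ d20) : (fun q' : R * R => q'.2) @ q --> q.2 by exact: cvg_snd.
  by apply: filterS => q' /=; rewrite distrC.
suff : \forall q' \near q, A (q'.1 +i* q'.2) by [].
apply: filterS2 h1 h2 => q' h1 h2; apply: hd.
apply: (le_lt_trans (nc_le_ReIm _)) => /=.
rewrite (splitr d); exact: ltrD.
Qed.

Lemma closed_disk_compact (r : R) : compact [set z : C | nc z <= r].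
Proof.
set S := (fun q : R * R => q.1 +i* q.2 : C) @` (`[- r, r] `*` `[- r, r]).
have cS : compact S.
  apply: continuous_compact.
    exact/continuous_subspaceT/Complex_continuous.
  by apply: compact_setX; exact: segment_compact.
apply: (subclosed_compact _ cS).
  move=> z hz; rewrite /mkset leNgt; apply/negP => rz.
  have d0 : 0 < nc z - r by rewrite subr_gt0.
  have /hz[w [/= wr wz]] : nbhs z [set w | nc (w - z) < nc z - r].
    by apply/nbhs_diskP; exists (nc z - r).
  have := lt_le_trans wz (lerB (lexx _) wr).
  by rewrite ltNge ncB ncBD.
move=> z /= zr; exists (complex.Re z, complex.Im z) => /=; last by case: (z).
rewrite !in_itv /= -!ler_norml; split.
  exact: le_trans (Re_le_nc _) zr.
exact: le_trans (Im_le_nc _) zr.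
Qed.

Lemma disk_max (r : R) (u : C -> R) : 0 <= r ->
  (forall z, nc z <= r -> {for z, continuous u}) ->
  exists2 z0, nc z0 <= r & forall z, nc z <= r -> u z <= u z0.
Proof.
move=> r0 cu; have [| |z0 z0r hz0] := @compact_EVT_max C R u [set z | nc z <= r] _ (@closed_disk_compact r).
- by exists 0; rewrite /mkset nc0.
- by apply: continuous_in_subspaceT => z; rewrite inE; exact: cu.
by exists z0; [rewrite inE in z0r|move=> z zr; apply: hz0; rewrite inE].
Qed.

(** The pairs of points whose images are at least [e] apart form a compact set [S] that misses the
    diagonal; the distance of the two points attains a positive minimum on [S], which serves as
    [d]. *)
Lemma disk_unif_continuous (r e : R) (f : C -> C) : 0 < e ->
  (forall z, nc z <= r -> {for z, continuous f}) ->
  exists2 d : R, 0 < d &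
    forall z w, nc z <= r -> nc w <= r -> nc (z - w) < d -> nc (f z - f w) < e.
Proof.
move=> e0 cf.
pose K := [set z : C | nc z <= r].
have cK : compact (K `*` K) by apply: compact_setX; exact: closed_disk_compact.
pose S := [set q : C * C | [/\ nc q.1 <= r, nc q.2 <= r & e <= nc (f q.1 - f q.2)]].
have cS : compact S.
  apply: (subclosed_compact _ cK); last by move=> [z w] [/= ? ? _].
  move=> [z w] hzw.
  have clo (d : R) : 0 < d -> exists q, S q /\ nc (q.1 - z) < d /\ nc (q.2 - w) < d.
    move=> d0; have /hzw[q [Sq [/= h1 h2]]] : nbhs (z, w)
        ([set z' | nc (z' - z) < d] `*` [set w' | nc (w' - w) < d]).
      by exists ([set z' | nc (z' - z) < d], [set w' | nc (w' - w) < d]) => //=;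
        split; apply/nbhs_diskP; exists d.
    by exists q.
  have zr : nc z <= r.
    rewrite leNgt; apply/negP => rz; have d0 : 0 < nc z - r by rewrite subr_gt0.
    have [q [[qr _ _] [qz _]]] := clo _ d0.
    by have := lt_le_trans qz (lerB (lexx _) qr); rewrite ltNge ncB ncBD.
  have wr : nc w <= r.
    rewrite leNgt; apply/negP => rz; have d0 : 0 < nc w - r by rewrite subr_gt0.
    have [q [[_ qr _] [_ qz]]] := clo _ d0.
    by have := lt_le_trans qz (lerB (lexx _) qr); rewrite ltNge ncB ncBD.
  split => //=; rewrite leNgt; apply/negP => fe.
  have e1 : 0 < (e - nc (f z - f w)) / 2 by rewrite divr_gt0// subr_gt0.
  have [d1 d10 h1] := (continuous_epsP f z).1 (cf _ zr) _ e1.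
  have [d2 d20 h2] := (continuous_epsP f w).1 (cf _ wr) _ e1.
  have dm : 0 < Num.min d1 d2 by rewrite lt_min d10.
  have [q [[_ _ qe] []]] := clo _ dm.
  rewrite !lt_min => /andP[/h1 k1 _] /andP[_ /h2 k2].
  move: qe; apply/negP; rewrite -ltNge.
  have -> : f q.1 - f q.2 = (f q.1 - f z) + (f z - f w) - (f q.2 - f w) by ring.
  apply: (le_lt_trans (ncD _ _)); rewrite ncN.
  have := ncD (f q.1 - f z) (f z - f w); lra.
have [[q0 Sq0]|nS] := pselect (S !=set0); last first.
  exists 1 => // z w zr wr _; rewrite ltNge; apply/negP => h.
  by apply: nS; exists (z, w).
have cd : {within S, continuous (fun q : C * C => nc (q.1 - q.2))}.
  apply: continuous_subspaceT => -[z w] A /=.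
  move=> /nbhs_ballP[d /= d0 hd].
  exists ([set z' | nc (z' - z) < d / 2], [set w' | nc (w' - w) < d / 2]) => /=.
    by split; apply/nbhs_diskP; exists (d / 2) => //; rewrite divr_gt0.
  move=> [z' w'] [/= h1 h2]; apply: hd; rewrite /ball /= /ball_ /=.
  rewrite distrC; apply: (le_lt_trans (nc_dist _ _)).
  have -> : z' - w' - (z - w) = (z' - z) - (w' - w) by ring.
  by have := ncD (z' - z) (- (w' - w)); rewrite ncN; lra.
have [q Sq hq] := compact_EVT_min (ex_intro _ _ Sq0) cS cd.
rewrite inE in Sq; exists (nc (q.1 - q.2)).
  rewrite nc_gt0 subr_eq0; apply/eqP => qq; have [_ _] := Sq.
  by rewrite qq subrr nc0 leNgt e0.
move=> z w zr wr zw; rewrite ltNge; apply/negP => h.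
have /hq : (z, w) \in S by rewrite inE.
by rewrite leNgt zw.
Qed.

Lemma disk_bounded (r : R) (f : C -> C) : 0 <= r ->
  (forall z, nc z <= r -> {for z, continuous f}) ->
  exists2 B : R, 0 <= B & forall z, nc z <= r -> nc (f z) <= B.
Proof.
move=> r0 cf; have [|z0 _ h] := @disk_max r (fun z => nc (f z)) r0.
  move=> z /cf /continuous_epsP cz; apply/continuousR_epsP => e /cz[d d0 hd].
  by exists d => // w /hd; apply: le_lt_trans; exact: nc_dist.
by exists (nc (f z0)); rewrite ?nc_ge0.
Qed.

End Compactness.

(** * Real differentiability *)

Section RealDifferentiability.
Variable R : realType.
Local Notation C := R[i].
Implicit Types (f g : C -> C) (z w a b u v c : C).

(* [a] and [b] are the Wirtinger derivatives of [f] at [z]; the quadratic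
   remainder holds for C^2 mappings and spares all o-notation. *)
Definition rdiff f z a b : Prop := exists K d : R, [/\ 0 <= K, 0 < d &
  forall v, nc v < d -> nc (f (z + v) - f z - (a * v + b * v^*)) <= K * nc v ^+ 2].

Lemma rdiff_ext f g z a b (d : R) : 0 < d ->
  (forall v, nc v < d -> f (z + v) = g (z + v)) -> rdiff f z a b -> rdiff g z a b.
Proof.
move=> d0 fg [K [d' [K0 d'0 h]]]; exists K, (Num.min d d'); split => //.
  by rewrite lt_min d0.
move=> v; rewrite lt_min => /andP[vd vd']; rewrite -(fg v vd).
have : g (z + 0) = f (z + 0) by rewrite -fg// nc0.
by rewrite addr0 => ->; exact: h.
Qed.

Lemma rdiff_cst c z : rdiff (fun=> c) z 0 0.
Proof.
exists 0, 1; split => // v _.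
by rewrite !mul0r addr0 subrr subr0 nc0.
Qed.

Lemma rdiff_id z : rdiff id z 1 0.
Proof.
exists 0, 1; split => // v _.
have -> : (z + v : C) - z - (1 * v + 0 * v^*) = 0 by ring.
by rewrite nc0 mul0r.
Qed.

Lemma rdiff_conj f z a b : rdiff f z a b -> rdiff (fun w => (f w)^*) z b^* a^*.
Proof.
move=> [K [d [K0 d0 h]]]; exists K, d; split => // v vd.
rewrite -ncJ !(rmorphB, rmorphD, rmorphM) /= !conjcK.
by rewrite [_ + a * _]addrC; exact: h.
Qed.

Lemma rdiffD f g z a b a' b' : rdiff f z a b -> rdiff g z a' b' ->
  rdiff (fun w => f w + g w) z (a + a') (b + b').
Proof.
move=> [K [d [K0 d0 h]]] [K' [d' [K'0 d'0 h']]].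
exists (K + K'), (Num.min d d'); split; rewrite ?addr_ge0 ?lt_min ?d0//.
move=> v; rewrite lt_min => /andP[/h hv /h' hv'].
have -> : f (z + v) + g (z + v) - (f z + g z) - ((a + a') * v + (b + b') * v^*) =
  (f (z + v) - f z - (a * v + b * v^*)) + (g (z + v) - g z - (a' * v + b' * v^*)).
  by ring.
by apply: (le_trans (ncD _ _)); rewrite mulrDl lerD.
Qed.

Lemma rdiff_lip f z a b : rdiff f z a b -> exists L d : R, [/\ 0 <= L, 0 < d &
  forall v, nc v < d -> nc (f (z + v) - f z) <= L * nc v].
Proof.
move=> [K [d [K0 d0 h]]].
exists (K + nc a + nc b), (Num.min d 1); split.
- by rewrite !addr_ge0 ?nc_ge0.
- by rewrite lt_min d0 ltr01.
move=> v; rewrite lt_min => /andP[vd v1].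
rewrite -[f (z + v) - f z](subrK (a * v + b * v^*)).
apply: (le_trans (ncD _ _)); rewrite 2!mulrDl -[leRHS]addrA lerD//.
  apply: (le_trans (h v vd)); rewrite ler_wpM2l// expr2 -[leRHS]mul1r.
  by rewrite ler_wpM2r ?nc_ge0// ltW.
by apply: (le_trans (ncD _ _)); rewrite !ncM ncJ.
Qed.

Lemma rdiff_continuous f z a b : rdiff f z a b -> {for z, continuous f}.
Proof.
move=> /rdiff_lip[L [d [L0 d0 h]]]; apply/continuous_epsP => e e0.
exists (Num.min d (e / (L + 1))).
  by rewrite lt_min d0 divr_gt0// ltr_wpDl.
move=> w; rewrite lt_min => /andP[/h]; rewrite (addrC z) subrK => hw.
rewrite ltr_pdivlMr ?ltr_wpDl// => wz.
by apply: (le_lt_trans hw); have := nc_ge0 (w - z); nra.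
Qed.

Lemma rdiffM f g z a b a' b' : rdiff f z a b -> rdiff g z a' b' ->
  rdiff (fun w => f w * g w) z (a * g z + f z * a') (b * g z + f z * b').
Proof.
move=> hf hg.
have [L [e [L0 e0 lf]]] := rdiff_lip hf; have [L' [e' [L'0 e'0 lg]]] := rdiff_lip hg.
move: hf hg => [K [d [K0 d0 h]]] [K' [d' [K'0 d'0 h']]].
exists (K * nc (g z) + nc (f z) * K' + L * L'), (Num.min (Num.min d d') (Num.min e e')); split.
- by rewrite !addr_ge0 ?mulr_ge0 ?nc_ge0.
- by rewrite !lt_min d0 d'0 e0.
move=> v; rewrite !lt_min => /andP[/andP[/h hv /h' hv'] /andP[/lf lv /lg lv']].
set F := f (z + v) in hv lv *; set G := g (z + v) in hv' lv' *.
have -> : F * G - f z * g z -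
    ((a * g z + f z * a') * v + (b * g z + f z * b') * v^*) =
  (F - f z - (a * v + b * v^*)) * g z + f z * (G - g z - (a' * v + b' * v^*)) +
  (F - f z) * (G - g z) by ring.
apply: (le_trans (ncD _ _)); rewrite [leRHS]mulrDl lerD//.
  apply: (le_trans (ncD _ _)); rewrite [leRHS]mulrDl !ncM lerD//.
    by rewrite mulrAC ler_wpM2r ?nc_ge0.
  by rewrite -mulrA ler_wpM2l ?nc_ge0.
by rewrite ncM expr2 mulrACA ler_pM ?nc_ge0.
Qed.

Lemma rdiffZ c f z a b : rdiff f z a b -> rdiff (fun w => c * f w) z (c * a) (c * b).
Proof.
by move=> /(rdiffM (rdiff_cst c z)); rewrite !mul0r !add0r.
Qed.

Lemma rdiff_sum (I : Type) (r : seq I) (P : pred I) (F : I -> C -> C) z (A B : I -> C) :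
  (forall i, P i -> rdiff (F i) z (A i) (B i)) ->
  rdiff (fun w => \sum_(i <- r | P i) F i w) z (\sum_(i <- r | P i) A i)
    (\sum_(i <- r | P i) B i).
Proof.
move=> h; elim: r => [|i r IH].
  have -> : (fun w => \sum_(i <- [::] | P i) F i w) = fun=> 0.
    by apply/funext => w; rewrite big_nil.
  by rewrite !big_nil; exact: rdiff_cst.
have -> : (fun w => \sum_(j <- i :: r | P j) F j w) =
    fun w => (if P i then F i w else 0) + \sum_(j <- r | P j) F j w.
  by apply/funext => w; rewrite big_cons; case: (P i) => //; rewrite add0r.
rewrite !big_cons; case Pi : (P i).
  by apply: rdiffD => //; exact: h.
by have := rdiffD (rdiff_cst 0 z) IH; rewrite !add0r.
Qed.

Lemma rdiff_horner (p : {poly C}) z : rdiff (fun w => p.[w]) z p^`().[z] 0.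
Proof.
elim/poly_ind: p => [|p c IH].
  rewrite deriv0 horner0; have := rdiff_cst 0 z.
  by congr rdiff; apply/funext => w; rewrite horner0.
have := rdiffD (rdiffM IH (rdiff_id z)) (rdiff_cst c z).
rewrite derivD derivC addr0 derivM derivX mulr1 !hornerE /= ?(mul0r, mulr0, addr0, mulr1).
by congr rdiff; apply/funext => w; rewrite !hornerE.
Qed.

Lemma is_derive_epsP (g : R -> R) (t0 l : R) : is_derive t0 1 g l <->
  forall e, 0 < e -> exists2 d : R, 0 < d &
    forall h, `|h| < d -> `|g (t0 + h) - g t0 - l * h| <= e * `|h|.
Proof.
have E : (fun h => h^-1 *: ((g \o shift t0) (h *: 1) - g t0)) =
    fun h => h^-1 *: (g (h + t0) - g t0).
  by apply/funext => h /=; rewrite /GRing.scale /= mulr1.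
split=> [[dg gl] e e0|hg].
  have cv : h^-1 *: ((g \o shift t0) (h *: 1) - g t0) @[h --> 0^'] --> l.
    by rewrite -gl; exact: dg.
  have /cvgrPdist_le/(_ _ e0) := cv.
  move=> /nbhs_ballP[d /= d0 hd].
  exists d => // h hd'.
  have [->|h0] := eqVneq h 0; first by rewrite addr0 mulr0 !subrr normr0 mulr0.
  have := hd h; rewrite /ball /= sub0r normrN => /(_ hd' h0).
  rewrite /GRing.scale /= mulr1 (addrC h) => hh.
  rewrite -[X in X <= _]mulr1 -(mulVf (_ : `|h| != 0)) ?normr_eq0// mulrA.
  rewrite [X in X * _]mulrC ler_pM2r ?normr_gt0//.
  rewrite -normrV ?unitfE// -normrM.
  rewrite (_ : h^-1 * _ = - (l - h^-1 * (g (t0 + h) - g t0))); last by field.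
  by rewrite normrN.
have cv : h^-1 *: (g (h + t0) - g t0) @[h --> 0^'] --> l.
  apply/cvgrPdist_le => e e0; have [d d0 hd] := hg _ e0; near=> h.
  have h0 : h != 0 by near: h; exact: nbhs_dnbhs_neq.
  have : `|h| < d by near: h; exact: dnbhs0_lt.
  move=> /hd; rewrite [t0 + h]addrC => hh.
  rewrite distrC -(ler_pM2r (_ : 0 < `|h|)) ?normr_gt0// -normrM.
  rewrite (_ : (_ - l) * h = g (h + t0) - g t0 - l * h)//.
  by rewrite /GRing.scale /=; field.
by apply: DeriveDef; [apply/cvg_ex; exists l|apply: cvg_lim => //]; rewrite E.
Unshelve. all: by end_near. Qed.

Lemma is_derive_quad (g : R -> R) (t0 l K d : R) : 0 < d ->
  (forall h, `|h| < d -> `|g (t0 + h) - g t0 - l * h| <= K * h ^+ 2) ->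
  is_derive t0 1 g l.
Proof.
move=> d0 hg; apply/is_derive_epsP => e e0.
have K0 : 0 <= K.
  have h0 : `|d / 2| < d by rewrite gtr0_norm ?divr_gt0// gtr_pMr// invf_lt1// ltr1n.
  have := le_trans (normr_ge0 _) (hg _ h0).
  by rewrite pmulr_lge0// exprn_gt0// divr_gt0.
exists (Num.min d (e / (K + 1))); first by rewrite lt_min d0 divr_gt0// ltr_wpDl.
move=> h; rewrite lt_min ltr_pdivlMr ?ltr_wpDl// => /andP[/hg hh he].
apply: (le_trans hh); rewrite -[h ^+ 2]real_normK ?num_real//.
by have := normr_ge0 h; nra.
Qed.

Lemma rdiff_line f z v (t0 : R) a b : rdiff f (z + t0%:C * v) a b ->
  is_derive t0 1 (fun t : R => complex.Re (f (z + t%:C * v)))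
    (complex.Re (a * v + b * v^*)).
Proof.
move=> [K [d [K0 d0 hK]]].
have d'0 : 0 < d / (nc v + 1) by rewrite divr_gt0// ltr_wpDl// nc_ge0.
apply: (@is_derive_quad _ _ _ (K * nc v ^+ 2) _ d'0) => h.
rewrite ltr_pdivlMr ?ltr_wpDl ?nc_ge0// => hd.
have hv : nc (h%:C * v) < d.
  by rewrite ncM ncR; apply: le_lt_trans hd; have := normr_ge0 h; nra.
have := hK _ hv; rewrite conjcMr ncM ncR exprMn real_normK ?num_real// => hh.
rewrite -mulrA [nc v ^+ 2 * _]mulrC; apply: le_trans hh.
suff -> : complex.Re (f (z + (t0 + h)%:C * v)) - complex.Re (f (z + t0%:C * v)) -
    complex.Re (a * v + b * v^*) * h =
    complex.Re (f (z + t0%:C * v + h%:C * v) - f (z + t0%:C * v) -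
      (a * (h%:C * v) + b * (h%:C * v^*))) by exact: Re_le_nc.
rewrite [RHS]reB [in RHS]reB.
have -> : a * (h%:C * v) + b * (h%:C * v^*) = h%:C * (a * v + b * v^*) by ring.
by rewrite reMr rmorphD /= mulrDl addrA [X in _ - X]mulrC.
Qed.

Lemma rdiff_line_Im f z v (t0 : R) a b : rdiff f (z + t0%:C * v) a b ->
  is_derive t0 1 (fun t : R => complex.Im (f (z + t%:C * v)))
    (complex.Im (a * v + b * v^*)).
Proof.
have ImE w : complex.Im w = complex.Re (- 'i%C * w).
  by case: w => x y /=; rewrite oppr0 mul0r mulN1r sub0r opprK.
move=> /(rdiffZ (- 'i%C)) /rdiff_line; rewrite -!mulrA -mulrDr -ImE.
by congr is_derive; apply/funext => t; rewrite -ImE.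
Qed.

Let lineX z (t : R) : t +i* complex.Im z = (0 +i* complex.Im z) + t%:C * 1.
Proof. by apply/eqP; rewrite eq_complex /=; apply/andP; split; apply/eqP; ring. Qed.

Let lineY z (t : R) : complex.Re z +i* t = (complex.Re z)%:C + t%:C * 'i%C.
Proof. by apply/eqP; rewrite eq_complex /=; apply/andP; split; apply/eqP; ring. Qed.

Lemma rdiff_partials f z a b : rdiff f z a b ->
  [/\ has_partials f z, pdx f z = a + b & pdy f z = 'i%C * (a - b)].
Proof.
move=> h.
have hx : rdiff f ((0 +i* complex.Im z) + (complex.Re z)%:C * 1) a b.
  by rewrite -lineX; case: (z) h.
have hy : rdiff f ((complex.Re z)%:C + (complex.Im z)%:C * 'i%C) a b.
  by rewrite -lineY; case: (z) h.
have fX (g : C -> R) : (fun t : R => g ((0 +i* complex.Im z) + t%:C * 1)) =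
    fun t : R => g (t +i* complex.Im z).
  by apply/funext => t; rewrite lineX.
have fY (g : C -> R) : (fun t : R => g ((complex.Re z)%:C + t%:C * 'i%C)) =
    fun t : R => g (complex.Re z +i* t).
  by apply/funext => t; rewrite lineY.
have := rdiff_line hx; rewrite (fX (fun w => complex.Re (f w))) => d1.
have := rdiff_line_Im hx; rewrite (fX (fun w => complex.Im (f w))) => d2.
have := rdiff_line hy; rewrite (fY (fun w => complex.Re (f w))) => d3.
have := rdiff_line_Im hy; rewrite (fY (fun w => complex.Im (f w))) => d4.
split.
- by split; [case: d1|case: d2|case: d3|case: d4].
- rewrite /pdx !derive1E (@derive_val _ _ _ _ _ _ _ d1) (@derive_val _ _ _ _ _ _ _ d2).
  by rewrite conjc1 !mulr1; case: (a + b).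
- rewrite /pdy !derive1E (@derive_val _ _ _ _ _ _ _ d3) (@derive_val _ _ _ _ _ _ _ d4).
  rewrite (_ : 'i%C^* = - 'i%C :> C); last by rewrite /= ; simpc.
  by rewrite mulrN -mulrBl mulrC; case: (_ * _).
Qed.

Lemma rdiff_wirtinger f z a b : rdiff f z a b -> dz f z = a /\ dzbar f z = b.
Proof.
move=> /rdiff_partials[_ hx hy]; rewrite /dz /dzbar hx hy !mulrA -expr2 sqr_i.
by split; field.
Qed.

End RealDifferentiability.

(** * Functions of one real variable *)

Section RealLines.
Variable R : realType.
Implicit Types (g dg : R -> R).

Lemma is_derive_shift g (t0 l s : R) :
  is_derive t0 1 (fun t => g (s + t)) l <-> is_derive (s + t0) 1 g l.
Proof.
by split=> /is_derive_epsP h; apply/is_derive_epsP => e /h[d d0 hd];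
  exists d => // x /hd; rewrite addrA.
Qed.

Lemma is_derive_cont g (t l : R) : is_derive t 1 g l -> {for t, continuous g}.
Proof. by move=> [dg _]; apply: differentiable_continuous; exact/derivable1_diffP. Qed.

Lemma MVT_seg g dg (a b : R) : a < b ->
  (forall t, a <= t <= b -> is_derive t 1 g (dg t)) ->
  exists2 c, a < c < b & g b - g a = dg c * (b - a).
Proof.
move=> ab hg; have [| |c cab E] := @MVT _ g dg a b ab.
- by move=> x; rewrite in_itv /= => /andP[ax xb]; apply: hg; rewrite !ltW.
- apply: continuous_in_subspaceT => x; rewrite inE /= in_itv /= => /hg.
  exact: is_derive_cont.
by exists c.
Qed.

(** At the maximum [dg] vanishes. Were [l] positive, [dg] would be positive just to the right of
    [t0], and by the mean value theorem [g] would exceed its maximum. *)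
Lemma second_derive_max g dg (t0 l d : R) : 0 < d ->
  (forall t, `|t - t0| < d -> is_derive t 1 g (dg t)) -> is_derive t0 1 dg l ->
  (forall t, `|t - t0| < d -> g t <= g t0) -> l <= 0.
Proof.
move=> d0 hg hg' gmax.
have dg0 : dg t0 = 0.
  have : is_derive t0 1 g 0.
    apply: (@derive1_at_max _ g (t0 - d) (t0 + d)).
    - by rewrite lerBlDr -addrA lerDl addr_ge0// ltW.
    - move=> t; rewrite in_itv /= => /andP[h1 h2].
      have h : `|t - t0| < d by rewrite ltr_norml; lra.
      by have [] := hg t h.
    - by rewrite in_itv /=; lra.
    - move=> t; rewrite in_itv /= => /andP[h1 h2]; apply: gmax.
      by rewrite ltr_norml; lra.
  have ht0 : `|t0 - t0| < d by rewrite subrr normr0.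
  by case: (hg t0 ht0) => _ <-; case.
rewrite leNgt; apply/negP => l0.
have [e e0 he] := (is_derive_epsP _ _ _).1 hg' _ (divr_gt0 l0 (ltr0Sn _ 1)).
pose h := Num.min e d / 2.
have m0 : 0 < Num.min e d by rewrite lt_min e0.
have h0 : 0 < h by rewrite divr_gt0.
have [he' hd] : h < e /\ h < d.
  have : h < Num.min e d by rewrite /h; lra.
  by rewrite lt_min => /andP.
have [| |t /andP[t1 t2] E] := @MVT_seg g dg t0 (t0 + h).
- by lra.
- by move=> t ht; apply: hg; rewrite ltr_norml; lra.
have : dg t * (t0 + h - t0) <= 0.
  rewrite -E subr_le0; apply: gmax.
  by rewrite addrC addKr gtr0_norm.
rewrite addrC addKr pmulr_lle0// => gt0.
have := he (t - t0); rewrite [t0 + _]addrC subrK dg0 subr0 gtr0_norm ?subr_gt0//.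
have lt1 : t - t0 < e by lra.
move=> /(_ lt1); rewrite ler_norml => /andP[+ _].
have : 0 < l * (t - t0) by rewrite mulr_gt0// subr_gt0.
by lra.
Qed.

End RealLines.

(** * Harmonic functions and harmonic polynomials *)

Section MaximumPrinciple.
Variable R : realType.
Local Notation C := R[i].
Implicit Types (u ux uy : C -> R) (z v w : C).

(** Only directional derivatives are required: total differentiability of a harmonic mapping is
    established later, in [harmonic_rdiff], with the help of the maximum principle. *)
Definition dline u z v (l : R) := is_derive (0 : R) 1 (fun t : R => u (z + t%:C * v)) l.

Lemma dline_shift u z v (t0 l : R) : dline u (z + t0%:C * v) v l <->
  is_derive t0 1 (fun t : R => u (z + t%:C * v)) l.
Proof.
rewrite /dline -[X in _ <-> is_derive X _ _ _]addr0 -is_derive_shift.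
suff -> : (fun t : R => u (z + t0%:C * v + t%:C * v)) =
  (fun t : R => u (z + (t0 + t)%:C * v)) by [].
by apply/funext => t; rewrite rmorphD /= mulrDl addrA.
Qed.

(* Adding eps x^2 makes the Laplacian positive, which excludes an interior maximum. *)
Lemma maximum_principle (r m : R) u ux uy uxx uyy :
  (forall z, nc z <= r -> {for z, continuous u}) ->
  (forall z, nc z < r -> [/\ dline u z 1 (ux z), dline ux z 1 (uxx z),
    dline u z 'i%C (uy z), dline uy z 'i%C (uyy z) & uxx z + uyy z = 0]) ->
  (forall z, nc z = r -> u z <= m) -> forall z, nc z <= r -> u z <= m.
Proof.
move=> cu du um z zr; have r0 : 0 <= r := le_trans (nc_ge0 z) zr.
have main e : 0 < e -> u z <= m + e * r ^+ 2.
  move=> e0; pose w x := u x + e * complex.Re x ^+ 2.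
  have [|z0 z0r wz0] := @disk_max _ r w r0.
    move=> x /cu /continuousR_epsP cx; apply/continuousR_epsP => d d0.
    have d20 : 0 < d / 2 by rewrite divr_gt0.
    have [d1 d10 h1] := cx _ d20.
    have B0 : 0 < e * (2 * `|complex.Re x| + 1).
      by rewrite mulr_gt0// ltr_wpDl// mulr_ge0.
    exists (Num.min 1 (Num.min d1 (d / 2 / (e * (2 * `|complex.Re x| + 1))))).
      by rewrite !lt_min ltr01 d10 divr_gt0.
    move=> y; rewrite !lt_min => /and3P[y1 /h1 hy]; rewrite ltr_pdivlMr// => yd.
    have -> : w y - w x = (u y - u x) + e * (complex.Re y - complex.Re x) *
        (complex.Re y - complex.Re x + 2 * complex.Re x) by rewrite /w; ring.
    apply: (le_lt_trans (ler_normD _ _)); rewrite !normrM (gtr0_norm e0).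
    have k1 := Re_le_nc (y - x); rewrite reB in k1.
    have k2 := ler_normD (complex.Re y - complex.Re x) (2 * complex.Re x).
    rewrite normrM (ger0_norm (ler0n _ 2)) in k2.
    suff : e * `|complex.Re y - complex.Re x| * `|complex.Re y - complex.Re x + 2 * complex.Re x|
      <= nc (y - x) * (e * (2 * `|complex.Re x| + 1)) by lra.
    rewrite -mulrA [leRHS]mulrCA ler_pM2l//; apply: ler_pM => //.
    by apply: (le_trans k2); lra.
  have [z0lt|] := ltP (nc z0) r; last first.
    move=> rz0; have z0E : nc z0 = r by apply/le_anti; rewrite z0r.
    have := wz0 z zr; rewrite /w.
    have : complex.Re z0 ^+ 2 <= r ^+ 2.
      by rewrite -z0E nc_sqr lerDl sqr_ge0.
    have := um z0 z0E; have := sqr_ge0 (complex.Re z); nra.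
  pose d := r - nc z0; have d0 : 0 < d by rewrite subr_gt0.
  have inD v (t : R) : nc v = 1 -> `|t - 0| < d -> nc (z0 + t%:C * v) < r.
    rewrite subr0 => v1 td; apply: (le_lt_trans (ncD _ _)).
    by rewrite ncM ncR v1 mulr1; rewrite /d in td; lra.
  have n1 : nc (1 : C) = 1 by exact: nc1.
  have ni : nc ('i%C : C) = 1 by rewrite /= expr0n expr1n add0r sqrtr1.
  have [k1 k2 k3 k4 k5] := du z0 z0lt.
  have hx : uxx z0 + 2 * e <= 0.
    apply: (@second_derive_max _ (fun t : R => w (z0 + t%:C * 1))
      (fun t : R => ux (z0 + t%:C * 1) + 2 * e * (complex.Re z0 + t)) 0 _ d d0).
    - move=> t /(inD _ _ n1) ht; have [h1 _ _ _ _] := du _ ht.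
      move/dline_shift: h1 => h1.
      have -> : (fun t : R => w (z0 + t%:C * 1)) =
          (fun t : R => u (z0 + t%:C * 1)) + (fun t : R => e * (complex.Re z0 + t) ^+ 2).
        by apply/funext => s; rewrite /w reD fctE /= !mulr1 ?mulr0 ?subr0.
      have h2 : is_derive t 1 (fun t : R => e * (complex.Re z0 + t) ^+ 2)
          (2 * e * (complex.Re z0 + t)).
        apply: (@is_derive_quad _ _ _ _ e _ ltr01) => h _.
        rewrite (_ : _ - _ - _ = e * h ^+ 2); last by ring.
        by rewrite ger0_norm// mulr_ge0 ?sqr_ge0// ltW.
      exact: is_deriveD.
    - have h1 : is_derive (0 : R) 1 (fun t : R => ux (z0 + t%:C * 1)) (uxx z0) := k2.
      have h2 : is_derive (0 : R) 1 (fun t : R => 2 * e * (complex.Re z0 + t)) (2 * e).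
        apply: (@is_derive_quad _ _ _ _ 0 _ ltr01) => h _.
        by rewrite (_ : _ - _ - _ = 0); [rewrite normr0 mul0r|ring].
      exact: is_deriveD.
    - move=> t /(inD _ _ n1) ht; apply: (le_trans (wz0 _ (ltW ht))).
      by rewrite (_ : (0 : R)%:C * 1 = 0) ?mul0r// addr0.
  have hy : uyy z0 <= 0.
    apply: (@second_derive_max _ (fun t : R => u (z0 + t%:C * 'i%C))
      (fun t : R => uy (z0 + t%:C * 'i%C)) 0 _ d d0).
    - move=> t /(inD _ _ ni) ht; have [_ _ h1 _ _] := du _ ht.
      exact/dline_shift.
    - exact: k4.
    - move=> t /(inD _ _ ni) ht; have := wz0 _ (ltW ht).
      rewrite /w (_ : (0 : R)%:C * 'i%C = 0) ?mul0r// addr0.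
      rewrite reD (_ : complex.Re (t%:C * 'i%C) = 0) ?addr0; last by rewrite /=; ring.
      by lra.
  lra.
apply/ler_addgt0Pr => e e0.
have := main (e / (r ^+ 2 + 1)) _.
have r20 : 0 < r ^+ 2 + 1 by rewrite ltr_wpDl// sqr_ge0.
rewrite divr_gt0// => /(_ isT) h; apply: (le_trans h); rewrite lerD2l.
by rewrite mulrAC ler_pdivrMr// ler_pM2l// lerDl.
Qed.

End MaximumPrinciple.

(** * Laplace's equation and comparison with harmonic polynomials *)

Section Harmonic.
Variable R : realType.
Local Notation C := R[i].
Implicit Types (f g : C -> C) (u : C -> R) (z v w c : C).

Lemma reE c z : complex.Re (c * z) =
  complex.Re c * complex.Re z - complex.Im c * complex.Im z.
Proof. by case: c; case: z. Qed.

Lemma re_inj z w : (forall c, complex.Re (c * z) = complex.Re (c * w)) -> z = w.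
Proof.
move=> h; apply/eqP; rewrite eq_complex; apply/andP; split; apply/eqP.
  by have := h 1; rewrite !mul1r.
have := h 'i%C; rewrite !reE /= !mul0r !mul1r !sub0r; exact: oppr_inj.
Qed.

Lemma dline_unique u z v (l l' : R) : dline u z v l -> dline u z v l' -> l = l'.
Proof. by move=> [_ <-] [_ <-]. Qed.

Lemma is_derive_re_mul (F : R -> C) c (s X Y : R) :
  is_derive s 1 (fun t => complex.Re (F t)) X ->
  is_derive s 1 (fun t => complex.Im (F t)) Y ->
  is_derive s 1 (fun t => complex.Re (c * F t)) (complex.Re (c * (X +i* Y))).
Proof.
move=> hX hY.
have h1 := is_deriveZ (complex.Re c) hX; have h2 := is_deriveZ (complex.Im c) hY.
have h := is_deriveB h1 h2; rewrite (reE c).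
by rewrite (_ : (fun t => complex.Re (c * F t)) = (fun t => complex.Re c * complex.Re (F t) -
  complex.Im c * complex.Im (F t))); [exact: h|apply/funext => t; rewrite (reE c)].
Qed.

(** The functions Re (c f), for all constants [c], carry both components of [f]; derivatives of
    complex mappings are handled through them so that the real maximum principle applies. *)
Lemma has_partials_dline f z : has_partials f z -> forall c,
  dline (fun w => complex.Re (c * f w)) z 1 (complex.Re (c * pdx f z)) /\
  dline (fun w => complex.Re (c * f w)) z 'i%C (complex.Re (c * pdy f z)).
Proof.
move=> [h1 h2 h3 h4] c; split.
  have := @is_derive_re_mul (fun s : R => f (s +i* complex.Im z)) c (complex.Re z) _ _
    (derivableP h1) (derivableP h2).
  rewrite -!derive1E -[X in is_derive X _ _ _]addr0.
  move=> h; move: ((is_derive_shift _ _ _ _).2 h); congr is_derive; apply/funext => t; congr (complex.Re (c * f _)).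
  by case: (z) => x y; apply/eqP; rewrite eq_complex /=; apply/andP; split; apply/eqP; ring.
have := @is_derive_re_mul (fun s : R => f (complex.Re z +i* s)) c (complex.Im z) _ _
  (derivableP h3) (derivableP h4).
rewrite -!derive1E -[X in is_derive X _ _ _]addr0.
move=> h; move: ((is_derive_shift _ _ _ _).2 h); congr is_derive; apply/funext => t; congr (complex.Re (c * f _)).
by case: (z) => x y; apply/eqP; rewrite eq_complex /=; apply/andP; split; apply/eqP; ring.
Qed.

Lemma dlineD u u' z v (l l' : R) : dline u z v l -> dline u' z v l' ->
  dline (fun w => u w + u' w) z v (l + l').
Proof. by move=> h h'; exact: (is_deriveD h h'). Qed.

Lemma dlineB u u' z v (l l' : R) : dline u z v l -> dline u' z v l' ->
  dline (fun w => u w - u' w) z v (l - l').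
Proof. by move=> h h'; exact: (is_deriveB h h'). Qed.

Lemma rdiff_dline f z v a b c : rdiff f z a b ->
  dline (fun w => complex.Re (c * f w)) z v (complex.Re (c * (a * v + b * v^*))).
Proof.
move=> /(rdiffZ c) h; rewrite mulrDr !mulrA.
have h0 : rdiff (fun w => c * f w) (z + (0 : R)%:C * v) (c * a) (c * b).
  by rewrite (_ : (0 : R)%:C = 0)// mul0r addr0.
exact: (rdiff_line h0).
Qed.

Lemma dline_partials f z (X Y : C) : (forall c,
  dline (fun w => complex.Re (c * f w)) z 1 (complex.Re (c * X)) /\
  dline (fun w => complex.Re (c * f w)) z 'i%C (complex.Re (c * Y))) ->
  [/\ has_partials f z, pdx f z = X & pdy f z = Y].
Proof.
move=> h.
suff H : has_partials f z.
  split => //; apply: re_inj => c; have [h1 h2] := has_partials_dline H c;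
  have [h3 h4] := h c; [exact: dline_unique h3|exact: dline_unique h4].
have imE w : complex.Im w = complex.Re (- 'i%C * w).
  by rewrite reE /=; ring.
have [k1 k3] := h 1; have [k2 k4] := h (- 'i%C).
have X1 (F : C -> R) l : dline F z 1 l ->
    derivable (fun t : R => F (t +i* complex.Im z)) (complex.Re z) 1.
  rewrite /dline (_ : (fun t : R => _) = fun t : R =>
      (fun s : R => F (s +i* complex.Im z)) (complex.Re z + t)).
    by move=> hl; have := (is_derive_shift (fun s : R => F (s +i* complex.Im z)) 0 l (complex.Re z)).1 hl; rewrite addr0; case.
  apply/funext => t; congr F.
  by case: (z) => x y; apply/eqP; rewrite eq_complex /=; apply/andP; split; apply/eqP; ring.
have Y1 (F : C -> R) l : dline F z 'i%C l ->
    derivable (fun t : R => F (complex.Re z +i* t)) (complex.Im z) 1.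
  rewrite /dline (_ : (fun t : R => _) = fun t : R =>
      (fun s : R => F (complex.Re z +i* s)) (complex.Im z + t)).
    by move=> hl; have := (is_derive_shift (fun s : R => F (complex.Re z +i* s)) 0 l (complex.Im z)).1 hl; rewrite addr0; case.
  apply/funext => t; congr F.
  by case: (z) => x y; apply/eqP; rewrite eq_complex /=; apply/andP; split; apply/eqP; ring.
have E1 : (fun w => complex.Re (1 * f w)) = fun w => complex.Re (f w).
  by apply/funext => w; rewrite mul1r.
have E2 : (fun w => complex.Re (- 'i%C * f w)) = fun w => complex.Im (f w).
  by apply/funext => w; rewrite imE.
rewrite E1 in k1 k3; rewrite E2 in k2 k4; split.
- exact: X1 k1.
- exact: X1 k2.
- exact: Y1 k3.
- exact: Y1 k4.
Qed.

Lemma has_partials_lin f g z a b : has_partials f z -> has_partials g z ->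
  [/\ has_partials (fun w => a * f w + b * g w) z,
   pdx (fun w => a * f w + b * g w) z = a * pdx f z + b * pdx g z &
   pdy (fun w => a * f w + b * g w) z = a * pdy f z + b * pdy g z].
Proof.
move=> /has_partials_dline hf /has_partials_dline hg; apply: dline_partials => c.
have -> : (fun w => complex.Re (c * (a * f w + b * g w))) =
    (fun w => complex.Re (c * a * f w) + complex.Re (c * b * g w)).
  by apply/funext => w; rewrite -reD mulrDr !mulrA.
rewrite !mulrDr !reD !mulrA; have [f1 f2] := hf (c * a); have [g1 g2] := hg (c * b).
by split; [exact: (dlineD f1 g1)|exact: (dlineD f2 g2)].
Qed.

(** The second difference is the increment in direction [v] of u(. + h w) - u(.). One mean value
    step brings in [uv], a second one [uvw]. *)
Lemma mixed_difference u uv uvw z v w (h : R) : 0 < h ->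
  (forall s t : R, 0 <= s <= h -> 0 <= t <= h ->
    dline u (z + s%:C * v + t%:C * w) v (uv (z + s%:C * v + t%:C * w)) /\
    dline uv (z + s%:C * v + t%:C * w) w (uvw (z + s%:C * v + t%:C * w))) ->
  exists s t : R, [/\ 0 < s < h, 0 < t < h &
    u (z + h%:C * v + h%:C * w) - u (z + h%:C * v) - u (z + h%:C * w) + u z =
    uvw (z + s%:C * v + t%:C * w) * h ^+ 2].
Proof.
move=> h0 hu; have hh : 0 <= h <= h by rewrite lexx ltW.
have h00 : 0 <= (0 : R) <= h by rewrite lexx ltW.
have [//| |s sh E] := @MVT_seg _
  (fun s : R => u (z + h%:C * w + s%:C * v) - u (z + s%:C * v))
  (fun s : R => uv (z + h%:C * w + s%:C * v) - uv (z + s%:C * v)) 0 h.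
  move=> s hs; apply: is_deriveB.
    by apply/dline_shift; have [+ _] := hu s h hs hh; rewrite addrAC.
  apply/dline_shift; have [+ _] := hu s 0 hs h00.
  by rewrite (_ : z + s%:C * v + 0%:C * w = z + s%:C * v)// mul0r addr0.
have sh' : 0 <= s <= h by case/andP: sh => *; rewrite !ltW.
have [//| |t th E'] := @MVT_seg _ (fun t : R => uv (z + s%:C * v + t%:C * w))
  (fun t : R => uvw (z + s%:C * v + t%:C * w)) 0 h.
  by move=> t ht; apply/dline_shift; have [] := hu s t sh' ht.
exists s, t; split=> //; move: E E'; rewrite !subr0.
rewrite (_ : (0 : R)%:C = 0)// !mul0r !addr0 => E E'.
rewrite [z + h%:C * v + h%:C * w]addrAC expr2 mulrA -E'.
by rewrite [z + s%:C * v + h%:C * w]addrAC -E; ring.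
Qed.

(** One second difference, read in both orders, is h^2 times a value of [uxy] and h^2 times a value
    of [uyx] at points near [z]; continuity of both does the rest. *)
Lemma schwarz_theorem u ux uy uxy uyx z (d : R) : 0 < d ->
  (forall w, nc (w - z) < d -> [/\ dline u w 1 (ux w), dline ux w 'i%C (uxy w),
     dline u w 'i%C (uy w) & dline uy w 1 (uyx w)]) ->
  {for z, continuous uxy} -> {for z, continuous uyx} -> uxy z = uyx z.
Proof.
move=> d0 hu /continuousR_epsP c1 /continuousR_epsP c2.
apply/eqP; rewrite -subr_eq0 -normr_le0; apply/ler_addgt0Pr => e e0; rewrite add0r.
have e20 : 0 < e / 2 by rewrite divr_gt0.
have [d1 d10 h1] := c1 _ e20; have [d2 d20 h2] := c2 _ e20.
pose m := Num.min d (Num.min d1 d2).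
have m0 : 0 < m by rewrite !lt_min d0 d10.
(* The points of the square of side [h] are within 2h < m of [z]. *)
pose h := m / 4; have h0 : 0 < h by rewrite divr_gt0.
have ni : nc ('i%C : C) = 1 by rewrite /= expr0n expr1n add0r sqrtr1.
have near (s t : R) v w : nc v = 1 -> nc w = 1 -> 0 <= s <= h -> 0 <= t <= h ->
    nc (z + s%:C * v + t%:C * w - z) < m.
  move=> v1 w1 /andP[s0 sh] /andP[t0 th].
  rewrite (_ : _ - z = s%:C * v + t%:C * w); last by ring.
  apply: (le_lt_trans (ncD _ _)); rewrite !ncM !ncR v1 w1 !mulr1 !ger0_norm//.
  have : h = m / 4 by []. lra.
have mE w : nc (w - z) < m -> [/\ nc (w - z) < d, nc (w - z) < d1 & nc (w - z) < d2].
  by rewrite !lt_min => /and3P.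
have [s [t [/andP[s0 s1] /andP[t0 t1] E]]] := @mixed_difference u ux uxy z 1 'i%C h h0
  (fun s t hs ht => let: And3 k _ _ := mE _ (near s t _ _ (nc1 _) ni hs ht) in
    let: And4 k1 k2 _ _ := hu _ k in conj k1 k2).
have [s' [t' [/andP[s'0 s'1] /andP[t'0 t'1] E']]] := @mixed_difference u uy uyx z 'i%C 1 h h0
  (fun s t hs ht => let: And3 k _ _ := mE _ (near s t _ _ ni (nc1 _) hs ht) in
    let: And4 _ _ k1 k2 := hu _ k in conj k1 k2).
have : uxy (z + s%:C * 1 + t%:C * 'i%C) = uyx (z + s'%:C * 'i%C + t'%:C * 1).
  apply: (@mulIf _ (h ^+ 2)); first by rewrite expf_neq0// gt_eqF.
  rewrite -E -E'; rewrite [z + h%:C * 1 + _]addrAC; ring.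
have cc (x : R) : 0 < x -> x < h -> 0 <= x <= h by move=> *; rewrite !ltW.
have [_ /h1 k1 _] := mE _ (near s t _ _ (nc1 _) ni (cc s s0 s1) (cc t t0 t1)).
have [_ _ /h2 k2] := mE _ (near s' t' _ _ ni (nc1 _) (cc s' s'0 s'1) (cc t' t'0 t'1)).
move=> k3.
have -> : uxy z - uyx z = (uyx (z + s'%:C * 'i%C + t'%:C * 1) - uyx z) -
   (uxy (z + s%:C * 1 + t%:C * 'i%C) - uxy z) by rewrite k3; ring.
apply: (le_trans (ler_normB _ _)); lra.
Qed.

Lemma continuous_re f z c : {for z, continuous f} ->
  {for z, continuous (fun w => complex.Re (c * f w))}.
Proof.
move=> /continuous_epsP k; apply/continuousR_epsP => e e0.
have [d d0 hd] := k (e / (nc c + 1)) (divr_gt0 e0 (ltr_wpDl (nc_ge0 c) ltr01)).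
exists d => // w /hd; rewrite ltr_pdivlMr ?ltr_wpDl ?nc_ge0// => hw.
rewrite -reB -mulrBr; apply: (le_lt_trans (Re_le_nc _)); rewrite ncM.
by apply: le_lt_trans hw; have := nc_ge0 (f w - f z); nra.
Qed.

Lemma disk_sub z w : nc z < 1 -> nc (w - z) < 1 - nc z -> nc w < 1.
Proof. by move=> z1 wz; have := ncD (w - z) z; rewrite subrK; lra. Qed.

(** Expanding [4 * dzbar (dz f)] produces the two pure second derivatives and the two mixed ones
    with factors i and -i; the latter cancel by symmetry. *)
Lemma harmonic_laplace f z : Defs.harmonic f -> nc z < 1 ->
  pdx (pdx f) z + pdy (pdy f) z = 0.
Proof.
move=> [[c1 c1x c1y] lap] z1.
have D w : nc w < 1 -> unit_disk w by rewrite /unit_disk /disk /= subr0.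
have [px _ _] := c1x z (D z z1); have [py _ _] := c1y z (D z z1).
have mix : pdy (pdx f) z = pdx (pdy f) z.
  apply: re_inj => c; apply: (@schwarz_theorem (fun w => complex.Re (c * f w))
    (fun w => complex.Re (c * pdx f w)) (fun w => complex.Re (c * pdy f w))
    (fun w => complex.Re (c * pdy (pdx f) w)) (fun w => complex.Re (c * pdx (pdy f) w))
    z (1 - nc z)); first by rewrite subr_gt0.
  - move=> w /(disk_sub z1)/D Dw.
    have [/has_partials_dline/(_ c)[k1 k2] _ _] := c1 w Dw.
    have [/has_partials_dline/(_ c)[_ k3] _ _] := c1x w Dw.
    by have [/has_partials_dline/(_ c)[k4 _] _ _] := c1y w Dw.
  - by apply: continuous_re; have [] := c1x z (D z z1).
  - by apply: continuous_re; have [] := c1y z (D z z1).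
have E : dz f = fun w => 2^-1 * pdx f w + (- 'i%C / 2) * pdy f w.
  by apply/funext => w; rewrite /dz; field.
have [_ hx _] := has_partials_lin 2^-1 (- 'i%C / 2) px py.
have [_ _ hy] := has_partials_lin 2^-1 (- 'i%C / 2) px py.
have := lap z (D z z1); rewrite /laplacian /dzbar E hx hy mix => <-.
have i2 : 'i%C * 'i%C = -1 :> C by rewrite -expr2 sqr_i.
suff alg (a m b : C) : 4 * ((2^-1 * a + (- 'i%C / 2) * m +
    'i%C * (2^-1 * m + (- 'i%C / 2) * b)) / 2) = a + b by rewrite alg.
have -> : a + b = a - 'i%C * 'i%C * b by rewrite i2; ring.
by move: ('i%C : C) => i; field.
Qed.

Definition hpoly (p q : {poly C}) z : C := p.[z] + (q.[z])^*.

Lemma rdiff_hpoly p q z : rdiff (hpoly p q) z p^`().[z] (q^`().[z])^*.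
Proof.
have := rdiffD (rdiff_horner p z) (rdiff_conj (rdiff_horner q z)).
by rewrite conjc0 addr0 add0r.
Qed.

(** The difference of [f] and a harmonic polynomial has harmonic components, so the real part of
    each of its rotations obeys the maximum principle, and closeness spreads from the circle to the
    disk. *)
Lemma harmonic_max f p q (r e : R) : Defs.harmonic f ->
  (forall z, nc z < 1 -> {for z, continuous f}) -> r < 1 ->
  (forall z, nc z = r -> nc (f z - hpoly p q z) <= e) ->
  forall z, nc z <= r -> nc (f z - hpoly p q z) <= e.
Proof.
move=> hf cf r1 he z zr; apply: nc_le_Re => c c1.
have [[C1f C1x C1y] _] := hf.
have D w : nc w < 1 -> unit_disk w by rewrite /unit_disk /disk /= subr0.
(* The derivative of [hpoly p q] in direction i. Differentiated once more in that direction it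
   becomes minus the second derivative in direction 1, whence the plus sign in the last function
   below. *)
pose Qy := fun w => p^`().[w] * 'i%C + (q^`().[w] * 'i%C)^*.
apply: (@maximum_principle _ r e (fun w => complex.Re (c * (f w - hpoly p q w)))
  (fun w => complex.Re (c * (pdx f w - hpoly p^`() q^`() w)))
  (fun w => complex.Re (c * (pdy f w - Qy w)))
  (fun w => complex.Re (c * (pdx (pdx f) w - hpoly p^`()^`() q^`()^`() w)))
  (fun w => complex.Re (c * (pdy (pdy f) w + hpoly p^`()^`() q^`()^`() w)))).
- move=> w wr; apply: continuous_re.
  have cQ := rdiff_continuous (rdiff_hpoly p q w).
  exact: (continuousB (cf w (le_lt_trans wr r1)) cQ).
- move=> w wr; have w1 : nc w < 1 by apply: lt_trans r1.
  have [/has_partials_dline/(_ c)[k1 k2] _ _] := C1f w (D w w1).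
  have [/has_partials_dline/(_ c)[k3 _] _ _] := C1x w (D w w1).
  have [/has_partials_dline/(_ c)[_ k4] _ _] := C1y w (D w w1).
  have B g h v (X Y : C) : dline (fun w => complex.Re (c * g w)) w v (complex.Re (c * X)) ->
      dline (fun w => complex.Re (c * h w)) w v (complex.Re (c * Y)) ->
      dline (fun w => complex.Re (c * (g w - h w))) w v (complex.Re (c * (X - Y))).
    move=> hg hh; have := dlineB hg hh; rewrite -reB -mulrBr.
    by congr dline; apply/funext => x; rewrite -reB -mulrBr.
  split.
  + apply: (B f (hpoly p q) 1 (pdx f w) (hpoly p^`() q^`() w) k1); have := rdiff_dline 1 c (rdiff_hpoly p q w).
    by rewrite conjc1 !mulr1.
  + apply: (B (pdx f) (hpoly p^`() q^`()) 1 (pdx (pdx f) w) (hpoly p^`()^`() q^`()^`() w) k3); have := rdiff_dline 1 c (rdiff_hpoly p^`() q^`() w).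
    by rewrite conjc1 !mulr1.
  + apply: (B f (hpoly p q) 'i%C (pdy f w) (Qy w) k2); have := rdiff_dline 'i%C c (rdiff_hpoly p q w).
    by rewrite /Qy rmorphM.
  + rewrite -[hpoly _ _ w]opprK; apply: (B (pdy f) Qy 'i%C (pdy (pdy f) w) (- hpoly p^`()^`() q^`()^`() w) k4).
    have -> : - hpoly p^`()^`() q^`()^`() w =
      p^`()^`().[w] * 'i%C * 'i%C + ((q^`()^`().[w])^* * 'i%C^*) * 'i%C^*.
      rewrite /hpoly (_ : 'i%C^* = - 'i%C); last by rewrite /=; simpc.
      have i2 : 'i%C * 'i%C = -1 :> C by rewrite -expr2 sqr_i.
      by rewrite -!mulrA mulrNN i2; ring.
    apply: rdiff_dline.
    have hp := rdiffM (rdiff_horner p^`() w) (rdiff_cst 'i%C w).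
    have hq := rdiff_conj (rdiffM (rdiff_horner q^`() w) (rdiff_cst 'i%C w)).
    have := rdiffD hp hq.
    by rewrite !mulr0 !mul0r !addr0 conjc0 addr0 add0r rmorphM.
  + rewrite -reD -mulrDr.
    set H := hpoly _ _ w; have -> : pdx (pdx f) w - H + (pdy (pdy f) w + H) = 0.
      by rewrite addrACA addNr addr0; exact: harmonic_laplace.
    by rewrite mulr0.
- move=> w wr; apply: (le_trans (Re_le_ncW _)); rewrite ncM c1 mul1r; exact: he.
- exact: zr.
Qed.

End Harmonic.

(** * Approximation by harmonic polynomials *)

Section RootsOfUnity.
Variable R : realType.
Local Notation C := R[i].
Implicit Types (p q : {poly C}) (z w : C).

Definition expi (t : R) : C := cos t +i* sin t.

Lemma expiD (a b : R) : expi (a + b) = expi a * expi b.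
Proof.
by rewrite /expi cosD sinD; apply/eqP; rewrite eq_complex /=; apply/andP; split;
  apply/eqP; ring.
Qed.

Lemma expi0 : expi 0 = 1.
Proof. by rewrite /expi cos0 sin0. Qed.

Lemma expiX (t : R) n : expi t ^+ n = expi (t * n%:R).
Proof.
elim: n => [|n IH]; first by rewrite expr0 mulr0 expi0.
by rewrite exprS IH -expiD -natr1 mulrDr mulr1 addrC.
Qed.

Lemma nc_expi (t : R) : nc (expi t) = 1.
Proof. by rewrite /= cos2Dsin2 sqrtr1. Qed.

Definition uroot (N : nat) : C := expi (2 * pi / N%:R).

Lemma nc_uroot N j : nc (uroot N ^+ j) = 1.
Proof. by rewrite ncX nc_expi expr1n. Qed.

Lemma urootN N : (0 < N)%N -> uroot N ^+ N = 1.
Proof.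
move=> N0; have N0' : (N%:R : R) != 0 by rewrite pnatr_eq0 -lt0n.
rewrite expiX divfK// mulr_natl mulr2n expiD /expi cospi sinpi.
by apply/eqP; rewrite eq_complex /=; apply/andP; split; apply/eqP; ring.
Qed.

(** The power is [expi t * expi t] with 0 < t < pi. Were it 1, [expi t] would equal its conjugate,
    yet its imaginary part [sin t] is positive. *)
Lemma uroot_neq1 N k : (0 < k < N)%N -> uroot N ^+ k != 1.
Proof.
move=> /andP[k0 kN]; have N0 : (0 < N)%N := ltn_trans k0 kN.
have N0' : 0 < N%:R :> R by rewrite ltr0n.
pose t : R := pi * k%:R / N%:R.
have st : 0 < sin t.
  apply: sin_gt0_pi; rewrite divr_gt0 ?mulr_gt0 ?pi_gt0 ?ltr0n//=.
  by rewrite ltr_pdivrMr// ltr_pM2l ?pi_gt0// ltr_nat.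
have -> : uroot N ^+ k = expi t * expi t.
  rewrite expiX -expiD /t; congr expi; ring.
apply/eqP => h.
have h2 : expi t = (expi t)^*.
  apply: (mulfI (_ : expi t != 0)); first by rewrite -nc_gt0 nc_expi.
  by rewrite h mulcJ nc_expi expr1n.
move: h2; rewrite /expi => /eqP; rewrite eq_complex /= => /andP[_].
by rewrite -subr_eq0 opprK -mulr2n mulrn_eq0 /= (gt_eqF st).
Qed.

Lemma sum_uroot N k : (0 < k < N)%N -> \sum_(j < N) (uroot N ^+ j) ^+ k = 0.
Proof.
move=> kN; have N0 : (0 < N)%N by case/andP: kN => _; apply: leq_ltn_trans.
have /mulfI : uroot N ^+ k - 1 != 0 by rewrite subr_eq0 uroot_neq1.
apply; rewrite mulr0.
have -> : \sum_(j < N) (uroot N ^+ j) ^+ k = \sum_(j < N) (uroot N ^+ k) ^+ j.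
  by apply: eq_bigr => j _; rewrite -!exprM mulnC.
by rewrite -subrX1 -exprM mulnC exprM urootN// expr1n subrr.
Qed.

Lemma sum_uroot_conj N k : (0 < k < N)%N -> \sum_(j < N) ((uroot N ^+ j)^*) ^+ k = 0.
Proof.
move=> kN.
have -> : \sum_(j < N) ((uroot N ^+ j)^*) ^+ k = \sum_(j < N) ((uroot N ^+ j) ^+ k)^*.
  by apply: eq_bigr => j _; rewrite [RHS]conjX.
by rewrite -conj_sum sum_uroot// conjc0.
Qed.

Lemma uroot_orthogonal N i k : (i < N)%N -> (k < N)%N ->
  \sum_(j < N) (uroot N ^+ j) ^+ i * ((uroot N ^+ j)^*) ^+ k = (N * (i == k))%:R.
Proof.
have E w m n : nc w = 1 -> (m <= n)%N -> w ^+ n * (w^*) ^+ m = w ^+ (n - m).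
  by move=> w1 mn; rewrite -{1}(subnK mn) exprD -mulrA -exprMn mulcJ w1 !expr1n mulr1.
have E' w m n : nc w = 1 -> (m <= n)%N -> w ^+ m * (w^*) ^+ n = w^* ^+ (n - m).
  move=> w1 mn; rewrite -{1}(subnK mn) exprD mulrCA -exprMn mulcJ w1.
  by rewrite !expr1n mulr1.
move=> iN kN; case: (ltngtP i k) => ik.
- rewrite muln0 mulr0n; transitivity (\sum_(j < N) ((uroot N ^+ j)^*) ^+ (k - i)).
    by apply: eq_bigr => j _; rewrite E' ?nc_uroot// ltnW.
  apply: sum_uroot_conj.
  by rewrite subn_gt0 ik/=; apply: leq_ltn_trans kN; exact: leq_subr.
- rewrite muln0 mulr0n; transitivity (\sum_(j < N) (uroot N ^+ j) ^+ (i - k)).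
    by apply: eq_bigr => j _; rewrite E ?nc_uroot// ltnW.
  apply: sum_uroot.
  by rewrite subn_gt0 ik/=; apply: leq_ltn_trans iN; exact: leq_subr.
- rewrite ik muln1 -[in RHS](card_ord N) -sumr_const.
  by apply: eq_bigr => j _; rewrite E ?nc_uroot// subnn.
Qed.

Lemma hpoly_wide p q z (L : nat) : (size p <= L)%N -> (size q <= L)%N ->
  hpoly p q z = \sum_(i < L) (p`_i * z ^+ i + (q`_i)^* * (z^*) ^+ i).
Proof.
move=> hp hq; rewrite /hpoly (horner_coef_wide _ hp) (horner_coef_wide _ hq).
rewrite conj_sum big_split /=; congr (_ + _).
by apply: eq_bigr => i _; rewrite conjM [in LHS]conjX.
Qed.

(** A discrete Fourier coefficient. [L + L <= N] excludes aliasing: the analytic part meets the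
    frequencies i - n, the conjugate part i + n, and the latter lies strictly between 0 and [N]. *)
Lemma dft_hpoly p q z (L N n : nat) : (size p <= L)%N -> (size q <= L)%N ->
  (L + L <= N)%N -> (0 < n < L)%N ->
  \sum_(j < N) hpoly p q (z * uroot N ^+ j) * ((uroot N ^+ j)^*) ^+ n =
  N%:R * (p`_n * z ^+ n).
Proof.
move=> hp hq LN /andP[n0 nL].
have nN : (n < N)%N by exact: leq_trans nL (leq_trans (leq_addr _ _) LN).
under eq_bigr => j _ do rewrite (hpoly_wide _ hp hq) mulr_suml.
rewrite exchange_big /=.
under eq_bigr => i _.
  under eq_bigr => j _.
    rewrite (_ : (_ + _) * _ = (p`_i * z ^+ i) * ((uroot N ^+ j) ^+ i * ((uroot N ^+ j)^*) ^+ n)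
      + ((q`_i)^* * (z^*) ^+ i) * ((uroot N ^+ j)^*) ^+ (i + n)); last first.
      by rewrite conjM !exprMn exprD; ring.
    over.
  rewrite big_split /= -!mulr_sumr uroot_orthogonal//; last first.
    exact: leq_trans (ltn_ord i) (leq_trans (leq_addr _ _) LN).
  rewrite sum_uroot_conj ?mulr0 ?addr0; last first.
    rewrite addn_gt0 n0 orbT /=; apply: leq_trans LN.
    by rewrite -addnS leq_add// ltnW.
  over.
rewrite (bigD1 (Ordinal nL)) //= [X in _ + X]big1 ?addr0 => [|i ni].
  by rewrite eqxx muln1 mulrC.
by rewrite (_ : (i == n :> nat) = false) ?muln0 ?mulr0//; apply/negbTE.
Qed.

Lemma dft_hpoly_conj p q z (L N n : nat) : (size p <= L)%N -> (size q <= L)%N ->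
  (L + L <= N)%N -> (0 < n < L)%N ->
  \sum_(j < N) hpoly p q (z * uroot N ^+ j) * (uroot N ^+ j) ^+ n =
  N%:R * ((q`_n)^* * (z^*) ^+ n).
Proof.
move=> hp hq LN nL; have E := dft_hpoly z hq hp LN nL.
transitivity ((N%:R * (q`_n * z ^+ n))^* : C).
  rewrite -E conj_sum; apply: eq_bigr => j _.
  by rewrite [RHS]conjM [X in _ = _ * X]conjX conjcK /hpoly conjD conjcK addrC.
by rewrite !conjM conj_nat [(z ^+ n)^*]conjX.
Qed.

Lemma dft0_hpoly p q z (L N : nat) : (size p <= L.+1)%N -> (size q <= L.+1)%N ->
  (L < N)%N -> \sum_(j < N) hpoly p q (z * uroot N ^+ j) = N%:R * (p`_0 + (q`_0)^*).
Proof.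
move=> hp hq LN.
under eq_bigr => j _ do rewrite (hpoly_wide _ hp hq).
rewrite exchange_big /= big_ord_recl [X in _ + X]big1 ?addr0.
  under eq_bigr => j _ do rewrite !expr0 !mulr1.
  by rewrite sumr_const card_ord mulr_natl.
move=> i _; rewrite lift0.
under eq_bigr => j _ do rewrite conjM !exprMn !mulrA.
rewrite big_split /= -!mulr_sumr sum_uroot ?sum_uroot_conj ?mulr0 ?addr0//=.
- exact: leq_ltn_trans (ltn_ord i) LN.
- exact: leq_ltn_trans (ltn_ord i) LN.
Qed.

(** Expanding one factor of Q conj Q turns the right side into Fourier coefficients of [hpoly p q].
    With the constant term, in which [p] and [q] mix, it is an equality; that term is dropped
    here. *)
Lemma parseval_hpoly p q z (L N : nat) : (size p <= L)%N -> (size q <= L)%N ->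
  (L + L <= N)%N ->
  N%:R * \sum_(1 <= n < L) (nc p`_n ^+ 2 + nc q`_n ^+ 2) * nc z ^+ (2 * n) <=
  \sum_(j < N) nc (hpoly p q (z * uroot N ^+ j)) ^+ 2.
Proof.
move=> hp hq LN; case: L hp hq LN => [|L] hp hq LN.
  by rewrite big_geq// mulr0 sumr_ge0// => j _; rewrite sqr_ge0.
have LN' : (L < N)%N by apply: leq_trans LN; exact: leq_addr.
suff E : (\sum_(j < N) nc (hpoly p q (z * uroot N ^+ j)) ^+ 2)%:C =
    (N%:R * (nc (p`_0 + (q`_0)^*) ^+ 2 +
     \sum_(1 <= n < L.+1) (nc p`_n ^+ 2 + nc q`_n ^+ 2) * nc z ^+ (2 * n)))%:C.
  by case: E => ->; rewrite mulrDr lerDr mulr_ge0// sqr_ge0.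
rewrite rc_sum.
have -> : \sum_(j < N) (nc (hpoly p q (z * uroot N ^+ j)) ^+ 2)%:C =
  \sum_(j < N) \sum_(i < L.+1) ((p`_i)^* * z^* ^+ i *
      (hpoly p q (z * uroot N ^+ j) * (uroot N ^+ j)^* ^+ i) + q`_i * z ^+ i *
      (hpoly p q (z * uroot N ^+ j) * (uroot N ^+ j) ^+ i)).
  apply: eq_bigr => j _; rewrite -mulcJ {2}(hpoly_wide _ hp hq) conj_sum mulr_sumr.
  apply: eq_bigr => i _; set Q := hpoly _ _ _; set w := uroot N ^+ j.
  rewrite conjD [(p`_i * _)^*]conjM [(_^* * _)^*]conjM conjcK.
  rewrite [((z * w) ^+ i)^*]conjX [((z * w)^* ^+ i)^*]conjX conjcK conjM !exprMn.
  by ring.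
rewrite exchange_big big_ord_recl /=.
under eq_bigr => j _ do rewrite !expr0 !mulr1 -mulrDl.
rewrite -mulr_sumr (@dft0_hpoly _ _ _ L)// rcM rc_nat rcD [RHS]mulrDr; congr (_ + _).
  rewrite -mulcJ conjD conjcK; ring.
rewrite big_add1 /= big_mkord rc_sum mulr_sumr; apply: eq_bigr => i _.
rewrite /bump add1n big_split /= -!mulr_sumr.
have iL : (0 < i.+1 < L.+1)%N by exact: ltn_ord i.
rewrite (dft_hpoly z hp hq LN iL) (dft_hpoly_conj z hp hq LN iL).
rewrite rcM rcD -!mulcJ.
rewrite (_ : (nc z ^+ (2 * i.+1))%:C = z ^+ i.+1 * z^* ^+ i.+1); first by ring.
by rewrite -exprMn mulcJ -rcX exprM.
Qed.

Lemma bessel_hpoly p q (r B : R) (L : nat) : 0 <= r ->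
  (forall z, nc z = r -> nc (hpoly p q z) <= B) ->
  \sum_(1 <= n < L) (nc p`_n ^+ 2 + nc q`_n ^+ 2) * r ^+ (2 * n) <= B ^+ 2.
Proof.
move=> r0 hB; pose m := (size p + size q + L)%N.
have N0 : 0 < ((m + m).+1)%:R :> R by rewrite ltr0n.
have hp : (size p <= m)%N by rewrite /m -addnA leq_addr.
have hq : (size q <= m)%N by rewrite /m addnAC leq_addl.
have hL : (L <= m)%N by rewrite /m leq_addl.
apply: (@le_trans _ _ (\sum_(1 <= n < m) (nc p`_n ^+ 2 + nc q`_n ^+ 2) * r ^+ (2 * n))).
  case: L @m hp hq hL N0 => [|L] m hp hq hL _.
    rewrite big_geq// sumr_ge0// => n _.
    by rewrite mulr_ge0 ?exprn_ge0// addr_ge0// sqr_ge0.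
  rewrite (big_cat_nat _ hL)//= lerDl sumr_ge0// => n _.
  by rewrite mulr_ge0 ?exprn_ge0// addr_ge0// sqr_ge0.
have := parseval_hpoly r%:C hp hq (leqnSn _); rewrite ncR ger0_norm// => h.
rewrite -(ler_pM2l N0); apply: (le_trans h).
rewrite mulr_natl -[in leRHS](card_ord (m + m).+1) -sumr_const ler_sum// => j _.
have hj : nc (hpoly p q (r%:C * uroot (m + m).+1 ^+ j)) <= B.
  by apply: hB; rewrite ncM nc_uroot mulr1 ncR ger0_norm.
by rewrite ler_pXn2r// nnegrE ?nc_ge0// (le_trans (nc_ge0 _) hj).
Qed.

Lemma coef_hpoly_le p q (r B : R) n : 0 <= r -> (0 < n)%N ->
  (forall z, nc z = r -> nc (hpoly p q z) <= B) ->
  nc p`_n * r ^+ n <= B /\ nc q`_n * r ^+ n <= B.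
Proof.
move=> r0 n0 hB.
have B0 : 0 <= B.
  by apply: le_trans (nc_ge0 _) (hB r%:C _); rewrite ncR ger0_norm.
have := bessel_hpoly n.+1 r0 hB; rewrite big_nat_recr//= => h.
have S0 : 0 <= \sum_(1 <= i < n) (nc p`_i ^+ 2 + nc q`_i ^+ 2) * r ^+ (2 * i).
  by rewrite sumr_ge0// => i _; rewrite mulr_ge0 ?exprn_ge0// addr_ge0// sqr_ge0.
have sq (x : R) : 0 <= x -> x ^+ 2 * r ^+ (2 * n) <= B ^+ 2 -> x * r ^+ n <= B.
  by move=> x0; rewrite mulnC exprM -exprMn ler_pXn2r// nnegrE mulr_ge0// exprn_ge0.
have r2 : 0 <= r ^+ (2 * n) by rewrite exprn_ge0.
split; apply: sq; rewrite ?nc_ge0//; move: h; rewrite mulrDl.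
  have := mulr_ge0 (sqr_ge0 (nc q`_n)) r2; lra.
have := mulr_ge0 (sqr_ge0 (nc p`_n)) r2; lra.
Qed.

End RootsOfUnity.

(** * Uniform approximation on a circle by discrete convolution *)

Section CircleApproximation.
Variable R : realType.
Local Notation C := R[i].
Implicit Types (p q : {poly C}) (z w x c : C).

Lemma unimod_expB w m n : nc w = 1 -> (m <= n)%N -> w ^+ n * (w^*) ^+ m = w ^+ (n - m).
Proof.
by move=> w1 mn; rewrite -{1}(subnK mn) exprD -mulrA -exprMn mulcJ w1 !expr1n mulr1.
Qed.

Lemma unimod_expBC w m n : nc w = 1 -> (m <= n)%N -> w ^+ m * (w^*) ^+ n = w^* ^+ (n - m).
Proof.
move=> w1 mn; rewrite -{1}(subnK mn) exprD mulrCA -exprMn mulcJ w1.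
by rewrite !expr1n mulr1.
Qed.

Definition is_hpoly (Q : C -> C) := exists p q, forall z, Q z = hpoly p q z.

Lemma is_hpolyZ c Q : is_hpoly Q -> is_hpoly (fun z => c * Q z).
Proof.
move=> [p [q h]]; exists (c *: p), (c^* *: q) => z.
by rewrite h /hpoly !hornerZ conjM conjcK mulrDr.
Qed.

Lemma is_hpoly_sum (I : Type) (r : seq I) (F : I -> C -> C) :
  (forall i, is_hpoly (F i)) -> is_hpoly (fun z => \sum_(i <- r) F i z).
Proof.
move=> h; elim: r => [|i r [p [q IH]]].
  by exists 0, 0 => z; rewrite big_nil /hpoly horner0 conjc0 addr0.
have [p' [q' h']] := h i; exists (p' + p), (q' + q) => z.
by rewrite big_cons IH h' /hpoly !hornerD conjD; ring.
Qed.

(* On the unit circle [mono n i x] is x^(i-n), so that [kern n] is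
   |1 + x|^(2n), an approximate identity after normalization; written with
   conjugates it is a harmonic polynomial. *)
Definition mono n i x : C := if (n <= i)%N then x ^+ (i - n) else x^* ^+ (n - i).

Lemma monoM n i x y : mono n i (x * y) = mono n i x * mono n i y.
Proof. by rewrite /mono; case: ifP => _; rewrite ?conjM exprMn. Qed.

Lemma mono_refl n x : mono n n x = 1.
Proof. by rewrite /mono leqnn subnn expr0. Qed.

Lemma mono_hpoly n i c : is_hpoly (fun z => mono n i (z * c)).
Proof.
rewrite /mono; case: (n <= i)%N.
  exists (c ^+ (i - n) *: 'X^(i - n)), 0 => z.
  by rewrite /hpoly hornerZ hornerXn horner0 conjc0 addr0 exprMn mulrC.
exists 0, (c ^+ (n - i) *: 'X^(n - i)) => z.
by rewrite /hpoly hornerZ hornerXn horner0 add0r -conjX exprMn mulrC.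
Qed.

Definition kern n x : C := \sum_(i < (2 * n).+1) 'C(2 * n, i)%:R * mono n i x.

(** For unimodular [x], |1 + x|^2 = (1 + x)^2 conj x; the binomial expansion of (1 + x)^(2n),
    shifted by [n], is the sum defining [kern]. *)
Lemma kernE n x : nc x = 1 -> kern n x = (nc (1 + x) ^+ (2 * n))%:C.
Proof.
move=> x1; have xx : x * x^* = 1 by rewrite mulcJ x1 expr1n.
rewrite exprM rcX -mulcJ conjD conjc1.
have -> : (1 + x) * (1 + x^*) = (1 + x) ^+ 2 * x^*.
  by rewrite expr2 -mulrA; congr (_ * _); rewrite mulrDl mul1r xx addrC.
rewrite exprMn -[_ ^+ 2 ^+ n]exprM exprDn mulr_suml /kern; apply: eq_bigr => i _.
rewrite expr1n mul1r -[x ^+ i *+ _]mulr_natl -mulrA; congr (_ * _); rewrite /mono.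
by case: leqP => ni; [rewrite unimod_expB|rewrite unimod_expBC// ltnW].
Qed.

(** The kernel has frequencies of modulus at most [n], and averaging over more than [n] roots of
    unity kills all of them but 0. The central binomial coefficient remains, whatever [x] is. *)
Lemma sum_kern N n x : (n < N)%N -> \sum_(j < N) kern n (x * (uroot R N ^+ j)^*) =
  (N * 'C(2 * n, n))%:R.
Proof.
move=> nN; rewrite exchange_big /=.
have nn : (n < (2 * n).+1)%N by rewrite ltnS mul2n -addnn leq_addr.
rewrite (bigD1 (Ordinal nn)) //= [X in _ + X]big1 ?addr0 => [|i ni].
  under eq_bigr => j _ do rewrite mono_refl mulr1.
  by rewrite sumr_const card_ord natrM mulr_natl.
have i2n : (i <= 2 * n)%N by rewrite -ltnS ltn_ord.
have nin : (i != n :> nat) by [].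
rewrite -mulr_sumr; under eq_bigr => j _ do rewrite monoM.
rewrite -mulr_sumr /mono; case: leqP => h.
  rewrite sum_uroot_conj ?mulr0// subn_gt0 ltn_neqAle eq_sym nin h /=.
  by apply: leq_ltn_trans nN; rewrite leq_subLR addnn -mul2n.
under eq_bigr => j _ do rewrite conjcK.
rewrite sum_uroot ?mulr0// subn_gt0 h /=.
by apply: leq_ltn_trans nN; rewrite leq_subr.
Qed.

(** Write [t] as the square of [x]: one factor [x ^+ n] absorbs [n.+1], by comparison with the
    geometric sum, and the other tends to 0. *)
Lemma nat_geometric_lt (t e : R) : 0 <= t < 1 -> 0 < e ->
  exists n : nat, n.+1%:R * t ^+ n < e.
Proof.
move=> /andP[t0 t1] e0; pose x := Num.sqrt t.
have x0 : 0 <= x by rewrite sqrtr_ge0.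
have x1 : x < 1 by rewrite -sqrtr1 ltr_sqrt.
have x10 : 0 < 1 - x by rewrite subr_gt0.
have := @cvg_expr R x; rewrite ger0_norm// => /(_ x1) /cvgrPdist_lt.
move=> /(_ (e * (1 - x)) (mulr_gt0 e0 x10)) [n _ /(_ n (leqnn n))] /=.
rewrite sub0r normrN ger0_norm ?exprn_ge0// => hn.
exists n; rewrite -[t](sqr_sqrtr t0) -exprM mul2n -addnn exprD mulrA.
have : n.+1%:R * x ^+ n <= (1 - x)^-1.
  apply: (@le_trans _ _ (\sum_(i < n.+1) x ^+ i)).
    rewrite mulr_natl -[in leLHS](card_ord n.+1) -sumr_const ler_sum// => i _.
    by rewrite ler_wiXn2l// ?ltW// -ltnS.
  rewrite -[leRHS]mul1r ler_pdivlMr// mulrC.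
  have := subrX1 x n.+1; have : 0 <= x ^+ n.+1 by rewrite exprn_ge0.
  by nra.
move=> h; apply: (@le_lt_trans _ _ ((1 - x)^-1 * x ^+ n)).
  by rewrite ler_wpM2r ?exprn_ge0.
by rewrite mulrC ltr_pdivrMr.
Qed.

(** [Q] averages the values of [f] at [N] nodes with weights K_j / S. Nodes near [z] contribute at
    most e/2 by uniform continuity. At far nodes K_j is at most 4^n t^n with t < 1, while [S] is at
    least 4^n, so they contribute at most 2 B N t^n. Since N = n + 1, this is small for a suitable
    [n]. *)
Lemma circle_approx (f : C -> C) (s e : R) : 0 < s -> 0 < e ->
  (forall z, nc z <= s -> {for z, continuous f}) ->
  exists p q, forall z, nc z = s -> nc (f z - hpoly p q z) <= e.
Proof.
move=> s0 e0 cf.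
have e20 : 0 < e / 2 by rewrite divr_gt0.
have [B B0 hB] := disk_bounded (ltW s0) cf.
have [d0 d00 hd0] := disk_unif_continuous e20 cf.
pose d := Num.min d0 s; have d_gt0 : 0 < d by rewrite lt_min d00.
have ds : d <= s by rewrite ge_min lexx orbT.
have hd z w : nc z <= s -> nc w <= s -> nc (z - w) < d -> nc (f z - f w) < e / 2.
  by move=> hz hw; rewrite lt_min => /andP[h _]; exact: hd0.
(* At a far node |1 - x| >= d/s, hence |1 + x|^2 = 4 - |1 - x|^2 <= 4t. The cap [d <= s] keeps [t]
   nonnegative. *)
pose t : R := 1 - (d / s) ^+ 2 / 4.
have dsp : 0 < d / s <= 1 by rewrite divr_gt0//= ler_pdivrMr// mul1r.
have t01 : 0 <= t < 1 by rewrite /t; case/andP: dsp => h1 h2; apply/andP; split; nra.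
have [n hn] := nat_geometric_lt t01 (divr_gt0 e20 (ltr_wpDl (mulr_ge0 (ler0n R 2) B0) ltr01)).
pose N := n.+1; pose w (j : nat) := uroot R N ^+ j.
have w1 j : nc (w j) = 1 by exact: nc_uroot.
pose S : R := (N * 'C(2 * n, n))%:R.
pose Q z := (S^-1)%:C * \sum_(j < N) f (s%:C * w j) * kern n (z * ((w j)^* * (s^-1)%:C)).
have hQ : is_hpoly Q.
  apply: is_hpolyZ; apply: is_hpoly_sum => j; apply: is_hpolyZ.
  apply: is_hpoly_sum => i; apply: is_hpolyZ; exact: mono_hpoly.
have [p [q hpq]] := hQ; exists p, q => z zs; rewrite -hpq.
pose x j := z * (s^-1)%:C * (w j)^*.
have x1 j : nc (x j) = 1.
  by rewrite !ncM ncJ w1 mulr1 zs ncR gtr0_norm ?invr_gt0// mulfV// gt_eqF.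
pose K (j : nat) := nc (1 + x j) ^+ (2 * n).
have SK : \sum_(j < N) K j = S.
  apply: (@complexI R); rewrite rc_sum /S rc_nat -(@sum_kern N n (z * (s^-1)%:C))//.
  by apply: eq_bigr => j _; rewrite -kernE.
(* The kernel sum does not depend on the base point; at base point 1 the node [j = 0] alone gives |1
   + 1|^(2n). *)
have S4 : 4 ^+ n <= S.
  have : (S%:C : C) = (\sum_(j < N) nc (1 + (w j)^*) ^+ (2 * n))%:C.
    rewrite /S rc_nat -(@sum_kern N n 1)// rc_sum; apply: eq_bigr => j _.
    by rewrite mul1r kernE// ncJ.
  move=> /complexI ->; rewrite big_ord_recl /w expr0 conjc1.
  have -> : nc (1 + 1 : C) = 2 by rewrite -[1 + 1]/(2%:R : C) -rc_nat ncR normr_nat.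
  rewrite exprM (_ : 2 ^+ 2 = 4 :> R) -?natrX// lerDl sumr_ge0// => j _; exact: exprn_ge0 (nc_ge0 _).
have S0 : 0 < S by apply: lt_le_trans S4; rewrite exprn_gt0.
have E : f z - Q z = (S^-1)%:C * \sum_(j < N) (f z - f (s%:C * w j)) * (K j)%:C.
  under eq_bigr => j _ do rewrite mulrBl.
  rewrite sumrB -mulr_sumr -rc_sum SK mulrBr mulrCA -rcM mulVf ?gt_eqF// mulr1.
  congr (_ - _ * _); apply: eq_bigr => j _; rewrite -kernE//; congr (_ * kern n _).
  by rewrite /x; ring.
have Kj j : nc (f z - f (s%:C * w j)) * K j <= e / 2 * K j + 2 * B * (4 ^+ n * t ^+ n).
  have K0 : 0 <= K j by rewrite exprn_ge0// nc_ge0.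
  have sw : nc (s%:C * w j) = s by rewrite ncM ncR w1 mulr1 gtr0_norm.
  have [near|far] := ltP (nc (z - s%:C * w j)) d.
    have h1 : nc (f z - f (s%:C * w j)) <= e / 2 by apply/ltW/hd; rewrite ?zs ?sw.
    apply: (le_trans (ler_wpM2r K0 h1)); rewrite lerDl !mulr_ge0// exprn_ge0//.
    by case/andP: t01.
  have h1 : nc (f z - f (s%:C * w j)) <= 2 * B.
    apply: (le_trans (ncD _ _)); rewrite ncN mulr2n mulrDl mul1r.
    by rewrite lerD// hB// ?zs ?sw.
  have h2 : K j <= 4 ^+ n * t ^+ n.
    rewrite -exprMn /K exprM lerXn2r// ?nnegrE ?sqr_ge0//.
      by rewrite mulr_ge0//; case/andP: t01.
    have -> : nc (1 + x j) ^+ 2 = 4 - nc (1 - x j) ^+ 2.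
      have := nc_sqr (x j); rewrite x1 expr1n !nc_sqr !(reD, imD, reN, imN) /=.
      by move: (complex.Re _) (complex.Im _) => a b h; nra.
    have : d / s <= nc (1 - x j).
      rewrite ler_pdivrMr//; apply: (le_trans far).
      have -> : z - s%:C * w j = (- s%:C * w j) * (1 - x j).
        have ww : w j * (w j)^* = 1 by rewrite mulcJ w1 expr1n.
        have ss : s%:C * (s^-1)%:C = 1 by rewrite -rcM mulfV ?gt_eqF.
        rewrite /x mulrBr mulr1 mulNr.
        rewrite (_ : - (s%:C * w j) * (z * (s^-1)%:C * (w j)^*) =
          - (z * (s%:C * (s^-1)%:C) * (w j * (w j)^*))); last by ring.
        by rewrite ww ss; ring.
      by rewrite !ncM ncN ncR w1 mulr1 gtr0_norm// mulrC.
    by case/andP: dsp => k1 k2 k3; rewrite /t; nra.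
  apply: (le_trans (ler_pM (nc_ge0 _) K0 h1 h2)).
  by rewrite lerDr mulr_ge0// ltW.
rewrite E ncM ncR gtr0_norm ?invr_gt0// mulrC ler_pdivrMr//.
apply: (le_trans (nc_sum _ _ _)).
apply: (@le_trans _ _ (\sum_(j < N) (e / 2 * K j + 2 * B * (4 ^+ n * t ^+ n)))).
  apply: ler_sum => j _; rewrite ncM ncR ger0_norm; last by rewrite exprn_ge0// nc_ge0.
  exact: Kj.
rewrite big_split /= -mulr_sumr SK sumr_const card_ord -[_ *+ N]mulr_natl.
have tn : 0 <= t ^+ n by apply: exprn_ge0; case/andP: t01.
have : N%:R * (2 * B * (4 ^+ n * t ^+ n)) <= e / 2 * S.
  rewrite (_ : N%:R * _ = (2 * B * (N%:R * t ^+ n)) * 4 ^+ n); last by ring.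
  have Nt : 0 <= N%:R * t ^+ n by rewrite mulr_ge0.
  have h1 : 2 * B * (N%:R * t ^+ n) <= e / 2.
    by move: hn; rewrite ltr_pdivlMr ?ltr_wpDl ?mulr_ge0// -/N; nra.
  by apply: ler_pM => //; rewrite ?exprn_ge0// mulr_ge0// mulr_ge0.
by rewrite (_ : e * S = e / 2 * S + e / 2 * S) ?lerD2l//; field.
Qed.

End CircleApproximation.

(** * Coefficient, growth and distortion bounds *)

Section CoefficientBounds.
Variable R : realType.
Local Notation C := R[i].
Implicit Types (p q : {poly C}) (z w c : C).

(** This is cot h <= 1/h: by the mean value theorem sin h / h is a value of cos between 0 and
    [h]. *)
Lemma mul_cos_le_sin (h : R) : 0 < h -> h < pi / 2 -> h * cos h <= sin h.
Proof.
move=> h0 hpi; have pi0 := @pi_gt0 R.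
have [c /andP[c0 ch] E] := MVT_seg h0 (fun t _ => is_derive_sin t).
rewrite sin0 !subr0 in E; rewrite E mulrC ler_wpM2r ?(ltW h0)// ltW//.
by rewrite ltr_cos// in_itv /=; lra.
Qed.

(** The mean of |cos| over the circle is 2/pi, and with a number of nodes divisible by 4 the
    discrete mean does not exceed it. The four quarters are sums of cos or sin of constant sign,
    adding up to 2 cot h with h = pi / (4m), and cot h <= 1/h. *)
Lemma sum_abs_cos (m : nat) : (0 < m)%N ->
  \sum_(j < 4 * m) `|cos (2 * pi / (4 * m)%:R * j%:R)| <= 2 * (4 * m)%:R / pi :> R.
Proof.
move=> m0; have m0' : 0 < m%:R :> R by rewrite ltr0n.
have pi0 := @pi_gt0 R.
pose h : R := pi / (4 * m)%:R.
have h0 : 0 < h by rewrite divr_gt0// ltr0n muln_gt0.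
have hm : 2 * h * m%:R = pi / 2.
  by rewrite /h natrM; field; rewrite gt_eqF.
have hpi : h < pi / 2.
  rewrite -hm; have : 1 <= m%:R :> R by rewrite ler1n.
  by nra.
have E (j : nat) : 2 * pi / (4 * m)%:R * j%:R = 2 * h * j%:R by rewrite /h; ring.
under eq_bigr => j _ do rewrite E.
have quarter (x : R) : `|cos (x + pi / 2)| = `|sin x| by rewrite cosDpihalf normrN.
have quarter' (x : R) : `|sin (x + pi / 2)| = `|cos x| by rewrite sinDpihalf.
have blk (k : nat) : 2 * h * (m + k)%:R = 2 * h * k%:R + pi / 2 :> R.
  by rewrite natrD mulrDr hm addrC.
pose F := \sum_(j < m) cos (2 * h * j%:R) + \sum_(j < m) sin (2 * h * j%:R).
have jpi (j : 'I_m) : 0 <= 2 * h * j%:R < pi / 2.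
  apply/andP; split; first by rewrite !mulr_ge0// ltW.
  by rewrite -hm ltr_pM2l; [rewrite ltr_nat|rewrite mulr_gt0].
have -> : \sum_(j < 4 * m) `|cos (2 * h * j%:R)| = 2 * F.
  rewrite (_ : 4 * m = m + (m + (m + m)))%N; last by rewrite !mulSn mul0n addn0.
  rewrite !big_split_ord /=.
  under [X in _ + (X + _)]eq_bigr => j _ do rewrite blk quarter.
  under [X in _ + (_ + (X + _))]eq_bigr => j _ do rewrite !blk quarter quarter'.
  under [X in _ + (_ + (_ + X))]eq_bigr => j _ do rewrite !blk quarter quarter' quarter.
  have -> : \sum_(j < m) `|cos (2 * h * j%:R)| = \sum_(j < m) cos (2 * h * j%:R).
    apply: eq_bigr => j _; rewrite ger0_norm// ltW// cos_gt0_pihalf//.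
    by have := jpi j; lra.
  have -> : \sum_(j < m) `|sin (2 * h * j%:R)| = \sum_(j < m) sin (2 * h * j%:R).
    apply: eq_bigr => j _; rewrite ger0_norm// sin_ge0_pi//.
    by have := jpi j; lra.
  by rewrite /F; ring.
have s0 : 0 < sin h by apply: sin_gt0_pihalf; rewrite h0.
(* Multiplied by 2 sin h, each term becomes a difference of sines or cosines at odd multiples of
   [h], and the sums telescope. *)
have tel : 2 * sin h * F = 2 * cos h.
  have T (k : nat) : 2 * sin h * (\sum_(j < k) cos (2 * h * j%:R) + \sum_(j < k) sin (2 * h * j%:R))
     = sin (2 * h * k%:R - h) + sin h + (cos h - cos (2 * h * k%:R - h)).
    elim: k => [|k IH].
      by rewrite !big_ord0 mulr0 sub0r sinN cosN addr0 mulr0 addNr subrr addr0.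
    rewrite !big_ord_recr /= addrACA mulrDr IH.
    have -> : 2 * h * k.+1%:R - h = 2 * h * k%:R + h by rewrite -natr1; ring.
    by rewrite !(sinD, cosD, sinN, cosN); ring.
  rewrite T hm; rewrite addrC [pi / 2 - h]addrC sinDpihalf cosDpihalf sinN cosN; ring.
have -> : 2 * F = 2 * cos h / sin h.
  by rewrite -tel; field; rewrite gt_eqF.
rewrite -mulrA -[leRHS]mulrA ler_pM2l// ler_pdivrMr//.
have -> : (4 * m)%:R / pi = h^-1 by rewrite /h invf_div.
by rewrite mulrC ler_pdivlMr// mulrC; exact: mul_cos_le_sin.
Qed.

(** On a suitably rotated circle the Fourier kernels of a_1 and of conj b_1 become, up to one
    unimodular constant, conjugate to each other. Their sum is twice a cosine, so (|a_1| + |b_1|) r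
    is at most [B] times the mean of 2 |cos|. *)
Lemma coef1_hpoly_le p q (r B : R) : 0 <= r ->
  (forall z, nc z = r -> nc (hpoly p q z) <= B) ->
  (nc p`_1 + nc q`_1) * r <= 4 * B / pi.
Proof.
move=> r0 hB; pose m := (size p + size q).+2.
have hp : (size p <= m)%N by do 2 apply: leqW; exact: leq_addr.
have hq : (size q <= m)%N by do 2 apply: leqW; exact: leq_addl.
pose N := (4 * m)%N; have N0 : 0 < N%:R :> R by rewrite ltr0n.
have hN : (m + m <= N)%N by rewrite /N addnn -mul2n leq_mul2r orbT.
have [k1 k11 e1] := nc_rotate p`_1; have [k2 k21 e2] := nc_rotate (q`_1)^*.
(* A square root is what balances the two rotations: it gives k1 conj u = k2 u, the common
   constant. *)
pose u := sqrtc (k1 * k2^*).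
have u2 : u ^+ 2 = k1 * k2^* by exact: sqr_sqrtc.
have u1 : nc u = 1.
  have := congr1 (@nc R) u2; rewrite ncX ncM ncJ k11 k21 mulr1 => /eqP.
  by rewrite sqrp_eq1 ?nc_ge0// => /eqP.
have kk : k1 * u^* = k2 * u.
  have uu : u * u^* = 1 by rewrite mulcJ u1 expr1n.
  have kk2 : k2 * k2^* = 1 by rewrite mulcJ k21 expr1n.
  have -> : k1 * u^* = (k1 * k2^*) * (k2 * u^*) by rewrite mulrACA [k2^* * _]mulrC; rewrite -[LHS]mulr1 -kk2; ring.
  by rewrite -u2 expr2 mulrACA [u * k2]mulrC -mulrA uu mulr1 mulrC.
pose z0 := r%:C * u.
have E : (N%:R * ((nc p`_1 + nc q`_1) * r))%:C = \sum_(j < N)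
    hpoly p q (z0 * uroot R N ^+ j) * (k2 * u * (2 * complex.Re (uroot R N ^+ j))%:C).
  have m1 : (0 < 1 < m)%N by [].
  have d1 := dft_hpoly z0 hp hq hN m1; have d2 := dft_hpoly_conj z0 hp hq hN m1.
  transitivity (k1 * u^* * (N%:R * (p`_1 * z0)) + k2 * u * (N%:R * ((q`_1)^* * z0^*))).
    rewrite rcM rc_nat rcM rcD -e1 -[nc q`_1]ncJ -e2 /z0 conjM conjR.
    have uu : u * u^* = 1 by rewrite mulcJ u1 expr1n.
    transitivity ((N%:R * r%:C * (k1 * p`_1 + k2 * (q`_1)^*)) * (u * u^*)); last by ring.
    by rewrite uu mulr1; ring.
  rewrite !expr1 in d1 d2; rewrite -d1 -d2 !mulr_sumr -big_split /=; apply: eq_bigr => j _.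
  by rewrite kk rcM rc_nat -addcJ !expr1; ring.
have {}E : N%:R * ((nc p`_1 + nc q`_1) * r) <=
    \sum_(j < N) B * (2 * `|complex.Re (uroot R N ^+ j)|).
  have L0 : 0 <= N%:R * ((nc p`_1 + nc q`_1) * r).
    by rewrite mulr_ge0// mulr_ge0// addr_ge0// nc_ge0.
  rewrite -[leLHS](ger0_norm L0) -ncR E; apply: (le_trans (nc_sum _ _ _)).
  apply: ler_sum => j _; rewrite !ncM k21 u1 !mul1r ncR normrM normr_nat.
  rewrite ler_wpM2r ?mulr_ge0//; apply: hB.
  by rewrite ncM nc_uroot /z0 ncM u1 ncR !mulr1 ger0_norm.
rewrite -(ler_pM2l N0); apply: (le_trans E); rewrite -!mulr_sumr.
have B0 : 0 <= B.
  by apply: le_trans (nc_ge0 _) (hB r%:C _); rewrite ncR ger0_norm.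
have m0 : (0 < m)%N by [].
have -> : N%:R * (4 * B / pi) = B * (2 * (2 * N%:R / pi)) by ring.
rewrite ler_wpM2l// ler_pM2l//; apply: le_trans (sum_abs_cos m0).
by apply: ler_sum => j _; rewrite expiX.
Qed.

(** With a = |p_1| and b = |q_1|, the first bound is (a + b)^2 = 2(a^2 + b^2) - (a - b)^2 together
    with Bessel. For the second, the coefficients with n >= 2 share what a^2 + b^2 >= (a - b)^2
    leaves of B^2, and (x + y)^2 <= 2(x^2 + y^2). For l = 1 these are the radicands of [K1] and
    [phi]. *)
Lemma coef_hpoly_sq p q (r B l : R) (L : nat) : 0 <= r -> 0 <= l ->
  l <= `|nc p`_1 - nc q`_1| * r ->
  (forall z, nc z = r -> nc (hpoly p q z) <= B) ->
  ((nc p`_1 + nc q`_1) * r) ^+ 2 <= 2 * B ^+ 2 - l ^+ 2 /\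
  \sum_(2 <= n < L) ((nc p`_n + nc q`_n) * r ^+ n) ^+ 2 <= 2 * B ^+ 2 - 2 * l ^+ 2.
Proof.
move=> r0 l0 hl hB.
have sq (a b : R) : (a + b) ^+ 2 <= 2 * (a ^+ 2 + b ^+ 2).
  by have := sqr_ge0 (a - b); nra.
have l2 : l ^+ 2 <= (nc p`_1 - nc q`_1) ^+ 2 * r ^+ 2.
  rewrite -exprMn -[leRHS]real_normK ?num_real// ler_pXn2r// normrM.
  by rewrite [`|r|]ger0_norm.
have bes K := bessel_hpoly K r0 hB.
split.
  have := bes 2; rewrite big_nat1 muln1 => h.
  by rewrite exprMn; move: (nc _) (nc _) h l2 => a b; nra.
case: (leqP L 1) => L1.
  rewrite big_geq ?(leq_trans L1)//.
  have := bes 2; rewrite big_nat1 muln1 => h.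
  have ab : (nc p`_1 - nc q`_1) ^+ 2 <= nc p`_1 ^+ 2 + nc q`_1 ^+ 2.
    by have := mulr_ge0 (nc_ge0 p`_1) (nc_ge0 q`_1); nra.
  have := ler_wpM2r (sqr_ge0 r) ab; lra.
have := bes L; rewrite big_ltn// muln1 => h.
have h2 : \sum_(2 <= n < L) ((nc p`_n + nc q`_n) * r ^+ n) ^+ 2 <=
    2 * \sum_(2 <= n < L) (nc p`_n ^+ 2 + nc q`_n ^+ 2) * r ^+ (2 * n).
  rewrite mulr_sumr; apply: ler_sum => n _; rewrite exprMn -exprM mulnC mulrA.
  by rewrite ler_wpM2r// exprn_ge0.
have ab : (nc p`_1 - nc q`_1) ^+ 2 <= nc p`_1 ^+ 2 + nc q`_1 ^+ 2.
  by have := mulr_ge0 (nc_ge0 p`_1) (nc_ge0 q`_1); nra.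
have := ler_wpM2r (sqr_ge0 r) ab; lra.
Qed.

Lemma sum_cauchy_schwarz (I : Type) (s : seq I) (x y : I -> R) :
  (\sum_(i <- s) x i * y i) ^+ 2 <= (\sum_(i <- s) x i ^+ 2) * (\sum_(i <- s) y i ^+ 2).
Proof.
elim: s => [|i s IH]; first by rewrite !big_nil expr0n mul0r.
rewrite !big_cons; set X := \sum_(j <- s) _ ^+ 2 in IH *.
set Y := \sum_(j <- s) _ ^+ 2 in IH *; set Z := \sum_(j <- s) _ in IH *.
have X0 : 0 <= X by apply: sumr_ge0 => j _; exact: sqr_ge0.
have Y0 : 0 <= Y by apply: sumr_ge0 => j _; exact: sqr_ge0.
suff : 2 * (x i * y i) * Z <= x i ^+ 2 * Y + X * y i ^+ 2 by nra.
apply: (le_trans (ler_norm _)).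
have W0 : 0 <= x i ^+ 2 * Y + X * y i ^+ 2 by rewrite addr_ge0// mulr_ge0// sqr_ge0.
rewrite -(ler_pXn2r (_ : (0 < 2)%N)) ?nnegrE// real_normK ?num_real//.
apply: (@le_trans _ _ (4 * (x i * y i) ^+ 2 * (X * Y))).
  rewrite (_ : (_ * _ * Z) ^+ 2 = 4 * (x i * y i) ^+ 2 * Z ^+ 2); last by ring.
  by rewrite ler_wpM2l// mulr_ge0// sqr_ge0.
by have := sqr_ge0 (x i ^+ 2 * Y - X * y i ^+ 2); nra.
Qed.

Lemma sum_cauchy_schwarz_le (I : Type) (s : seq I) (x y : I -> R) (X Y : R) :
  \sum_(i <- s) x i ^+ 2 <= X -> \sum_(i <- s) y i ^+ 2 <= Y ->
  \sum_(i <- s) x i * y i <= Num.sqrt X * Num.sqrt Y.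
Proof.
move=> hX hY.
have X0 : 0 <= \sum_(i <- s) x i ^+ 2 by apply: sumr_ge0 => j _; exact: sqr_ge0.
have Y0 : 0 <= \sum_(i <- s) y i ^+ 2 by apply: sumr_ge0 => j _; exact: sqr_ge0.
apply: (le_trans (ler_norm _)); rewrite -sqrtrM ?(le_trans X0)// -sqrtr_sqr.
rewrite ler_wsqrtr//; apply: (le_trans (sum_cauchy_schwarz _ _ _)).
exact: ler_pM.
Qed.

(** The series over n >= 1 has sum (1 + x) / (1 - x)^3; [T] gives its partial sums with an explicit
    nonnegative remainder, and -1 removes the term n = 1. *)
Lemma sum_sqr_geometric (x : R) (L : nat) : 0 <= x < 1 ->
  \sum_(2 <= n < L) n%:R ^+ 2 * x ^+ n.-1 <= (1 + x) / (1 - x) ^+ 3 - 1.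
Proof.
move=> /andP[x0 x1]; have y0 : 0 < 1 - x by rewrite subr_gt0.
have T N : \sum_(1 <= n < N.+1) n%:R ^+ 2 * x ^+ n.-1 = (1 + x) / (1 - x) ^+ 3 -
   x ^+ N * (N%:R ^+ 2 * (1 - x) ^+ 2 + 2 * N%:R * (1 - x) + (1 + x)) / (1 - x) ^+ 3.
  elim: N => [|N IH].
    by rewrite big_geq// expr0; field; rewrite gt_eqF.
  by rewrite big_nat_recr//= IH -natr1 [x ^+ N.+1]exprS; field; rewrite gt_eqF.
have N0 N : 0 <= x ^+ N * (N%:R ^+ 2 * (1 - x) ^+ 2 + 2 * N%:R * (1 - x) + (1 + x)) / (1 - x) ^+ 3.
  rewrite divr_ge0 ?exprn_ge0 ?(ltW y0)// mulr_ge0 ?exprn_ge0//.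
  by rewrite !addr_ge0// ?mulr_ge0 ?exprn_ge0// ltW.
case: (leqP L 1) => L1.
  rewrite big_geq ?(leq_trans L1)//; have := T 1%N; rewrite big_nat1 expr0 mulr1.
  by have := N0 1%N; lra.
case: L L1 => // L L1; have := T L; rewrite big_ltn// expr0 mulr1.
by have := N0 L; lra.
Qed.

Lemma sum_geometric_le (x : R) (L : nat) : 0 <= x < 1 ->
  \sum_(2 <= n < L) x ^+ n <= x ^+ 2 / (1 - x).
Proof.
move=> /andP[x0 x1]; have y0 : 0 < 1 - x by rewrite subr_gt0.
case: (leqP L 1) => L1.
  by rewrite big_geq ?(leq_trans L1)// divr_ge0 ?exprn_ge0// ltW.
case: L L1 => // L L1.
have T N : \sum_(2 <= n < N.+2) x ^+ n = (x ^+ 2 - x ^+ N.+2) / (1 - x).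
  elim: N => [|N IH]; first by rewrite big_geq// subrr mul0r.
  by rewrite big_nat_recr//= IH !exprS; field; rewrite gt_eqF.
case: L L1 => // L _; rewrite T ler_pM2r ?invr_gt0// lerBlDr lerDl.
by rewrite exprn_ge0.
Qed.

(** The term n = 1 is bounded by the two estimates for |a_1| + |b_1|, the others by Cauchy-Schwarz
    against n x^(n-1) with x = r/s. The coefficients are normalized by s^n, which leaves the factor
    1/s. *)
Lemma hpoly_lip_le p q z w (r s B l : R) : 0 <= r -> r < s -> 0 <= l ->
  l <= `|nc p`_1 - nc q`_1| * s ->
  (forall z, nc z = s -> nc (hpoly p q z) <= B) ->
  nc z <= r -> nc w <= r ->
  nc (hpoly p q z - hpoly p q w) <=
  (Num.min (Num.sqrt (2 * B ^+ 2 - l ^+ 2)) (4 * B / pi) +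
   Num.sqrt (2 * B ^+ 2 - 2 * l ^+ 2) *
   Num.sqrt ((1 + (r / s) ^+ 2) / (1 - (r / s) ^+ 2) ^+ 3 - 1)) / s * nc (z - w).
Proof.
move=> r0 rs l0 hl hB zr wr; have s0 : 0 < s := le_lt_trans r0 rs.
pose L := (size p + size q).+2.
have hp : (size p <= L)%N by do 2 apply: leqW; exact: leq_addr.
have hq : (size q <= L)%N by do 2 apply: leqW; exact: leq_addl.
have [A1 A2] := coef_hpoly_sq L (ltW s0) l0 hl hB.
have A1' := coef1_hpoly_le (ltW s0) hB.
pose A n := (nc p`_n + nc q`_n) * s ^+ n.
have A0 n : 0 <= A n by rewrite mulr_ge0 ?exprn_ge0 ?(ltW s0)// addr_ge0// nc_ge0.
pose x := r / s; have x0 : 0 <= x by rewrite divr_ge0// ltW.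
have x1 : x < 1 by rewrite ltr_pdivrMr// mul1r.
have powB (n : nat) : nc (z ^+ n - w ^+ n) <= n%:R * r ^+ n.-1 * nc (z - w).
  rewrite subrXX ncM mulrC ler_wpM2r ?nc_ge0//; apply: (le_trans (nc_sum _ _ _)).
  rewrite mulr_natl -[X in _ <= _ *+ X](card_ord n) -sumr_const; apply: ler_sum => i _.
  have iN : (i <= n.-1)%N.
    by rewrite -ltnS prednK// (leq_ltn_trans (leq0n i) (ltn_ord i)).
  rewrite ncM !ncX -[X in _ <= r ^+ X](subnK iN) exprD ler_pM ?exprn_ge0 ?nc_ge0//.
    by apply: lerXn2r; rewrite ?nnegrE ?nc_ge0.
  by apply: lerXn2r; rewrite ?nnegrE ?nc_ge0.
have -> : hpoly p q z - hpoly p q w = \sum_(0 <= i < L)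
    (p`_i * (z ^+ i - w ^+ i) + (q`_i)^* * (z ^+ i - w ^+ i)^*).
  rewrite !(hpoly_wide _ hp hq) -sumrB big_mkord; apply: eq_bigr => i _.
  by rewrite conjB !conjX; ring.
rewrite big_ltn// !expr0 subrr conjc0 !mulr0 !add0r.
have termB (n : nat) : (0 < n)%N ->
    nc (p`_n * (z ^+ n - w ^+ n) + (q`_n)^* * (z ^+ n - w ^+ n)^*) <=
    A n * (n%:R * x ^+ n.-1) / s * nc (z - w).
  move=> n0; apply: (le_trans (ncD _ _)); rewrite !ncM !ncJ -mulrDl.
  have -> : A n * (n%:R * x ^+ n.-1) / s = (nc p`_n + nc q`_n) * (n%:R * r ^+ n.-1).
    case: n n0 => // n _; rewrite /A /x expr_div_n /= [s ^+ n.+1]exprS; field.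
    by rewrite expf_neq0 gt_eqF.
  by rewrite -mulrA ler_wpM2l// addr_ge0// nc_ge0.
apply: (le_trans (nc_sum _ _ _)).
apply: (@le_trans _ _ (\sum_(1 <= n < L) A n * (n%:R * x ^+ n.-1) / s * nc (z - w))).
  rewrite big_nat_cond [leRHS]big_nat_cond; apply: ler_sum => n /andP[/andP[n0 _] _].
  exact: termB.
rewrite -2!mulr_suml -mulrA -[leRHS]mulrA; apply: ler_wpM2r.
  by rewrite mulr_ge0 ?nc_ge0// invr_ge0 ltW.
rewrite big_ltn// expr0 !mulr1 lerD//.
  by rewrite le_min /A expr1 A1' andbT -[leLHS]ger0_norm ?(A0 1%N)// -sqrtr_sqr ler_wsqrtr.
apply: sum_cauchy_schwarz_le => //.
have x2 : 0 <= x ^+ 2 < 1 by rewrite exprn_ge0//= expr_lt1.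
apply: le_trans (sum_sqr_geometric L x2); apply: ler_sum => n _.
by rewrite exprMn -!exprM mulnC.
Qed.

(** As for the Lipschitz bound, with the weights x^n in place of n x^(n-1); the squares x^(2n) over
    n >= 2 sum to x^4 / (1 - x^2). *)
Lemma hpoly_dist0_le p q z (r s B l : R) : 0 <= r -> r < s -> 0 <= l ->
  l <= `|nc p`_1 - nc q`_1| * s ->
  (forall z, nc z = s -> nc (hpoly p q z) <= B) -> nc z <= r ->
  nc (hpoly p q z - hpoly p q 0) <=
  Num.min (Num.sqrt (2 * B ^+ 2 - l ^+ 2)) (4 * B / pi) * (r / s) +
   Num.sqrt (2 * B ^+ 2 - 2 * l ^+ 2) *
   Num.sqrt ((r / s) ^+ 4 / (1 - (r / s) ^+ 2)).
Proof.
move=> r0 rs l0 hl hB zr; have s0 : 0 < s := le_lt_trans r0 rs.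
pose L := (size p + size q).+2.
have hp : (size p <= L)%N by do 2 apply: leqW; exact: leq_addr.
have hq : (size q <= L)%N by do 2 apply: leqW; exact: leq_addl.
have [A1 A2] := coef_hpoly_sq L (ltW s0) l0 hl hB.
have A1' := coef1_hpoly_le (ltW s0) hB.
pose A n := (nc p`_n + nc q`_n) * s ^+ n.
have A0 n : 0 <= A n by rewrite mulr_ge0 ?exprn_ge0 ?(ltW s0)// addr_ge0// nc_ge0.
pose x := r / s; have x0 : 0 <= x by rewrite divr_ge0// ltW.
have x1 : x < 1 by rewrite ltr_pdivrMr// mul1r.
have -> : hpoly p q z - hpoly p q 0 = \sum_(1 <= i < L)
    (p`_i * z ^+ i + (q`_i)^* * (z^*) ^+ i).
  rewrite !(hpoly_wide _ hp hq) -sumrB -(big_mkord xpredT (fun i =>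
    p`_i * z ^+ i + (q`_i)^* * z^* ^+ i - (p`_i * 0 ^+ i + (q`_i)^* * 0^* ^+ i))).
  rewrite big_ltn// !expr0 subrr add0r big_nat_cond [RHS]big_nat_cond.
  apply: eq_bigr => n /andP[/andP[n0 _] _].
  by rewrite conjc0 expr0n -[n]prednK//= !mulr0 addr0 subr0.
apply: (le_trans (nc_sum _ _ _)).
apply: (@le_trans _ _ (\sum_(1 <= n < L) A n * x ^+ n)).
  apply: ler_sum => n _; apply: (le_trans (ncD _ _)).
  rewrite !ncM !ncX !ncJ -mulrDl /A /x expr_div_n -mulrA mulrC [_ * (_ / _)]mulrC divfK.
    by rewrite mulrC ler_wpM2l ?addr_ge0 ?nc_ge0// lerXn2r// ?nnegrE ?nc_ge0.
  by rewrite expf_neq0// gt_eqF.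
rewrite big_ltn// lerD//.
  rewrite expr1 ler_wpM2r//.
  by rewrite le_min /A expr1 A1' andbT -[leLHS]ger0_norm ?(A0 1%N)// -sqrtr_sqr ler_wsqrtr.
apply: sum_cauchy_schwarz_le => //.
have x2 : 0 <= x ^+ 2 < 1 by rewrite exprn_ge0//= expr_lt1.
have := sum_geometric_le L x2; rewrite -exprM; apply: le_trans.
by apply: ler_sum => n _; rewrite -!exprM mulnC.
Qed.

End CoefficientBounds.

(** * Taylor estimates uniform over bounded harmonic polynomials *)

Section HarmonicApproximation.
Variable R : realType.
Local Notation C := R[i].
Implicit Types (p q : {poly C}) (f : C -> C) (z w v c : C).

Lemma nc_nat n : nc (n%:R : C) = n%:R.
Proof. by rewrite -rc_nat ncR normr_nat. Qed.

Lemma pow_taylor_le z w (r : R) n : nc z <= r -> nc w <= r ->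
  nc (w ^+ n - z ^+ n - n%:R * z ^+ n.-1 * (w - z)) <=
  n%:R ^+ 2 * r ^+ n.-2 * nc (w - z) ^+ 2.
Proof.
move=> zr wr; have r0 := le_trans (nc_ge0 z) zr.
have D0 : 0 <= nc (w - z) ^+ 2 by exact: sqr_ge0.
elim: n => [|[|[|n]] IH].
- by rewrite !expr0 subrr sub0r !mul0r oppr0 nc0 expr0n !mul0r.
- rewrite (_ : _ - _ - _ = 0); last by rewrite /= expr0; ring.
  by rewrite nc0 !mulr_ge0 ?exprn_ge0 ?nc_ge0.
- rewrite (_ : _ - _ - _ = (w - z) ^+ 2); last by rewrite /=; ring.
  by rewrite ncX /= expr0 mulr1; move: D0; move: (_ ^+ 2) => D D0; nra.
rewrite (_ : _ - _ - _ = w * (w ^+ n.+2 - z ^+ n.+2 - n.+2%:R * z ^+ n.+2.-1 * (w - z)) +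
  n.+2%:R * z ^+ n.+1 * (w - z) ^+ 2); last first.
  by rewrite /= -[n.+3%:R]natr1 !exprS; ring.
apply: (le_trans (ncD _ _)); rewrite !ncM !ncX nc_nat.
set D := nc (w - z) ^+ 2 in D0 IH *.
have zn : nc z ^+ n.+1 <= r ^+ n.+1 by apply: lerXn2r; rewrite ?nnegrE ?nc_ge0.
apply: (@le_trans _ _ (r * (n.+2%:R ^+ 2 * r ^+ n * D) + n.+2%:R * r ^+ n.+1 * D)).
  apply: lerD; last by rewrite ler_wpM2r// ler_wpM2l.
  exact: (ler_pM (nc_ge0 _) (nc_ge0 _) wr IH).
have rn : 0 <= r ^+ n.+1 * D by rewrite mulr_ge0// exprn_ge0.
have N0 : 0 <= n.+2%:R :> R by [].
rewrite (_ : r * _ + _ = (n.+2%:R ^+ 2 + n.+2%:R) * (r ^+ n.+1 * D)); last first.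
  by rewrite [r ^+ n.+1]exprS; ring.
rewrite -[leRHS]mulrA ler_wpM2r// -[n.+3%:R]natr1; nra.
Qed.

Lemma horner_deriv_wide p z (L : nat) : (size p <= L)%N ->
  p^`().[z] = \sum_(1 <= n < L.+1) p`_n * (n%:R * z ^+ n.-1).
Proof.
move=> hp; rewrite big_add1 /= big_mkord (@horner_coef_wide _ L).
  by apply: eq_bigr => i _; rewrite coef_deriv -mulr_natl; ring.
have [->|p0] := eqVneq p 0; first by rewrite deriv0 size_poly0.
by apply: leq_trans hp; exact/ltnW/lt_size_deriv.
Qed.

Lemma sum_shift_hpoly (a : nat -> R) (s r B : R) (L : nat) : 0 < r -> r < s ->
  (forall n, (0 < n)%N -> 0 <= a n /\ a n * s ^+ n <= B) ->
  \sum_(1 <= n < L) a n * (n%:R ^+ 2 * r ^+ n.-1) <=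
  B * ((1 + r / s) / (1 - r / s) ^+ 3 / s).
Proof.
move=> r0 rs ha; have s0 := lt_trans r0 rs.
have [_ B1] := ha 1%N isT; have B0 : 0 <= B.
  by apply: le_trans B1; have [a0 _] := ha 1%N isT; rewrite mulr_ge0// exprn_ge0// ltW.
have x0 : 0 <= r / s by rewrite divr_ge0 ?ltW.
have x1 : r / s < 1 by rewrite ltr_pdivrMr// mul1r.
have x01 : 0 <= r / s < 1 by rewrite x0.
have k0 : 0 <= (1 + r / s) / (1 - r / s) ^+ 3.
  by rewrite divr_ge0 ?addr_ge0// exprn_ge0// subr_ge0 ltW.
apply: (@le_trans _ _ (\sum_(1 <= n < L) B / s * (n%:R ^+ 2 * (r / s) ^+ n.-1))).
  rewrite big_nat_cond [leRHS]big_nat_cond; apply: ler_sum => n /andP[/andP[n0 _] _].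
  case: n n0 => // n n0; have [an anB] := ha _ n0.
  have sn : 0 < s ^+ n by rewrite exprn_gt0.
  rewrite expr_div_n /= (_ : B / s * _ = B / s ^+ n.+1 * (n.+1%:R ^+ 2 * r ^+ n)); last first.
    by rewrite [s ^+ n.+1]exprS; field; rewrite gt_eqF//= gt_eqF.
  by rewrite ler_wpM2r ?mulr_ge0 ?exprn_ge0 ?(ltW r0)// ler_pdivlMr// exprn_gt0.
rewrite -mulr_sumr -mulrA ler_wpM2l// mulrC ler_wpM2r ?invr_ge0 ?(ltW s0)//.
case: (leqP L 1) => L1; first by rewrite big_geq.
rewrite big_ltn// expr0 expr1n mul1r.
by have := sum_sqr_geometric L x01; lra.
Qed.

(** [K] is chosen before the polynomials: a bound on the circle of radius [s] bounds the n-th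
    coefficients by B / s^n, and the series of n^2 r^(n-1) / s^n converges. This uniformity lets
    derivatives pass to the limit. *)
Lemma hpoly_taylor (r s : R) : 0 < r -> r < s -> exists2 K : R, 0 <= K &
  forall p q (B : R), (forall z, nc z = s -> nc (hpoly p q z) <= B) ->
  (forall z, nc z <= r -> nc p^`().[z] <= K * B /\ nc q^`().[z] <= K * B) /\
  (forall z v, nc z <= r -> nc (z + v) <= r ->
    nc (hpoly p q (z + v) - hpoly p q z - (p^`().[z] * v + (q^`().[z])^* * v^*)) <=
    K * B * nc v ^+ 2).
Proof.
move=> r0 rs; have s0 := lt_trans r0 rs.
pose K0 := (1 + r / s) / (1 - r / s) ^+ 3 / s.
have K00 : 0 <= K0.
  have x0 : 0 <= r / s by rewrite divr_ge0 ?ltW.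
  have x1 : r / s < 1 by rewrite ltr_pdivrMr// mul1r.
  by rewrite /K0 !mulr_ge0 ?invr_ge0 ?addr_ge0 ?exprn_ge0 ?subr_ge0 ?(ltW x1)// ltW.
have K2 : 0 <= 2 * K0 / r by apply: divr_ge0; [exact: mulr_ge0|exact: ltW].
exists (K0 + 2 * K0 / r); first exact: addr_ge0.
move=> p q B hB.
have B0 : 0 <= B.
  by apply: le_trans (nc_ge0 _) (hB s%:C _); rewrite ncR gtr0_norm.
have cp n : (0 < n)%N -> 0 <= nc p`_n /\ nc p`_n * s ^+ n <= B.
  by move=> n0; rewrite nc_ge0; have [] := coef_hpoly_le (ltW s0) n0 hB.
have cq n : (0 < n)%N -> 0 <= nc q`_n /\ nc q`_n * s ^+ n <= B.
  by move=> n0; rewrite nc_ge0; have [] := coef_hpoly_le (ltW s0) n0 hB.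
have der (t : {poly C}) (z : C) :
    (forall n, (0 < n)%N -> 0 <= nc t`_n /\ nc t`_n * s ^+ n <= B) ->
    nc z <= r -> nc t^`().[z] <= (K0 + 2 * K0 / r) * B.
  move=> ht zr; rewrite (horner_deriv_wide z (leqnn _)).
  apply: (le_trans (nc_sum _ _ _)); apply: (@le_trans _ _ (B * K0)); last first.
    by rewrite mulrDl [B * _]mulrC lerDl mulr_ge0.
  apply: le_trans (sum_shift_hpoly (size t).+1 r0 rs ht).
  rewrite big_nat_cond [leRHS]big_nat_cond; apply: ler_sum => n /andP[/andP[n0 _] _].
  rewrite !ncM ler_wpM2l ?nc_ge0// ncX nc_nat.
  apply: ler_pM; rewrite ?exprn_ge0 ?nc_ge0//.
    by rewrite expr2 ler_peMr// ler1n.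
  by apply: lerXn2r; rewrite ?nnegrE ?nc_ge0// ltW.
have tay (t : {poly C}) (z v : C) :
    (forall n, (0 < n)%N -> 0 <= nc t`_n /\ nc t`_n * s ^+ n <= B) ->
    nc z <= r -> nc (z + v) <= r ->
    nc (t.[z + v] - t.[z] - t^`().[z] * v) <= K0 / r * B * nc v ^+ 2.
  move=> ht zr zvr.
  have hL := leqnSn (size t); rewrite (horner_deriv_wide z (leqnn _)).
  rewrite !(horner_coef_wide _ hL) -sumrB -(big_mkord xpredT (fun i =>
    t`_i * (z + v) ^+ i - t`_i * z ^+ i)) big_ltn// !expr0 subrr add0r mulr_suml -sumrB.
  apply: (le_trans (nc_sum _ _ _)).
  rewrite (_ : K0 / r * B * _ = (B * K0) * (nc v ^+ 2 / r)); last by ring.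
  apply: le_trans (ler_wpM2r _ (sum_shift_hpoly (size t).+1 r0 rs ht)); last first.
    by rewrite divr_ge0 ?sqr_ge0 ?ltW.
  rewrite mulr_suml big_nat_cond [leRHS]big_nat_cond.
  apply: ler_sum => n /andP[/andP[n0 _] _].
  have -> : t`_n * (z + v) ^+ n - t`_n * z ^+ n - t`_n * (n%:R * z ^+ n.-1) * v =
    t`_n * ((z + v) ^+ n - z ^+ n - n%:R * z ^+ n.-1 * (z + v - z)) by ring.
  rewrite ncM -[leRHS]mulrA ler_wpM2l ?nc_ge0//.
  case: n n0 => [//|[|n]] _.
    rewrite (_ : _ - _ - _ = 0); last by rewrite /= expr0; ring.
    by rewrite nc0 !mulr_ge0 ?exprn_ge0 ?nc_ge0 ?invr_ge0// ltW.
  apply: (le_trans (pow_taylor_le n.+2 zr zvr)).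
  rewrite (_ : z + v - z = v) /=; last by ring.
  rewrite (_ : _ * (_ / r) = n.+2%:R ^+ 2 * r ^+ n * nc v ^+ 2)//.
  by rewrite [r ^+ n.+1]exprS; field; rewrite gt_eqF.
split=> [z zr|z v zr zvr]; first by split; exact: der.
have -> : hpoly p q (z + v) - hpoly p q z - (p^`().[z] * v + (q^`().[z])^* * v^*) =
  (p.[z + v] - p.[z] - p^`().[z] * v) + (q.[z + v] - q.[z] - q^`().[z] * v)^*.
  by rewrite /hpoly !conjB conjM; ring.
apply: (le_trans (ncD _ _)); rewrite ncJ.
have := tay p z v cp zr zvr; have := tay q z v cq zr zvr.
have : 0 <= K0 * B * nc v ^+ 2 by apply: mulr_ge0; [exact: (mulr_ge0 K00 B0)|exact: sqr_ge0].
rewrite (_ : (K0 + 2 * K0 / r) * B * nc v ^+ 2 = K0 * B * nc v ^+ 2 +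
  (K0 / r * B * nc v ^+ 2 + K0 / r * B * nc v ^+ 2)); last by ring.
by lra.
Qed.

End HarmonicApproximation.

(** * Approximation of harmonic mappings together with their derivatives *)

Section HarmonicC1Approximation.
Variable R : realType.
Local Notation C := R[i].
Implicit Types (p q : {poly C}) (f : C -> C) (z w v c : C).

Lemma harmonic_approx f (s e : R) : Defs.harmonic f ->
  (forall z, nc z < 1 -> {for z, continuous f}) -> 0 < s -> s < 1 -> 0 < e ->
  exists p q, forall z, nc z <= s -> nc (f z - hpoly p q z) <= e.
Proof.
move=> hf cf s0 s1 e0.
have cs z : nc z <= s -> {for z, continuous f} by move=> zs; apply/cf/(le_lt_trans zs).
have [p [q h]] := circle_approx s0 e0 cs.
by exists p, q; exact: harmonic_max.
Qed.

Lemma dline_eps f z v (X : C) :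
  (forall c, dline (fun w => complex.Re (c * f w)) z v (complex.Re (c * X))) ->
  forall e : R, 0 < e -> exists2 d : R, 0 < d & forall t : R, `|t| < d ->
    nc (f (z + t%:C * v) - f z - t%:C * X) <= e * `|t|.
Proof.
move=> hX e e0; have e20 : 0 < e / 2 by rewrite divr_gt0.
have [d1 d10 h1] := (is_derive_epsP _ _ _).1 (hX 1) _ e20.
have [d2 d20 h2] := (is_derive_epsP _ _ _).1 (hX (- 'i%C)) _ e20.
exists (Num.min d1 d2); first by rewrite lt_min d10.
move=> t; rewrite lt_min => /andP[/h1 k1 /h2 k2].
apply: (le_trans (nc_le_ReIm _)).
have Z (c : C) : complex.Re (c * (f (z + t%:C * v) - f z - t%:C * X)) =
    complex.Re (c * f (z + (0 + t)%:C * v)) - complex.Re (c * f (z + (0 : R)%:C * v)) -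
    complex.Re (c * X) * t.
  rewrite add0r (_ : (0 : R)%:C = 0)// mul0r addr0 !mulrBr !reB.
  by congr (_ - _); rewrite mulrCA reMr mulrC.
have E1 := Z 1; rewrite mul1r in E1; rewrite E1.
have E2 := Z (- 'i%C).
have ImE w : complex.Im w = complex.Re (- 'i%C * w).
  by case: w => x y /=; rewrite oppr0 mul0r mulN1r sub0r opprK.
by rewrite ImE E2 [e]splitr mulrDl; exact: lerD.
Qed.

Lemma ncD4 a b c d : nc (- a + b - c + d : C) <= nc a + nc b + nc c + nc d.
Proof.
apply: (le_trans (ncD _ _)); rewrite lerD2r; apply: (le_trans (ncD _ _)).
by rewrite ncN lerD2r; apply: (le_trans (ncD _ _)); rewrite ncN.
Qed.

(** Compares difference quotients of [f] and of the polynomial for one fixed step [t]: that of the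
    polynomial is close to its derivative uniformly over the approximants, that of [f] by
    differentiability at [z]. The resulting [h] still depends on [z]. *)
Lemma harmonic_deriv_pointwise f (r s e : R) z : Defs.harmonic f ->
  (forall z, nc z < 1 -> {for z, continuous f}) -> 0 <= r -> r < s -> s < 1 ->
  nc z <= r -> 0 < e -> exists2 h : R, 0 < h & forall p q,
  (forall w, nc w <= s -> nc (f w - hpoly p q w) <= h) ->
  nc (dz f z - p^`().[z]) <= e /\ nc (dzbar f z - (q^`().[z])^*) <= e.
Proof.
move=> hf cf r0 rs s1 zr e0.
have s0 : 0 < s := le_lt_trans r0 rs.
pose r' := (r + s) / 2.
have r'0 : 0 < r' by rewrite /r'; lra.
have r's : r' < s by rewrite /r'; lra.
have rr' : r < r' by rewrite /r'; lra.
have [K K0 hK] := hpoly_taylor r'0 r's.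
have cs x : nc x <= s -> {for x, continuous f} by move=> xs; apply/cf/(le_lt_trans xs).
have [Bf Bf0 hBf] := disk_bounded (ltW s0) cs.
pose B := Bf + 1; have B0 : 0 < B by rewrite ltr_wpDl.
have [[C1f _ _] _] := hf.
have zD : unit_disk z.
  by rewrite /unit_disk /disk /= subr0; apply: le_lt_trans zr (lt_trans rs s1).
have [/has_partials_dline hp _ _] := C1f z zD.
have e40 : 0 < e / 4 by rewrite divr_gt0.
have [d1 d10 h1] := dline_eps (fun c => (hp c).1) e40.
have [d2 d20 h2] := dline_eps (fun c => (hp c).2) e40.
(* The third entry keeps the displaced points in the disk of radius [r']; the last makes the Taylor
   remainder [K * B * t ^+ 2] at most [t * e / 4]. *)
pose t := Num.min (Num.min (d1 / 2) (d2 / 2)) (Num.min (r' - r) (e / 4 / (K * B + 1))).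
have KB0 : 0 <= K * B by rewrite mulr_ge0// ltW.
have KB1 : 0 < K * B + 1 by rewrite ltr_wpDl.
have t0 : 0 < t by rewrite /t !lt_min subr_gt0 rr' !divr_gt0.
have [td1 td2 tr tK] : [/\ t < d1, t < d2, t <= r' - r & t <= e / 4 / (K * B + 1)].
  have : t <= t by []; rewrite {2}/t !le_min => /andP[/andP[k1 k2] /andP[k3 k4]].
  by split=> //; lra.
have hd1 : `|t| < d1 by rewrite gtr0_norm.
have hd2 : `|t| < d2 by rewrite gtr0_norm.
(* The entry 1 keeps the approximants bounded by [B] on the circle; after division by [t], the two
   approximation errors cost e/8 each. *)
exists (Num.min 1 (t * e / 8)); first by rewrite lt_min ltr01 divr_gt0// mulr_gt0.
move=> p q hpq.
have hB w : nc w = s -> nc (hpoly p q w) <= B.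
  move=> ws; have := hpq w; rewrite ws lexx => /(_ isT); rewrite le_min => /andP[k _].
  have := hBf w; rewrite ws lexx => /(_ isT) k'.
  by have := ncBD (hpoly p q w) (f w); rewrite ncB /B; lra.
have [_ tay] := hK p q B hB.
have ni : nc ('i%C : C) = 1 by rewrite /= expr0n expr1n add0r sqrtr1.
have step v (X : C) : nc v = 1 -> nc (f (z + t%:C * v) - f z - t%:C * X) <= e / 4 * `|t| ->
    nc (X - (p^`().[z] * v + (q^`().[z])^* * v^*)) <= e.
  move=> v1; rewrite gtr0_norm// => hX.
  have tv : nc (t%:C * v) = t by rewrite ncM ncR v1 mulr1 gtr0_norm.
  have zt : nc (z + t%:C * v) <= r' by apply: (le_trans (ncD _ _)); rewrite tv; lra.
  have zr' : nc z <= r' by lra.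
  have := tay z (t%:C * v) zr' zt; rewrite tv => hQ.
  have := hpq _ (le_trans zt (ltW r's)); rewrite le_min => /andP[_ hQ1].
  have := hpq _ (le_trans zr' (ltW r's)); rewrite le_min => /andP[_ hQ2].
  rewrite -(ler_pM2l t0) -{1}(gtr0_norm t0) -ncR -ncM.
  set Y := p^`().[z] * v + _.
  have -> : t%:C * (X - Y) = - (f (z + t%:C * v) - f z - t%:C * X) +
    (f (z + t%:C * v) - hpoly p q (z + t%:C * v)) - (f z - hpoly p q z) +
    (hpoly p q (z + t%:C * v) - hpoly p q z -
      (p^`().[z] * (t%:C * v) + (q^`().[z])^* * (t%:C * v)^*)).
    by rewrite conjcMr /Y; ring.
  apply: (le_trans (ncD4 _ _ _ _)); rewrite (_ : t * e = e / 4 * t + t * e / 8 +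
    t * e / 8 + t * e / 2); last by field.
  rewrite !lerD//; apply: (le_trans hQ).
  move: tK; rewrite ler_pdivlMr ?ltr_wpDl// => tK.
  have : t * (t * (K * B + 1)) <= t * (e / 4) by rewrite ler_pM2l.
  have := sqr_ge0 t; have := mulr_ge0 (ltW t0) (ltW e0); rewrite expr2.
  by clear; nra.
have sx := step 1 _ (nc1 _) (h1 _ hd1); have sy := step 'i%C _ ni (h2 _ hd2).
rewrite conjc1 !mulr1 in sx; rewrite (_ : 'i%C^* = - 'i%C) in sy; last by rewrite /=; simpc.
have ii : 'i%C * 'i%C = -1 :> C by rewrite -expr2 sqr_i.
have n2 : nc (2^-1 : C) = 2^-1 by rewrite ncV nc_nat.
set a := p^`().[z] in sx sy *; set b := (q^`().[z])^* in sx sy *.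
set X := pdx f z - (a + b) in sx; set Y := pdy f z - (a * 'i%C + b * - 'i%C) in sy.
have EX : dz f z - a = 2^-1 * (X - 'i%C * Y).
  have -> : X - 'i%C * Y = pdx f z - 'i%C * pdy f z - (a + b) + ('i%C * 'i%C) * (a - b).
    by rewrite /X /Y; ring.
  by rewrite ii /dz; field.
have EY : dzbar f z - b = 2^-1 * (X + 'i%C * Y).
  have -> : X + 'i%C * Y = pdx f z + 'i%C * pdy f z - (a + b) - ('i%C * 'i%C) * (a - b).
    by rewrite /X /Y; ring.
  by rewrite ii /dzbar; field.
rewrite EX EY !ncM n2.
have := ncD X (- ('i%C * Y)); have := ncD X ('i%C * Y); rewrite ncN ncM ni mul1r.
by move=> k1 k2; split; lra.
Qed.

Lemma hpolyB p q p' q' z : hpoly p q z - hpoly p' q' z = hpoly (p - p') (q - q') z.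
Proof. by rewrite /hpoly !(hornerD, hornerN) conjB; ring. Qed.

(** A second approximant, as close as the pointwise lemma demands at [z], has almost the derivatives
    of [f] there. It lies within 2h of the first one on the circle, and [hpoly_taylor] applied to
    their difference bounds the change of derivative independently of [z]. *)
Lemma harmonic_deriv_uniform f (r s : R) : Defs.harmonic f ->
  (forall z, nc z < 1 -> {for z, continuous f}) -> 0 < r -> r < s -> s < 1 ->
  exists2 K : R, 0 <= K & forall p q (h : R), 0 < h ->
  (forall w, nc w <= s -> nc (f w - hpoly p q w) <= h) -> forall z, nc z <= r ->
  nc (dz f z - p^`().[z]) <= K * h /\ nc (dzbar f z - (q^`().[z])^*) <= K * h.
Proof.
move=> hf cf r0 rs s1; have s0 : 0 < s := lt_trans r0 rs.
have [K K0 hK] := hpoly_taylor r0 rs.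
exists (K * 2); first by rewrite mulr_ge0.
move=> p q h h0 hpq z zr.
have main (e : R) : 0 < e -> nc (dz f z - p^`().[z]) <= K * 2 * h + e /\
    nc (dzbar f z - (q^`().[z])^*) <= K * 2 * h + e.
  move=> e0; have [h1 h10 hh1] := harmonic_deriv_pointwise hf cf (ltW r0) rs s1 zr e0.
  have m0 : 0 < Num.min h h1 by rewrite lt_min h0.
  have [p2 [q2 hp2]] := harmonic_approx hf cf s0 s1 m0.
  have [w|k1 k2] := hh1 p2 q2.
    by move=> /hp2; rewrite le_min => /andP[].
  have B2 w : nc w = s -> nc (hpoly (p - p2) (q - q2) w) <= 2 * h.
    move=> ws; rewrite -hpolyB.
    have := hpq w; rewrite ws lexx => /(_ isT) a1.
    have := hp2 w; rewrite ws lexx le_min => /(_ isT) /andP[a2 _].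
    have -> : hpoly p q w - hpoly p2 q2 w = (f w - hpoly p2 q2 w) - (f w - hpoly p q w) by ring.
    by apply: (le_trans (ncD _ _)); rewrite ncN; lra.
  have [/(_ z zr)[k3 k4] _] := hK _ _ _ B2.
  rewrite !derivB !(hornerD, hornerN) mulrA in k3 k4; split.
    have -> : dz f z - p^`().[z] = (dz f z - p2^`().[z]) - (p^`().[z] - p2^`().[z]) by ring.
    by apply: (le_trans (ncD _ _)); rewrite ncN; lra.
  rewrite -ncJ conjB in k4.
  have -> : dzbar f z - (q^`().[z])^* = (dzbar f z - (q2^`().[z])^*) -
    ((q^`().[z])^* - (q2^`().[z])^*) by ring.
  by apply: (le_trans (ncD _ _)); rewrite ncN; lra.
by split; apply/ler_addgt0Pr => e /main[].
Qed.

Lemma harmonic_C1_approx f (r e : R) : Defs.harmonic f ->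
  (forall z, nc z < 1 -> {for z, continuous f}) -> 0 < r -> r < 1 -> 0 < e ->
  exists p q, forall z, nc z <= r -> [/\ nc (f z - hpoly p q z) <= e,
    nc (dz f z - p^`().[z]) <= e & nc (dzbar f z - (q^`().[z])^*) <= e].
Proof.
move=> hf cf r0 r1 e0; pose s := (r + 1) / 2.
have rs : r < s by rewrite /s; lra.
have s1 : s < 1 by rewrite /s; lra.
have [K K0 hK] := harmonic_deriv_uniform hf cf r0 rs s1.
have h0 : 0 < e / (K + 1) by rewrite divr_gt0// ltr_wpDl.
have [p [q hpq]] := harmonic_approx hf cf (lt_trans r0 rs) s1 h0.
have Ke : K * (e / (K + 1)) <= e.
  by rewrite mulrA ler_pdivrMr ?ltr_wpDl// mulrC ler_pM2l// lerDl.
have Ke' : e / (K + 1) <= e.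
  by rewrite ler_pdivrMr ?ltr_wpDl// ler_peMr ?lerDr// ltW.
exists p, q => z zr; have [k1 k2] := hK p q _ h0 hpq z zr.
split; [|exact: le_trans k1 Ke|exact: le_trans k2 Ke].
exact: le_trans (hpq z (le_trans zr (ltW rs))) Ke'.
Qed.

(** The quadratic remainder of the approximants has the constant [K * (Bf + 1)] throughout; with [v]
    fixed, the approximation error is let tend to 0. *)
Lemma harmonic_rdiff f z : Defs.harmonic f ->
  (forall z, nc z < 1 -> {for z, continuous f}) -> nc z < 1 ->
  rdiff f z (dz f z) (dzbar f z).
Proof.
move=> hf cf z1; pose r := (nc z + 1) / 2; pose s := (r + 1) / 2.
have z0 := nc_ge0 z.
have r0 : 0 < r by rewrite /r; lra.
have zr : nc z < r by rewrite /r; lra.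
have r1 : r < 1 by rewrite /r; lra.
have rs : r < s by rewrite /s; lra.
have s1 : s < 1 by rewrite /s; lra.
have s0 := lt_trans r0 rs.
have [K' K'0 hK'] := harmonic_deriv_uniform hf cf r0 rs s1.
have [K K0 hK] := hpoly_taylor r0 rs.
have cs x : nc x <= s -> {for x, continuous f} by move=> xs; apply/cf/(le_lt_trans xs).
have [Bf Bf0 hBf] := disk_bounded (ltW s0) cs.
exists (K * (Bf + 1)), (r - nc z); split; rewrite ?subr_gt0//.
  by rewrite mulr_ge0// addr_ge0.
move=> v vr; have zvr : nc (z + v) <= r by apply: (le_trans (ncD _ _)); lra.
apply/ler_addgt0Pr => e e0.
have v0 := nc_ge0 v.
have D0 : 0 < 2 + 2 * K' * nc v by rewrite ltr_wpDr// !mulr_ge0.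
pose h := Num.min 1 (e / (2 + 2 * K' * nc v)).
have h0 : 0 < h by rewrite lt_min ltr01 divr_gt0.
have [h1 he] : h <= 1 /\ h * (2 + 2 * K' * nc v) <= e.
  have : h <= h by []; rewrite {2}/h le_min => /andP[-> k]; split=> //.
  by rewrite -ler_pdivlMr.
have [p [q hpq]] := harmonic_approx hf cf s0 s1 h0.
have hB w : nc w = s -> nc (hpoly p q w) <= Bf + 1.
  move=> ws; have := hpq w; rewrite ws lexx => /(_ isT) k.
  have := hBf w; rewrite ws lexx => /(_ isT) k'.
  by have := ncBD (hpoly p q w) (f w); rewrite ncB; lra.
have [_ /(_ z v (ltW zr) zvr) tay] := hK p q _ hB.
have [k1 k2] := hK' p q h h0 hpq z (ltW zr).
have k3 := hpq _ (le_trans zvr (ltW rs)); have k4 := hpq _ (le_trans (ltW zr) (ltW rs)).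
set T := hpoly p q (z + v) - _ - _ in tay.
have -> : f (z + v) - f z - (dz f z * v + dzbar f z * v^*) =
  T + ((f (z + v) - hpoly p q (z + v)) - (f z - hpoly p q z) -
   ((dz f z - p^`().[z]) * v + (dzbar f z - (q^`().[z])^*) * v^*)).
  by rewrite /T; ring.
apply: (le_trans (ncD _ _)); rewrite lerD// -[leRHS]/e.
apply: (le_trans (ncD _ _)); rewrite ncN.
have := ncD (f (z + v) - hpoly p q (z + v)) (- (f z - hpoly p q z)); rewrite ncN.
have := ncD ((dz f z - p^`().[z]) * v) ((dzbar f z - (q^`().[z])^*) * v^*).
rewrite !ncM ncJ => n1 n2.
have m1 := ler_wpM2r v0 k1; have m2 := ler_wpM2r v0 k2.
have hh : h * (2 + 2 * K' * nc v) = 2 * h + 2 * (K' * h * nc v) by ring.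
by rewrite hh in he; lra.
Qed.

End HarmonicC1Approximation.

(** * Continuity at a point by structural decomposition *)

Section ContinuityCombinators.
Variable R : realType.
Implicit Types (f g : R -> R) (x c : R).

(** Kept folded so that the tactic [ct] can select a rule from the shape of the function alone. *)
Definition ctat x f := {for x, continuous f}.

Lemma ct_cst x c : ctat x (fun=> c).
Proof. exact: cst_continuous. Qed.

Lemma ct_id x : ctat x (fun t => t).
Proof. exact: cvg_id. Qed.

Lemma ctD x f g : ctat x f -> ctat x g -> ctat x (fun t => f t + g t).
Proof. exact: continuousD. Qed.

Lemma ctN x f : ctat x f -> ctat x (fun t => - f t).
Proof. exact: continuousN. Qed.

Lemma ctM x f g : ctat x f -> ctat x g -> ctat x (fun t => f t * g t).
Proof. exact: continuousM. Qed.

Lemma ctX x f n : ctat x f -> ctat x (fun t => f t ^+ n).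
Proof.
move=> cf; elim: n => [|n IH]; first exact: ct_cst.
rewrite (_ : (fun t => f t ^+ n.+1) = fun t => f t * f t ^+ n); first exact: ctM.
by apply/funext => t; rewrite exprS.
Qed.

Lemma ctV x f : f x != 0 -> ctat x f -> ctat x (fun t => (f t)^-1).
Proof. exact: continuousV. Qed.

Lemma ct_sqrt x f : ctat x f -> ctat x (fun t => Num.sqrt (f t)).
Proof. by move=> cf; apply: (continuous_comp cf); exact: sqrt_continuous. Qed.

Lemma ct_min x f g : ctat x f -> ctat x g -> ctat x (fun t => Num.min (f t) (g t)).
Proof. exact: continuous_min. Qed.

(** The limit passage by which the slack [e] of the polynomial estimates is removed; continuity at 0
    suffices, no rate is computed. *)
Lemma ct_le_right (a d : R) f : 0 < d -> (forall e, 0 < e < d -> a <= f e) ->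
  ctat 0 f -> a <= f 0.
Proof.
move=> d0 h cf; rewrite leNgt; apply/negP => fa.
have e0 : 0 < a - f 0 by rewrite subr_gt0.
have /cvgrPdist_lt/(_ _ e0) := cf; move=> /nbhs_ballP[d1 /= d10 hd].
pose e := Num.min d d1 / 2; have m0 : 0 < Num.min d d1 by rewrite lt_min d0.
have em : e < Num.min d d1 by rewrite /e; lra.
have e00 : 0 < e by rewrite /e; lra.
move: em; rewrite lt_min => /andP[ed ed1].
have /hd : ball 0 d1 e by rewrite /ball /= sub0r normrN gtr0_norm.
have := h e; rewrite e00 ed => /(_ isT) k.
by rewrite ltr_norml => /andP[k1 _]; lra.
Qed.

End ContinuityCombinators.

(** The constant case comes first, so that subterms free of the variable are closed at once;
    nonvanishing of denominators is left as side goals. *)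
Ltac ct := repeat lazymatch goal with
  | |- ctat _ (fun _ => ?c) => refine (@ct_cst _ _ c)
  | |- ctat _ (fun t => t) => refine (@ct_id _ _)
  | |- ctat _ (fun t => @Num.Def.sqrtr _ (@?f t)) => refine (@ct_sqrt _ _ f _)
  | |- ctat _ (fun t => @Order.min _ _ (@?f t) (@?g t)) => refine (@ct_min _ _ f g _ _)
  | |- ctat _ (fun t => @GRing.exp _ (@?f t) ?n) => refine (@ctX _ _ f n _)
  | |- ctat _ (fun t => @GRing.inv _ (@?f t)) => refine (@ctV _ _ f _ _)
  | |- ctat _ (fun t => @GRing.mul _ (@?f t) (@?g t)) => refine (@ctM _ _ f g _ _)
  | |- ctat _ (fun t => @Algebra.opp _ (@?f t)) => refine (@ctN _ _ f _)
  | |- ctat _ (fun t => @Algebra.add _ (@?f t) (@?g t)) => refine (@ctD _ _ f g _ _)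
  end.

(** * Bounded harmonic mappings with [lambda] equal to 1 at 0 *)

Section BoundedHarmonic.
Variable R : realType.
Local Notation C := R[i].
Implicit Types (p q : {poly C}) (f : C -> C) (z w v c : C).

Lemma hpoly_coef1 p : p^`().[0] = p`_1.
Proof. by rewrite horner_coef0 coef_deriv mulr1n. Qed.

(** The last bound has the factor 1 - 2e because each of the two derivatives at 0 may be off by [e],
    and 1 - e because the coefficients are taken on the circle of that radius; [e < 2^-1] keeps it
    positive. *)
Lemma bounded_harmonic_approx f (M : R) : Defs.harmonic f ->
  (forall z, nc z < 1 -> {for z, continuous f}) ->
  (forall z, nc z < 1 -> nc (f z) <= M) -> lambda f 0 = 1 ->
  forall e : R, 0 < e < 2^-1 -> exists p q,
  [/\ forall z, nc z <= 1 - e -> nc (f z - hpoly p q z) <= e,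
     forall z, nc z = 1 - e -> nc (hpoly p q z) <= M + e &
     (1 - 2 * e) * (1 - e) <= `|nc p`_1 - nc q`_1| * (1 - e)].
Proof.
move=> hf cf fM l1 e /andP[e0 e2].
have s0 : 0 < 1 - e by lra.
have s1 : 1 - e < 1 by lra.
have [p [q hpq]] := harmonic_C1_approx hf cf s0 s1 e0.
exists p, q; split.
- by move=> z /hpq[].
- move=> z zs; have [|k _ _] := hpq z; first by rewrite zs.
  have := fM z; rewrite zs => /(_ s1) k'.
  by have := ncBD (hpoly p q z) (f z); rewrite ncB; lra.
- rewrite ler_wpM2r ?(ltW s0)//.
  have [|_] := hpq 0; first by rewrite nc0 ltW.
  rewrite !hpoly_coef1 => k1 k2; move: l1; rewrite /lambda => l1.
  have m1 := le_trans (nc_dist _ _) k1.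
  have m2 := le_trans (nc_dist _ _) k2; rewrite ncJ in m2.
  have : nc (dz f 0) - nc (dzbar f 0) = (nc p`_1 - nc q`_1) +
    ((nc (dz f 0) - nc p`_1) - (nc (dzbar f 0) - nc q`_1)) by ring.
  move=> E; move: l1; rewrite E => l1.
  have := ler_normD (nc p`_1 - nc q`_1)
    ((nc (dz f 0) - nc p`_1) - (nc (dzbar f 0) - nc q`_1)).
  by have := ler_normB (nc (dz f 0) - nc p`_1) (nc (dzbar f 0) - nc q`_1); lra.
Qed.

Lemma bounded_harmonic_ge1 f (M : R) : Defs.harmonic f ->
  (forall z, nc z < 1 -> {for z, continuous f}) ->
  (forall z, nc z < 1 -> nc (f z) <= M) -> lambda f 0 = 1 -> 1 <= M.
Proof.
move=> hf cf fM l1.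
have M0 : 0 <= M by apply: le_trans (nc_ge0 _) (fM 0 _); rewrite nc0.
suff : 0 <= 2 * (M + 0) ^+ 2 - 2 * ((1 - 2 * 0) * (1 - 0)) ^+ 2 by nra.
apply: (@ct_le_right R 0 2^-1 (fun e => 2 * (M + e) ^+ 2 - 2 * ((1 - 2 * e) * (1 - e)) ^+ 2)).
- by rewrite invr_gt0.
- move=> e he; have [p [q [_ h2 h3]]] := bounded_harmonic_approx hf cf fM l1 he.
  case/andP: he => e0 e2.
  have s0 : 0 <= 1 - e by lra.
  have l0 : 0 <= (1 - 2 * e) * (1 - e) by apply: mulr_ge0; lra.
  (* With 2 as upper limit the sum is empty, so the bound itself must be nonnegative; its limit is 0
     <= 2M^2 - 2. *)
  have [_ k] := coef_hpoly_sq 2 s0 l0 h3 h2.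
  by rewrite big_geq in k.
- by ct.
Qed.

Lemma bounded_harmonic_lip f (M r : R) z w : Defs.harmonic f ->
  (forall z, nc z < 1 -> {for z, continuous f}) ->
  (forall z, nc z < 1 -> nc (f z) <= M) -> lambda f 0 = 1 ->
  0 <= r -> r < 1 -> nc z <= r -> nc w <= r ->
  nc (f z - f w) <= (K1 M + Num.sqrt (2 * M ^+ 2 - 2) *
     Num.sqrt ((1 + r ^+ 2) / (1 - r ^+ 2) ^+ 3 - 1)) * nc (z - w).
Proof.
move=> hf cf fM l1 r0 r1 zr wr.
(* The summand [2 * e] pays for replacing [f] by the polynomial at the two points; the remainder is
   [hpoly_lip_le] with radius, bound and [l] perturbed. *)
pose Phi (e : R) := 2 * e + (Num.min (Num.sqrt (2 * (M + e) ^+ 2 - ((1 - 2 * e) * (1 - e)) ^+ 2))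
    (4 * (M + e) / pi) + Num.sqrt (2 * (M + e) ^+ 2 - 2 * ((1 - 2 * e) * (1 - e)) ^+ 2) *
   Num.sqrt ((1 + (r / (1 - e)) ^+ 2) / (1 - (r / (1 - e)) ^+ 2) ^+ 3 - 1)) / (1 - e) * nc (z - w).
suff : nc (f z - f w) <= Phi 0.
  by rewrite /Phi !(mulr0, subr0, mulr1, add0r, addr0, invr1, expr1n).
have m0 : 0 < Num.min 2^-1 (1 - r) by rewrite lt_min invr_gt0 ltr0n subr_gt0.
apply: (ct_le_right m0).
  move=> e /andP[e0]; rewrite lt_min => /andP[e2 er].
  have he : 0 < e < 2^-1 by rewrite e0.
  have [p [q [h1 h2 h3]]] := bounded_harmonic_approx hf cf fM l1 he.
  have s0 : 0 <= 1 - e by lra.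
  have l0 : 0 <= (1 - 2 * e) * (1 - e) by apply: mulr_ge0; lra.
  have rs : r < 1 - e by lra.
  have := hpoly_lip_le r0 rs l0 h3 h2 zr wr.
  have k1 := h1 z (le_trans zr (ltW rs)); have k2 := h1 w (le_trans wr (ltW rs)).
  rewrite /Phi; set U := _ / (1 - e) * nc (z - w) => k3.
  have -> : f z - f w = (f z - hpoly p q z) - (f w - hpoly p q w) +
    (hpoly p q z - hpoly p q w) by ring.
  apply: (le_trans (ncD _ _)); rewrite lerD//; apply: (le_trans (ncD _ _)).
  by rewrite ncN mulr2n mulrDl mul1r lerD.
rewrite /Phi; ct => /=; rewrite ?subr0 ?oner_neq0 ?invr1 ?mulr1//.
by rewrite expf_neq0// gt_eqF// subr_gt0 expr_lt1.
Qed.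

Lemma bounded_harmonic_le f (M r : R) z : Defs.harmonic f ->
  (forall z, nc z < 1 -> {for z, continuous f}) ->
  (forall z, nc z < 1 -> nc (f z) <= M) -> lambda f 0 = 1 -> f 0 = 0 ->
  0 <= r -> r < 1 -> nc z <= r ->
  nc (f z) <= K1 M * r + Num.sqrt (2 * M ^+ 2 - 2) * Num.sqrt (r ^+ 4 / (1 - r ^+ 2)).
Proof.
move=> hf cf fM l1 f0 r0 r1 zr.
pose Phi (e : R) := 2 * e + (Num.min (Num.sqrt (2 * (M + e) ^+ 2 - ((1 - 2 * e) * (1 - e)) ^+ 2))
    (4 * (M + e) / pi) * (r / (1 - e)) +
   Num.sqrt (2 * (M + e) ^+ 2 - 2 * ((1 - 2 * e) * (1 - e)) ^+ 2) *
   Num.sqrt ((r / (1 - e)) ^+ 4 / (1 - (r / (1 - e)) ^+ 2))).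
suff : nc (f z) <= Phi 0.
  by rewrite /Phi !(mulr0, subr0, mulr1, add0r, addr0, invr1, expr1n).
have m0 : 0 < Num.min 2^-1 (1 - r) by rewrite lt_min invr_gt0 ltr0n subr_gt0.
apply: (ct_le_right m0).
  move=> e /andP[e0]; rewrite lt_min => /andP[e2 er].
  have he : 0 < e < 2^-1 by rewrite e0.
  have [p [q [h1 h2 h3]]] := bounded_harmonic_approx hf cf fM l1 he.
  have s0 : 0 <= 1 - e by lra.
  have l0 : 0 <= (1 - 2 * e) * (1 - e) by apply: mulr_ge0; lra.
  have rs : r < 1 - e by lra.
  have := hpoly_dist0_le r0 rs l0 h3 h2 zr.
  have k1 := h1 z (le_trans zr (ltW rs)).
  have k2 := h1 0; rewrite nc0 s0 in k2; have {}k2 := k2 isT.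
  rewrite /Phi; set U := _ + Num.sqrt _ * _ => k3.
  have -> : f z = (f z - hpoly p q z) - (f 0 - hpoly p q 0) +
    (hpoly p q z - hpoly p q 0) by rewrite f0; ring.
  apply: (le_trans (ncD _ _)); rewrite lerD//; apply: (le_trans (ncD _ _)).
  by rewrite ncN mulr2n mulrDl mul1r lerD.
rewrite /Phi; ct => /=; rewrite ?subr0 ?oner_neq0 ?invr1 ?mulr1//.
by rewrite gt_eqF// subr_gt0 expr_lt1.
Qed.

End BoundedHarmonic.

(** * Schwarz-Pick lemma *)

Section SchwarzPick.
Variable R : realType.
Local Notation C := R[i].
Implicit Types (p q : {poly C}) (f : C -> C) (z w v c u : C).

Lemma poly_max_modulus p (r m : R) : (forall z, nc z = r -> nc p.[z] <= m) ->
  forall z, nc z <= r -> nc p.[z] <= m.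
Proof.
move=> hm z zr; apply: nc_le_Re => c c1.
have ii : 'i%C * 'i%C = -1 :> C by rewrite -expr2 sqr_i.
have D q v w : dline (fun x => complex.Re (c * q.[x])) w v (complex.Re (c * (q^`().[w] * v))).
  by have := rdiff_dline v c (rdiff_horner q w); rewrite mul0r addr0.
apply: (@maximum_principle _ r m (fun w => complex.Re (c * p.[w]))
  (fun w => complex.Re (c * (p^`().[w] * 1))) (fun w => complex.Re (c * (p^`().[w] * 'i%C)))
  (fun w => complex.Re (c * (p^`()^`().[w] * 1)))
  (fun w => complex.Re (c * 'i%C * (p^`()^`().[w] * 'i%C)))) => //.
- by move=> w _; apply: continuous_re; exact: rdiff_continuous (rdiff_horner p w).
- move=> w _; split; try exact: D.
  + rewrite (_ : (fun x => complex.Re (c * (p^`().[x] * 1))) =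
      fun x => complex.Re (c * p^`().[x])); first exact: D.
    by apply/funext => x; rewrite mulr1.
  + rewrite (_ : (fun x => complex.Re (c * (p^`().[x] * 'i%C))) =
      fun x => complex.Re (c * 'i%C * p^`().[x])); last first.
      by apply/funext => x; rewrite mulrA mulrAC.
    have := rdiff_dline 'i%C (c * 'i%C) (rdiff_horner p^`() w).
    by rewrite mul0r addr0.
  + rewrite -reD mulr1 (_ : c * 'i%C * _ = 'i%C * 'i%C * (c * p^`()^`().[w])); last by ring.
    by rewrite ii mulN1r subrr.
- move=> w /hm; apply: le_trans; apply: (le_trans (Re_le_ncW _)).
  by rewrite ncM c1 mul1r.
Qed.

(** For real [a], |1 - a w|^2 - |w - a|^2 = (1 - a^2)(1 - |w|^2). *)
Lemma unimod_moebius w (a : R) : nc w <= 1 -> `|a| <= 1 ->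
  nc (w - a%:C) <= nc (1 - a%:C * w).
Proof.
move=> w1 a1; rewrite -(ler_pXn2r (_ : (0 < 2)%N)) ?nnegrE ?nc_ge0//.
have := lerXn2r 2 (nc_ge0 w) ler01 w1; rewrite expr1n !nc_sqr.
have : a ^+ 2 <= 1 by rewrite -real_normK ?num_real// expr_le1.
case: w {w1} => x y /= h1 h2; nra.
Qed.

(* With p - a = z p1, Schwarz's lemma should be applied to p1 / (1 - a p),
   which is not a polynomial; A = p1 * sum_(j < k) (a p)^j approximates it. *)
Lemma poly_schwarz_pick p (a rho : R) : `|a| < 1 -> 0 <= rho -> rho <= 1 ->
  (forall z, nc z = 1 -> nc p.[z] <= 1) -> p.[0] = a%:C ->
  nc (p.[rho%:C] - a%:C) <= rho * nc (1 - a%:C * p.[rho%:C]).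
Proof.
move=> a1 r0 r1 hp p0.
have /factor_theorem[p1 hp1] : root (p - (a%:C)%:P) 0.
  by rewrite /root hornerD hornerN hornerC p0 subrr.
have P1 z : p.[z] - a%:C = z * p1.[z].
  have := congr1 (horner^~ z) hp1.
  by rewrite hornerD hornerN hornerC hornerM hornerXsubC subr0 mulrC.
have rho1 : nc (rho%:C : C) <= 1 by rewrite ncR ger0_norm.
have pr := poly_max_modulus hp rho1.
rewrite P1 ncM ncR ger0_norm// ler_wpM2l//.
set b := p.[rho%:C] in pr *.
rewrite leNgt; apply/negP => lt; set d := nc p1.[rho%:C] - nc (1 - a%:C * b).
have d0 : 0 < d by rewrite subr_gt0.
(* From |A| <= 1 + x and |1 - (a b)^k| >= 1 - x the excess [d] is at most [x] times the sum of the
   two moduli, hence at most [x * S]: a contradiction once [x * S < d]. *)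
pose S := nc p1.[rho%:C] + nc (1 - a%:C * b) + 1.
have S0 : 0 < S by rewrite ltr_wpDl// addr_ge0// nc_ge0.
have a01 : 0 <= `|a| < 1 by rewrite normr_ge0.
have [k hk] := nat_geometric_lt a01 (divr_gt0 d0 S0).
pose x := `|a| ^+ k; have x0 : 0 <= x by rewrite exprn_ge0.
have xS : x * S < d.
  rewrite -ltr_pdivlMr//; apply: le_lt_trans hk; rewrite ler_peMl//.
  by rewrite ler1n.
pose A := p1 * \sum_(j < k) (a%:C *: p) ^+ j.
have EA z : A.[z] * (1 - a%:C * p.[z]) = p1.[z] * (1 - (a%:C * p.[z]) ^+ k).
  rewrite /A hornerM horner_sum -mulrA; congr (_ * _).
  rewrite (_ : \sum_(j < k) _ = \sum_(j < k) (a%:C * p.[z]) ^+ j); last first.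
    by apply: eq_bigr => j _; rewrite horner_exp hornerZ.
  have := subrX1 (a%:C * p.[z]) k; set S' := \sum_(j < k) _ => h.
  have -> : 1 - (a%:C * p.[z]) ^+ k = - ((a%:C * p.[z]) ^+ k - 1) by rewrite opprB.
  by rewrite h; ring.
have hA z : nc z = 1 -> nc A.[z] <= 1 + x.
  move=> z1; have pz := hp z z1.
  have k1 : 0 < nc (1 - a%:C * p.[z]).
    have := ncBD 1 (a%:C * p.[z]); rewrite nc1 ncM ncR.
    by have := nc_ge0 p.[z]; nra.
  rewrite -(ler_pM2r k1) -ncM EA ncM mulrC; apply: ler_pM; rewrite ?nc_ge0//.
    apply: (le_trans (ncD _ _)); rewrite nc1 ncN lerD2l ncX ncM ncR.
    by rewrite lerXn2r// ?nnegrE ?mulr_ge0 ?nc_ge0// ler_piMr.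
  have -> : nc p1.[z] = nc (p.[z] - a%:C) by rewrite P1 ncM z1 mul1r.
  by apply: unimod_moebius => //; exact: ltW.
have hAr := poly_max_modulus hA rho1.
have := congr1 (@nc R) (EA rho%:C); rewrite !ncM -/b => E.
have : nc (1 - (a%:C * b) ^+ k) >= 1 - x.
  have := ncBD 1 ((a%:C * b) ^+ k); rewrite nc1 ncX ncM ncR.
  suff : (`|a| * nc b) ^+ k <= x by lra.
  by rewrite lerXn2r// ?nnegrE ?mulr_ge0 ?nc_ge0// ler_piMr.
move=> h1.
have n1 := nc_ge0 p1.[rho%:C]; have n2 := nc_ge0 (1 - a%:C * b).
have := ler_wpM2l n1 h1; rewrite -E.
have := ler_wpM2r n2 hAr.
by move: xS; rewrite /S /d; nra.
Qed.

(* Restricted to the line through 0 in direction [u], Re p becomes a polynomial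
   with real coefficients, to which Schwarz-Pick applies with real values. *)
Definition sym_poly u p : {poly C} := \poly_(i < size p) (complex.Re (p`_i * u ^+ i))%:C.

Lemma sym_polyE u p z : nc u = 1 ->
  (sym_poly u p).[z] = 2^-1 * (p.[z * u] + (p.[z^* * u])^*).
Proof.
move=> u1; rewrite horner_poly !horner_coef conj_sum -big_split /= mulr_sumr.
apply: eq_bigr => i _.
have -> : (complex.Re (p`_i * u ^+ i))%:C = 2^-1 * (p`_i * u ^+ i + (p`_i * u ^+ i)^*).
  by rewrite addcJ; field.
by rewrite !conjM !exprMn conjM !conjX conjcK; ring.
Qed.

(** Rescaled by [s] and [B], the symmetrized polynomial is real at 0 and at |z|/s, so Schwarz-Pick
    becomes a real inequality that can be solved for Re p(z). The cross-multiplied form has no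
    denominator, which helps in the later limit. *)
Lemma poly_harnack p z (B s l : R) : 0 < s -> nc z <= s ->
  (forall w, nc w = s -> nc p.[w] <= B) -> `|complex.Re p.[0]| < B ->
  l <= complex.Re p.[0] -> - B <= l ->
  B * (l - nc z / s * B) <= complex.Re p.[z] * (B - nc z / s * l).
Proof.
move=> s0 zs hB p0B lp lB; have B0 : 0 < B := le_lt_trans (normr_ge0 _) p0B.
have [u u1 zu] := unit_direction z.
pose P := (B^-1)%:C *: (sym_poly u p \Po (s%:C *: 'X)).
have EP w : P.[w] = (B^-1)%:C * (sym_poly u p).[s%:C * w].
  by rewrite hornerZ horner_comp hornerZ hornerX.
pose a := complex.Re p.[0] / B; pose rho := nc z / s.
have r0 : 0 <= rho by rewrite divr_ge0 ?nc_ge0// ltW.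
have r1 : rho <= 1 by rewrite ler_pdivrMr// mul1r.
have a1 : `|a| < 1 by rewrite normrM normfV (gtr0_norm B0) ltr_pdivrMr// mul1r.
have P0 : P.[0] = a%:C.
  rewrite EP mulr0 sym_polyE// conjc0 !mul0r addcJ /a rcM mulrC; congr (_ * _).
  by field.
have Pr : P.[rho%:C] = (complex.Re p.[z] / B)%:C.
  have sr : s%:C * rho%:C = (nc z)%:C :> C.
    by rewrite -rcM /rho mulrC divfK ?gt_eqF.
  rewrite EP sr sym_polyE// conjR -zu addcJ rcM mulrC; congr (_ * _).
  by field.
have hP w : nc w = 1 -> nc P.[w] <= 1.
  move=> w1; rewrite EP sym_polyE// !ncM ncV nc_nat ncR gtr0_norm ?invr_gt0//.
  have tw v : nc v = 1 -> nc p.[s%:C * w * v] <= B.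
    by move=> v1; apply: hB; rewrite !ncM ncR w1 v1 gtr0_norm// !mulr1.
  have tw' : nc p.[(s%:C * w)^* * u] <= B.
    by apply: hB; rewrite !ncM ncJ ncM ncR w1 u1 gtr0_norm// !mulr1.
  have := ncD p.[s%:C * w * u] (p.[(s%:C * w)^* * u])^*; rewrite ncJ.
  have := tw _ u1; move: tw'; set n := nc (_ + _) => h1 h2 h3.
  rewrite mulrCA -[leRHS](mulVf (_ : (2 : R) != 0))// ler_pM2l ?invr_gt0//.
  by rewrite mulrC ler_pdivrMr//; lra.
have b1 := poly_max_modulus hP (_ : nc (rho%:C : C) <= 1).
have := poly_schwarz_pick a1 r0 r1 hP P0.
have {b1} := b1 _; rewrite Pr ncR ger0_norm// => /(_ r1).
rewrite -rcB -rcM -[1 - _]/(1%:C - _) -rcB !ncR.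
set b := complex.Re p.[z] / B => b1 hb.
have [lb la] : - 1 < a /\ a < 1 by move: a1; rewrite ltr_norml => /andP[].
have [lb1 lb2] : - 1 <= b /\ b <= 1 by move: b1; rewrite ler_norml => /andP[].
have ab1 : 0 < 1 - a * b.
  rewrite subr_gt0; apply: le_lt_trans (ler_norm _) _.
  by rewrite normrM; apply: le_lt_trans a1; rewrite ler_piMr.
move: hb; rewrite (gtr0_norm ab1) distrC => /(le_trans (ler_norm _)) hb.
have Eb : complex.Re p.[z] = b * B by rewrite /b divfK// gt_eqF.
have Ea : complex.Re p.[0] = a * B by rewrite /a divfK// gt_eqF.
pose x := l / B; have El : l = x * B by rewrite /x divfK// gt_eqF.
have xa : x <= a by rewrite ler_pM2r ?invr_gt0.
have x1 : - 1 <= x by rewrite ler_pdivlMr// mulN1r.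
rewrite -/rho Eb El.
(* The quotient (x - rho) / (1 - rho x) is nondecreasing in x, so the exact value [a] may be
   replaced by its lower bound [x]. *)
suff H : x - rho <= b * (1 - rho * x).
  by have := ler_wpM2l (sqr_ge0 B) H; rewrite expr2; lra.
have e1 : a - rho <= b * (1 - rho * a) by lra.
have ra : 0 < 1 - rho * a by nra.
have rx : 0 <= 1 - rho * x by nra.
rewrite -(ler_pM2r ra); have := ler_wpM2r rx e1.
have : 0 <= (a - x) * (1 - rho * rho) by apply: mulr_ge0; nra.
clear; nra.
Qed.

Lemma lambda_le_Lambda f z : lambda f z <= Lambda f z.
Proof.
rewrite /lambda /Lambda ler_norml.
by have := nc_ge0 (dz f z); have := nc_ge0 (dzbar f z); lra.
Qed.

(** Conjugating the antiholomorphic summand does not change the real part, so Re (c D) is the real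
    part of c u dz f + conj c u conj (dzbar f), which is holomorphic with modulus at most [Lambda].
    At 0 the rotation makes it |D 0|, which is at least [lambda], that is 1. *)
Lemma harmonic_deriv_lower f (L : R) u : Defs.harmonic f ->
  (forall z, nc z < 1 -> {for z, continuous f}) ->
  (forall z, nc z < 1 -> Lambda f z <= L) -> lambda f 0 = 1 -> nc u = 1 ->
  exists2 c : C, nc c = 1 & forall z, nc z < 1 ->
    L * (1 - L * nc z) / (L - nc z) <= complex.Re (c * (u * dz f z + u^* * dzbar f z)).
Proof.
move=> hf cf fL l1 u1.
have L1 : 1 <= L by rewrite -l1; apply: le_trans (lambda_le_Lambda _ _) (fL _ _); rewrite nc0.
pose D z := u * dz f z + u^* * dzbar f z.
have D1 : 1 <= nc (D 0).
  rewrite -l1 /lambda /D; have := ncBD (u * dz f 0) (- (u^* * dzbar f 0)).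
  have := ncBD (- (u^* * dzbar f 0)) (u * dz f 0); rewrite ncB.
  by rewrite opprK !ncN !ncM ncJ u1 !mul1r ler_norml; lra.
have [c c1 cD] := nc_rotate (D 0); exists c => // z z1.
rewrite -/(D z); set r := nc z; set X := complex.Re _.
have r0 : 0 <= r := nc_ge0 z.
rewrite ler_pdivrMr ?subr_gt0 ?(lt_le_trans z1)//.
(* [poly_harnack] on the disk of radius 1 - e, with bound L + 3e and base value 1 - 2e; X + 2e
   dominates the real part of the approximant at [z]. *)
pose Phi (e : R) := (X + 2 * e) * (L + 3 * e - r / (1 - e) * (1 - 2 * e)) -
  (L + 3 * e) * (1 - 2 * e - r / (1 - e) * (L + 3 * e)).
suff : 0 <= Phi 0.
  by rewrite /Phi !(mulr0, subr0, mulr1, addr0, divr1); lra.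
have m0 : 0 < 1 - r by rewrite subr_gt0.
apply: (ct_le_right m0); last by rewrite /Phi; ct; rewrite subr0 oner_neq0.
move=> e /andP[e0 er]; have s0 : 0 < 1 - e by lra.
have [|p [q hpq]] := harmonic_C1_approx hf cf s0 _ e0; first by lra.
pose P := (c * u) *: p^`() + (c^* * u) *: q^`().
have RP w : complex.Re P.[w] =
    complex.Re (c * (u * p^`().[w] + u^* * (q^`().[w])^*)).
  rewrite hornerD !hornerZ !mulrDr !reD; congr (complex.Re _ + _); first by rewrite mulrA.
  by rewrite -[RHS]reJ !conjM !conjcK mulrA.
have RPD w : nc w <= 1 - e -> `|complex.Re P.[w] - complex.Re (c * D w)| <= 2 * e.
  move=> /hpq[_ h1 h2]; rewrite RP -reB -mulrBr.
  apply: (le_trans (Re_le_nc _)); rewrite ncM c1 mul1r ncB /D opprD addrACA -!mulrBr.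
  by apply: (le_trans (ncD _ _)); rewrite !ncM ncJ u1 !mul1r; lra.
have hB w : nc w <= 1 - e -> nc P.[w] <= L + 2 * e.
  move=> we; have [_ h1 h2] := hpq w we; rewrite hornerD !hornerZ.
  apply: (le_trans (ncD _ _)); rewrite !ncM ncJ c1 u1 !mul1r.
  have := ncBD p^`().[w] (dz f w); rewrite (ncB p^`().[w]) => k1.
  have := ncBD (q^`().[w])^* (dzbar f w); rewrite (ncB (q^`().[w])^*) ncJ => k2.
  by have := fL w _; rewrite /Lambda => /(_ ltac:(lra)); lra.
have z0 : nc (0 : C) <= 1 - e by rewrite nc0 ltW.
have P0 : 1 - 2 * e <= complex.Re P.[0].
  have := RPD 0 z0; rewrite cD /= ler_norml; lra.
have zs : nc z <= 1 - e by rewrite -/r; lra.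
(* 2e is the approximation error; one more [e] gives the strict inequality at 0 that [poly_harnack]
   asks for. *)
have HB w : nc w = 1 - e -> nc P.[w] <= L + 3 * e.
  by move=> we; apply: (le_trans (hB _ _)); rewrite ?we//; lra.
have PB : `|complex.Re P.[0]| < L + 3 * e.
  by apply: le_lt_trans (Re_le_nc _) _; apply: (le_lt_trans (hB _ z0)); lra.
have := poly_harnack s0 zs HB PB P0 _; rewrite -/r => /(_ ltac:(lra)).
have : complex.Re P.[z] <= X + 2 * e.
  by have := RPD z zs; rewrite -/X ler_norml; lra.
have : 0 <= L + 3 * e - r / (1 - e) * (1 - 2 * e).
  have : r / (1 - e) <= 1 by rewrite ler_pdivrMr// mul1r.
  have : 0 <= r / (1 - e) by rewrite divr_ge0// ltW.
  by nra.
rewrite /Phi => k1 k2 k3; rewrite subr_ge0; apply: (le_trans k3).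
by apply: ler_wpM2r.
Qed.

End SchwarzPick.

(** * From almost everywhere to everywhere *)

Section AlmostEverywhere.
Variable R : realType.
Local Notation C := R[i].
Implicit Types (f : C -> C) (z w : C).

(** Otherwise a whole open square around [z] would lie in the exceptional null set, although its
    area is positive. *)
Lemma ae_disk_dense (P : C -> Prop) z (d : R) : ae_disk P -> nc z < 1 -> 0 < d ->
  exists w, [/\ nc (w - z) < d, nc w < 1 & P w].
Proof.
move=> [N [mN N0 hN]] z1 d0; apply: contrapT => H.
pose m := Num.min d (1 - nc z).
have m0 : 0 < m by rewrite lt_min d0 subr_gt0.
pose a := complex.Re z; pose b := complex.Im z; pose e := m / 4.
have e0 : 0 < e by rewrite divr_gt0.
have sub : (`]a - e, a + e[%classic `*` `]b - e, b + e[%classic) `<=` N.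
  move=> [x y] [/= xa yb]; apply: hN => /= K; apply: H; exists (x +i* y).
  have hd : nc ((x +i* y) - z) < m.
    apply: (le_lt_trans (nc_le_ReIm _)).
    rewrite reB imD imN -/a -/b /=.
    move: xa yb; rewrite !in_itv /= => /andP[x1 x2] /andP[y1 y2].
    have h1 : `|x - a| < e by rewrite ltr_norml; lra.
    have h2 : `|y - b| < e by rewrite ltr_norml; lra.
    rewrite /e in h1 h2; lra.
  move: hd; rewrite lt_min => /andP[hd1 hd2].
  have w1 : nc (x +i* y) < 1.
    have := ncD ((x +i* y) - z) z; rewrite subrK; lra.
  split => //. by apply: K; rewrite /unit_disk /disk /mkset subr0.
have mI (c : R) : measurable (`]c - e, c + e[%classic : set R).
  exact: measurable_itv.
pose A := `]a - e, a + e[%classic : set R; pose B := `]b - e, b + e[%classic : set R.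
have : ((@lebesgue_measure R \x @lebesgue_measure R) (A `*` B) <=
    (@lebesgue_measure R \x @lebesgue_measure R) N)%E.
  apply: le_measure; rewrite ?inE; [|exact: mN|exact: sub].
  by apply: measurableX; exact: mI.
have l (c : R) : lebesgue_measure (`]c - e, c + e[%classic : set R) = (e + e)%:E.
  rewrite lebesgue_measure_itv /= lte_fin ifT; last lra.
  by rewrite -EFinD; congr (_%:E); lra.
have -> : ((@lebesgue_measure R \x @lebesgue_measure R) (A `*` B) =
    (e + e)%:E * (e + e)%:E)%E.
  by rewrite product_measure1E; [congr (_ * _)%E; exact: l|exact: mI|exact: mI].
rewrite N0 -EFinM lee_fin leNgt => /negP; apply.
by apply: mulr_gt0; exact: addr_gt0.
Qed.

(** The hypothesis is a quadratic inequality in [t]; completing the square confines [t] below its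
    larger root, which is [Lambda']. *)
Lemma elliptic_bound (K K' l t : R) : 1 <= K -> 0 <= K' -> 0 <= l -> 0 <= t ->
  t ^+ 2 <= K * (t * l) + K' -> t <= Lambda' K K' l.
Proof.
move=> K1 K0 l0 t0 h; rewrite /Lambda' ler_pdivlMr//.
have : `|2 * t - K * l| <= Num.sqrt (K ^+ 2 * l ^+ 2 + 4 * K').
  rewrite -sqrtr_sqr ler_wsqrtr//; rewrite !expr2 in h *; nra.
by have := ler_norm (2 * t - K * l); lra.
Qed.

Lemma dz_dzbar_dist f z w :
  nc (dz f z - dz f w) <= (nc (pdx f z - pdx f w) + nc (pdy f z - pdy f w)) / 2 /\
  nc (dzbar f z - dzbar f w) <= (nc (pdx f z - pdx f w) + nc (pdy f z - pdy f w)) / 2.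
Proof.
have i1 : nc ('i%C : C) = 1 by rewrite /= expr0n expr1n add0r sqrtr1.
have ni (v : C) : nc ('i%C * v) = nc v by rewrite ncM i1 mul1r.
rewrite /dz /dzbar; move: (pdx f z) (pdy f z) (pdx f w) (pdy f w) => x y x' y'.
have half (v : C) : nc (v / 2) = nc v / 2 by rewrite ncM ncV nc_nat.
split; rewrite -mulrBl half ler_pM2r ?invr_gt0// -(ni (y - y')) mulrBr.
  rewrite -(ncN ('i%C * y - _)).
  have -> : x - 'i%C * y - (x' - 'i%C * y') = x - x' + - ('i%C * y - 'i%C * y') by ring.
  exact: ncD.
by rewrite opprD addrACA; exact: ncD.
Qed.

Lemma Lambda_close f z w :
  Lambda f z - Lambda f w <= nc (pdx f z - pdx f w) + nc (pdy f z - pdy f w).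
Proof.
have [h1 h2] := dz_dzbar_dist f z w.
rewrite /Lambda opprD addrACA [leRHS]splitr; apply: lerD.
  exact: le_trans (ncBD _ _) h1.
exact: le_trans (ncBD _ _) h2.
Qed.

(** The Jacobian is at most [Lambda] times [lambda], so ellipticity at a point gives the hypothesis
    of [elliptic_bound]. Such points are dense, and [Lambda] is continuous because the partial
    derivatives are. *)
Lemma elliptic_Lambda_le (K K' l : R) f : 1 <= K -> 0 <= K' ->
  elliptic_harmonic K K' f -> (forall z, unit_disk z -> lambda f z <= l) ->
  forall z, nc z < 1 -> Lambda f z <= Lambda' K K' l.
Proof.
move=> K1 K0 [[[C1f _ _] _] [cf sp _ _ ae]] hl z z1.
have D w : nc w < 1 -> unit_disk w by rewrite /unit_disk /disk /= subr0.
rewrite leNgt; apply/negP => lt.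
have [_ cx cy] := C1f z (D z z1).
have e0 : 0 < (Lambda f z - Lambda' K K' l) / 2 by rewrite divr_gt0// subr_gt0.
have [d1 d10 h1] := (continuous_epsP _ _).1 cx _ e0.
have [d2 d20 h2] := (continuous_epsP _ _).1 cy _ e0.
have d0 : 0 < Num.min d1 d2 by rewrite lt_min d10.
have [w [+ w1 hw]] := ae_disk_dense ae z1 d0.
rewrite lt_min => /andP[/h1 k1 /h2 k2]; rewrite ncB in k1; rewrite ncB in k2.
have : Lambda f w <= Lambda' K K' l.
  have w0 : 0 <= Lambda f w by rewrite addr_ge0// nc_ge0.
  have l0 : 0 <= l by apply: le_trans (normr_ge0 _) (hl w (D w w1)).
  apply: elliptic_bound => //; apply: (le_trans hw).
  rewrite lerD2r; apply: ler_wpM2l; first lra.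
  have := hl w (D w w1); have := sp w (D w w1).
  rewrite /Defs.jacobian /lambda /Lambda => j0 jl.
  rewrite subr_sqr mulrC; apply: ler_wpM2l; last exact: le_trans (ler_norm _) jl.
  by rewrite addr_ge0// nc_ge0.
move=> le; have := Lambda_close f z w; apply/negP; rewrite -ltNge.
apply: (lt_le_trans (ltrD k1 k2)).
by rewrite -splitr lerD2l lerN2.
Qed.

End AlmostEverywhere.

(** * The radius equation *)

Section RadiusEquation.
Variable R : realType.
Implicit Types (L r s x : R) (p k n : nat) (M : nat -> R).

(* [dpsi] is the derivative of [psi]; [phi_term] is a summand of [phi] with
   n = 2(k-1), after r sqrt(4 - 3r^2 + r^4) / (1 - r^2)^(3/2) has been rewritten
   as sqrt((1 + r^2) / (1 - r^2)^3 - 1), which is visibly monotone. *)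
Definition dpsi L r := L * (1 - L * r) / (L - r).
Definition psi L r := L ^+ 2 * r + (L ^+ 3 - L) * ln (1 - r / L).
Definition phi_term (m : R) n r := r ^+ n * (n.+1%:R * K1 m + Num.sqrt (2 * m ^+ 2 - 2) *
  (n%:R * (r / Num.sqrt (1 - r ^+ 2)) + Num.sqrt ((1 + r ^+ 2) / (1 - r ^+ 2) ^+ 3 - 1))).
Definition sigma p M r := \sum_(2 <= k < p.+1) r ^+ (2 * k - 1) *
    (K1 (M (p - k + 1)%N) +
     Num.sqrt (2 * M (p - k + 1)%N ^+ 2 - 2) * (r / Num.sqrt (1 - r ^+ 2))).

(** In this form [r] occurs once, with a nonnegative coefficient in front of 1 / (L - r):
    monotonicity can be read off, strict for L > 1. *)
Lemma dpsiE L r : 1 <= L -> r < 1 -> dpsi L r = L ^+ 2 - L * (L ^+ 2 - 1) / (L - r).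
Proof. by move=> L1 r1; rewrite /dpsi; field; lra. Qed.

Lemma dpsi0 L : 1 <= L -> dpsi L 0 = 1.
Proof. by move=> L1; rewrite /dpsi; field; lra. Qed.

Lemma dpsi1 r : r < 1 -> dpsi 1 r = 1.
Proof. by move=> r1; rewrite /dpsi; field; lra. Qed.

Lemma dpsi_nincr L r s : 1 <= L -> r <= s -> s < 1 -> dpsi L s <= dpsi L r.
Proof.
move=> L1 rs s1; rewrite !dpsiE//; last exact: le_lt_trans rs s1.
rewrite lerD2l lerN2; apply: ler_wpM2l.
  by rewrite mulr_ge0 ?subr_ge0 ?exprn_ege1//; lra.
by rewrite lef_pV2 ?posrE; lra.
Qed.

Lemma dpsi_decr L r s : 1 < L -> r < s -> s < 1 -> dpsi L s < dpsi L r.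
Proof.
move=> L1 rs s1; rewrite !dpsiE//; [|exact: ltW|exact: lt_trans rs s1|exact: ltW].
rewrite ltrD2l ltrN2 ltr_pM2l; first by rewrite ltf_pV2 ?posrE; lra.
by rewrite mulr_gt0 ?subr_gt0 ?exprn_egt1//; lra.
Qed.

Lemma is_derive_psi L r : 1 <= L -> r < 1 -> is_derive r 1 (psi L) (dpsi L r).
Proof.
move=> L1 r1; have L0 : 0 < L by lra.
have y0 : 0 < 1 - r / L by rewrite subr_gt0 ltr_pdivrMr//; lra.
have h1 : is_derive r 1 (fun x : R => 1 - x / L) (- L^-1).
  have : is_derive r 1 (fun x : R => 1 + (- L^-1) * x) (0 + (- L^-1) * 1) by exact: is_deriveD.
  rewrite add0r mulr1; congr (is_derive _ _ _ _).
  by apply/funext => x; rewrite mulNr [_ * x]mulrC.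
have h2 : is_derive r 1 (fun x : R => ln (1 - x / L)) ((1 - r / L)^-1 * (- L^-1)).
  exact: (@is_derive1_comp _ (@ln R) (fun x => 1 - x / L) r _ _ (is_derive1_ln y0) h1).
have h3 : is_derive r 1 (fun x : R => L ^+ 2 * x + (L ^+ 3 - L) * ln (1 - x / L))
  (L ^+ 2 * 1 + (L ^+ 3 - L) * ((1 - r / L)^-1 * (- L^-1))).
  by apply: is_deriveD; apply: is_deriveZ.
rewrite (_ : dpsi L r = L ^+ 2 * 1 + (L ^+ 3 - L) * ((1 - r / L)^-1 * (- L^-1)))//.
rewrite /dpsi; field; lra.
Qed.

Lemma psi0 L : psi L 0 = 0.
Proof. by rewrite /psi mul0r subr0 ln1 !mulr0 addr0. Qed.

Lemma psi_ge L r : 1 <= L -> 0 < r < 1 ->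
  exists2 c, 0 < c < r & psi L r = dpsi L c * r.
Proof.
move=> L1 /andP[r0 r1].
have [|c cr] := @MVT_seg _ (psi L) (dpsi L) 0 r r0.
  by move=> t /andP[_ tr]; apply: is_derive_psi => //; exact: le_lt_trans tr r1.
by rewrite psi0 !subr0 => E; exists c.
Qed.

Lemma pi_lt4 : pi < 4 :> R.
Proof. by have := @pihalf_lt2 R; lra. Qed.

Lemma K1_ge1 (m : R) : 1 <= m -> 1 <= K1 m.
Proof.
move=> m1; rewrite /K1 le_min; apply/andP; split.
  by rewrite -[leLHS]sqrtr1 ler_wsqrtr//; have := exprn_ege1 2 m1; lra.
rewrite ler_pdivlMr ?pi_gt0// mul1r; have := pi_lt4; lra.
Qed.

(** Rests on (1 + r^2) - (1 - r^2)^3 = r^2 (4 - 3r^2 + r^4). *)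
Lemma phi_termE p M r : 0 <= r -> r < 1 ->
  phi p M r = \sum_(2 <= k < p.+1) phi_term (M (p - k + 1)%N) (2 * (k - 1)) r.
Proof.
move=> r0 r1; apply: eq_big_nat => k /andP[k2 _].
have x0 : 0 < 1 - r ^+ 2 by rewrite subr_gt0 expr_lt1.
rewrite /phi_term (_ : (2 * k - 1)%N = (2 * (k - 1)).+1); last first.
  by case: k k2 => [|k]// _; rewrite mulnS subn1 subSS subn0.
rewrite mulrA; congr (_ * (_ + _ * (_ + _))).
rewrite powRrM powR_mulrn ?(ltW x0)// powR12_sqrt ?exprn_ge0 ?(ltW x0)//.
rewrite -[X in X * _ / _](ger0_norm r0) -sqrtr_sqr -sqrtrM ?sqr_ge0// -sqrtrV ?exprn_ge0 ?(ltW x0)//.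
rewrite -sqrtrM; last first.
  apply: mulr_ge0; first exact: sqr_ge0.
  (* 4 - 3r^2 + r^4 = (r^2 - 2)^2 + r^2. *)
  have := sqr_ge0 (r ^+ 2 - 2); rewrite !expr2; nra.
congr Num.sqrt; field; lra.
Qed.

Lemma radius_rootE p M L r :
  radius_root p M L r <-> 0 < r < 1 /\ dpsi L r = phi p M r.
Proof.
split=> -[r01 h]; split => //; first by move/eqP: h; rewrite subr_eq0 => /eqP.
by rewrite -/(dpsi L r) h subrr.
Qed.

Lemma distortion_factor_mono r s : 0 <= r -> r <= s -> s < 1 ->
  r / Num.sqrt (1 - r ^+ 2) <= s / Num.sqrt (1 - s ^+ 2) /\
  Num.sqrt ((1 + r ^+ 2) / (1 - r ^+ 2) ^+ 3 - 1) <=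
  Num.sqrt ((1 + s ^+ 2) / (1 - s ^+ 2) ^+ 3 - 1).
Proof.
move=> r0 rs s1.
have x0 : 0 < 1 - s ^+ 2 by rewrite subr_gt0 expr_lt1//; lra.
have rs2 : r ^+ 2 <= s ^+ 2 by rewrite lerXn2r ?nnegrE//; lra.
have y0 : 0 < 1 - r ^+ 2 by lra.
split.
  apply: ler_pM => //.
  by rewrite lef_pV2 ?posrE ?sqrtr_gt0// ler_wsqrtr//; lra.
apply: ler_wsqrtr; rewrite lerD2r; apply: ler_pM.
- by rewrite addr_ge0 ?sqr_ge0.
- by rewrite invr_ge0 exprn_ge0// ltW.
- by rewrite lerD2l.
by rewrite lef_pV2 ?posrE ?exprn_gt0// lerXn2r ?nnegrE; lra.
Qed.

Lemma phi_bracket_mono (m : R) n r s : 0 <= r -> r <= s -> s < 1 ->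
  n.+1%:R * K1 m + Num.sqrt (2 * m ^+ 2 - 2) *
  (n%:R * (r / Num.sqrt (1 - r ^+ 2)) + Num.sqrt ((1 + r ^+ 2) / (1 - r ^+ 2) ^+ 3 - 1)) <=
  n.+1%:R * K1 m + Num.sqrt (2 * m ^+ 2 - 2) *
  (n%:R * (s / Num.sqrt (1 - s ^+ 2)) + Num.sqrt ((1 + s ^+ 2) / (1 - s ^+ 2) ^+ 3 - 1)).
Proof.
move=> r0 rs s1; have [h1 h2] := distortion_factor_mono r0 rs s1.
rewrite lerD2l ler_wpM2l ?sqrtr_ge0// lerD// ler_wpM2l//.
Qed.

Lemma phi_bracket_ge (m : R) n r : 1 <= m -> 0 <= r -> r < 1 ->
  n.+1%:R <= n.+1%:R * K1 m + Num.sqrt (2 * m ^+ 2 - 2) *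
  (n%:R * (r / Num.sqrt (1 - r ^+ 2)) + Num.sqrt ((1 + r ^+ 2) / (1 - r ^+ 2) ^+ 3 - 1)).
Proof.
move=> m1 r0 r1; rewrite -[leLHS]addr0; apply: lerD.
  by rewrite ler_peMr// K1_ge1.
rewrite mulr_ge0 ?sqrtr_ge0// addr_ge0 ?sqrtr_ge0// mulr_ge0// divr_ge0//.
Qed.

Lemma phi_term_ge (m : R) n r : 1 <= m -> 0 <= r -> r < 1 ->
  n.+1%:R * r ^+ n <= phi_term m n r.
Proof.
move=> m1 r0 r1; rewrite mulrC /phi_term; apply: ler_wpM2l; first exact: exprn_ge0.
exact: phi_bracket_ge.
Qed.

Lemma phi_term_mono (m : R) n r s : 1 <= m -> 0 <= r -> r <= s -> s < 1 ->
  phi_term m n r <= phi_term m n s.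
Proof.
move=> m1 r0 rs s1; rewrite /phi_term; apply: ler_pM.
- exact: exprn_ge0.
- apply: le_trans (phi_bracket_ge _ _ _ _) => //; exact: le_lt_trans rs s1.
- by rewrite lerXn2r ?nnegrE//; lra.
exact: phi_bracket_mono.
Qed.

Lemma phi_term_incr (m : R) n r s : 1 <= m -> 0 <= r -> r < s -> s < 1 ->
  phi_term m n.+1 r < phi_term m n.+1 s.
Proof.
move=> m1 r0 rs s1; rewrite /phi_term.
have h := phi_bracket_mono m n.+1 r0 (ltW rs) s1.
apply: (le_lt_trans (ler_wpM2l (exprn_ge0 _ r0) h)).
rewrite ltr_pM2r; first by rewrite ltrXn2r// ?nnegrE//; lra.
by apply: lt_le_trans (phi_bracket_ge _ _ _ _) => //; lra.
Qed.

Definition bounds_ge1 p M := forall k, (2 <= k <= p)%N -> 1 <= M (p - k + 1)%N.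

Lemma phi_ge0 p M r : bounds_ge1 p M -> 0 <= r -> r < 1 -> 0 <= phi p M r.
Proof.
move=> hM r0 r1; rewrite phi_termE//; rewrite big_nat; apply: sumr_ge0 => k /andP[k2 kp].
apply: le_trans (phi_term_ge _ _ _ _) => //; last by apply: hM; rewrite k2.
by rewrite mulr_ge0// exprn_ge0.
Qed.

Lemma phi_mono p M r s : bounds_ge1 p M -> 0 <= r -> r <= s -> s < 1 ->
  phi p M r <= phi p M s.
Proof.
move=> hM r0 rs s1; rewrite !phi_termE//; [|lra|lra].
apply: ler_sum_nat => k /andP[k2 kp]; apply: phi_term_mono => //.
by apply: hM; rewrite k2.
Qed.

Lemma phi_incr p M r s : bounds_ge1 p M -> (2 <= p)%N -> 0 <= r -> r < s -> s < 1 ->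
  phi p M r < phi p M s.
Proof.
move=> hM p2 r0 rs s1; rewrite !phi_termE//; [|lra|lra].
rewrite !(big_ltn (_ : 2 < p.+1)%N)//; apply: ltr_leD.
  by apply: phi_term_incr => //; apply: hM; rewrite p2.
apply: ler_sum_nat => k /andP[k2 kp]; apply: phi_term_mono => //; last exact: ltW.
by apply: hM; rewrite (ltnW k2).
Qed.

Lemma phi0 p M : phi p M 0 = 0.
Proof.
rewrite phi_termE// big_nat; apply: big1 => k /andP[k2 _].
by rewrite /phi_term expr0n; case: k k2 => [|[|k]]//; rewrite mul0r.
Qed.

Lemma phi_ge3 p M r : bounds_ge1 p M -> (2 <= p)%N -> 0 <= r -> r < 1 ->
  3 * r ^+ 2 <= phi p M r.
Proof.
move=> hM p2 r0 r1; rewrite phi_termE// (big_ltn (_ : 2 < p.+1)%N)// -[leLHS]addr0.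
apply: lerD; first by apply: phi_term_ge => //; apply: hM; rewrite p2.
rewrite big_nat; apply: sumr_ge0 => k /andP[k2 kp].
apply: le_trans (phi_term_ge _ _ _ _) => //; last by apply: hM; rewrite (ltnW k2).
by rewrite mulr_ge0// exprn_ge0.
Qed.

(** The margin [r ^+ n.+2] is available since [K1 m >= 1] gives K1 m + 1 <= (n + 2) K1 m; it makes
    [R1] strictly positive when p >= 2. *)
Lemma sigma_term_le (m : R) n r : 1 <= m -> 0 <= r -> r < 1 ->
  r ^+ n.+2 * (K1 m + Num.sqrt (2 * m ^+ 2 - 2) * (r / Num.sqrt (1 - r ^+ 2))) +
  r ^+ n.+2 <= r * phi_term m n.+1 r.
Proof.
move=> m1 r0 r1; rewrite /phi_term mulrA -exprS -[X in _ + X]mulr1 -mulrDr.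
apply: ler_wpM2l; first exact: exprn_ge0.
set t := r / _; set S := Num.sqrt _; set q := Num.sqrt (_ - 1).
have t0 : 0 <= t by rewrite divr_ge0// sqrtr_ge0.
have S0 : 0 <= S := sqrtr_ge0 _.
have q0 : 0 <= q := sqrtr_ge0 _.
have k1 := K1_ge1 m1.
have : K1 m + 1 <= n.+2%:R * K1 m.
  rewrite -natr1 mulrDl mul1r [leRHS]addrC lerD2l.
  by rewrite -[leLHS]mulr1 ler_pM// ler1n.
have : S * t <= S * (n.+1%:R * t + q).
  by apply: ler_wpM2l => //; rewrite -[leLHS]addr0 lerD// ler_peMl// ler1n.
lra.
Qed.

Lemma sigma_le p M r : bounds_ge1 p M -> 0 <= r -> r < 1 ->
  sigma p M r + \sum_(2 <= k < p.+1) r ^+ (2 * k - 1) <= r * phi p M r.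
Proof.
move=> hM r0 r1; rewrite phi_termE// mulr_sumr /sigma -big_split /=.
apply: ler_sum_nat => -[|[|k]]// kp.
rewrite (_ : (2 * k.+2 - 1)%N = (2 * k).+3); last by rewrite !mulnS subn1.
rewrite (_ : (2 * (k.+2 - 1))%N = (2 * k).+2); last by rewrite subn1 mulnS.
by apply: sigma_term_le => //; apply: hM; exact: kp.
Qed.

(** At the root, psi(r) = dpsi(c) r >= dpsi(r) r = r phi(r), which dominates [sigma]. Strictness
    comes from the margin in [sigma_le] if p >= 2. If p = 1 a root forces L > 1, and then [dpsi]
    decreases strictly. *)
Lemma R1_gt0 p M L r : bounds_ge1 p M -> 1 <= L -> (1 <= p)%N ->
  radius_root p M L r -> 0 < R1 p M L r.
Proof.
move=> hM L1 p1 /radius_rootE[/andP[r0 r1] E].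
rewrite /R1 -/(psi L r) -/(sigma p M r) subr_gt0.
have [|c /andP[c0 cr] ->] := @psi_ge L r L1; first by rewrite r0.
have := sigma_le hM (ltW r0) r1.
have [p2|p2] := ltnP 1 p.
  have : 0 < \sum_(2 <= k < p.+1) r ^+ (2 * k - 1).
    rewrite (big_ltn (_ : 2 < p.+1)%N)// ltr_pwDl ?exprn_gt0//.
    by apply: sumr_ge0 => k _; rewrite exprn_ge0// ltW.
  have := dpsi_nincr L1 (ltW cr) r1; rewrite E -(ler_pM2r r0) [_ * r]mulrC.
  by move=> h1 h2 h3; lra.
have {p1 p2} pE : p = 1%N by apply/eqP; rewrite eqn_leq p2.
move: E; rewrite pE /sigma /phi !big_geq// => E _.
apply: mulr_gt0 => //; rewrite -E; apply: dpsi_decr => //.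
rewrite lt_neqAle L1 andbT; apply/eqP => L1'.
by move: E; rewrite -L1' dpsi1// => /eqP; rewrite oner_eq0.
Qed.

Lemma ct_sum (I : Type) (l : seq I) (F : I -> R -> R) x :
  (forall i, ctat x (F i)) -> ctat x (fun t => \sum_(i <- l) F i t).
Proof.
move=> hF; elim: l => [|i l IH].
  rewrite (_ : (fun t => _) = fun=> 0); first exact: ct_cst.
  by apply/funext => t; rewrite big_nil.
rewrite (_ : (fun t => _) = fun t => F i t + \sum_(j <- l) F j t); first exact: ctD.
by apply/funext => t; rewrite big_cons.
Qed.

Lemma ct_phi_term (m : R) n x : 0 <= x -> x < 1 -> ctat x (phi_term m n).
Proof.
move=> x0 x1; have h : 0 < 1 - x ^+ 2 by rewrite subr_gt0 expr_lt1.
rewrite /phi_term; ct; first by rewrite gt_eqF// sqrtr_gt0.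
by rewrite gt_eqF// exprn_gt0.
Qed.

Lemma IVT_ctat (f : R -> R) (a b : R) : a <= b ->
  (forall x, a <= x <= b -> ctat x f) -> f b <= 0 -> 0 <= f a ->
  exists2 c, a <= c <= b & f c = 0.
Proof.
move=> ab cf fb fa; have [||c] := @IVT R f a b 0 ab.
- apply: continuous_in_subspaceT => x; rewrite inE /= in_itv /= => xab; exact: cf.
- by rewrite ge_min le_max fb fa orbT.
by rewrite in_itv /= => cab E; exists c.
Qed.

Lemma radius_fun_decr p M L r s : bounds_ge1 p M -> 1 <= L ->
  (1 <= p)%N -> ~ (p = 1%N /\ L = 1) -> 0 <= r -> r < s -> s < 1 ->
  dpsi L s - phi p M s < dpsi L r - phi p M r.
Proof.
move=> hM L1 p1 np r0 rs s1; have h1 := dpsi_nincr L1 (ltW rs) s1.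
have h2 := phi_mono hM r0 (ltW rs) s1.
have [p2|p2] := ltnP 1 p; first by have := phi_incr hM p2 r0 rs s1; lra.
have pE : p = 1%N by apply/eqP; rewrite eqn_leq p2.
suff L2 : 1 < L by have := dpsi_decr L2 rs s1; lra.
by rewrite lt_neqAle L1 andbT; apply/eqP => L1'; apply: np.
Qed.

Lemma radius_root_unique p M L : bounds_ge1 p M -> 1 <= L -> (1 <= p)%N ->
  ~ (p = 1%N /\ L = 1) -> exists! r, radius_root p M L r.
Proof.
move=> hM L1 p1 np.
have gdecr := @radius_fun_decr p M L _ _ hM L1 p1 np.
have [b /andP[b0 b1] gb] : exists2 b, 0 <= b < 1 & dpsi L b - phi p M b <= 0.
  have [L2|L2] := ltP 1 L.
    (* At 1/L the first term vanishes and [phi] is nonnegative. *)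
    have b01 : 0 <= L^-1 < 1 by rewrite invr_ge0 (le_trans ler01)//= invf_lt1//; lra.
    exists L^-1 => //; have := phi_ge0 hM (proj1 (andP b01)) (proj2 (andP b01)).
    by rewrite {1}/dpsi mulfV ?subrr ?mulr0 ?mul0r; lra.
  have E : L = 1 by apply/eqP; rewrite eq_le L1 L2.
  have p2 : (2 <= p)%N.
    by rewrite ltn_neqAle p1 andbT; apply/eqP => pE; apply: np.
  (* Here [dpsi] is constantly 1, and 3 (3/4)^2 = 27/16 already exceeds it. *)
  exists (3 / 4); first by apply/andP; split; lra.
  by rewrite E dpsi1; [have := @phi_ge3 p M (3 / 4) hM p2; rewrite !expr2; lra|lra].
pose g x := dpsi L x - \sum_(2 <= k < p.+1) phi_term (M (p - k + 1)%N) (2 * (k - 1)) x.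
have gE x : 0 <= x -> x < 1 -> g x = dpsi L x - phi p M x.
  by move=> x0 x1; rewrite /g phi_termE.
have [|||r /andP[r0 rb] E] := @IVT_ctat g 0 b b0 _ _ _.
- move=> x /andP[x0 xb]; have x1 : x < 1 by lra.
  apply: (@ctD _ _ (dpsi L) (fun x => - _)).
    by rewrite /dpsi; ct; lra.
  apply: ctN; apply: ct_sum => k; exact: ct_phi_term.
- by rewrite gE.
- by rewrite gE// phi0 dpsi0// subr0.
have r1 : r < 1 by lra.
rewrite gE// in E.
have root0 : radius_root p M L r.
  split => //; rewrite r1 andbT lt_neqAle r0 andbT; apply/eqP => r0'.
  by move: E; rewrite -r0' phi0 dpsi0// subr0 => /eqP; rewrite oner_eq0.
exists r; split => // s [/andP[s0 s1] Es].
have [rs|sr|] := ltgtP r s => //.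
  by have := gdecr _ _ r0 rs s1; rewrite E -Es /dpsi ltxx.
by have := gdecr _ _ (ltW s0) sr r1; rewrite E -Es /dpsi ltxx.
Qed.

End RadiusEquation.

(** * Univalence and covering *)

Section PolyharmonicEstimates.
Variable R : realType.
Local Notation C := R[i].
Implicit Types (f F : C -> C) (z w v c u : C) (p k n : nat).

(** Multiplied by [r] to avoid the exponent n - 1; in [weighted_lip] this factor is the one in the
    growth bound of [f]. *)
Lemma exprn_dist_le (a b r : R) n : 0 <= a -> a <= r -> 0 <= b -> b <= r ->
  `|a ^+ n - b ^+ n| * r <= n%:R * r ^+ n * `|a - b|.
Proof.
move=> a0 ar b0 br; have r0 := le_trans a0 ar.
rewrite subrXX normrM -[leLHS]mulrA [leLHS]mulrC; apply: ler_wpM2r; first exact: normr_ge0.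
case: n => [|n]; first by rewrite big_ord0 normr0 !mul0r.
rewrite [r ^+ n.+1]exprSr [leRHS]mulrA; apply: ler_wpM2r => //.
apply: (le_trans (ler_norm_sum _ _ _)).
rewrite (_ : n.+1%:R * r ^+ n = \sum_(i < n.+1) r ^+ n); last first.
  by rewrite sumr_const card_ord mulr_natl.
apply: ler_sum => i _; rewrite ger0_norm; last by rewrite mulr_ge0 ?exprn_ge0.
have -> : r ^+ n = r ^+ (n.+1.-1 - i) * r ^+ i by rewrite -exprD subnK// -ltnS.
by apply: ler_pM; rewrite ?exprn_ge0// lerXn2r ?nnegrE.
Qed.

Definition normalized_bounded f (m : R) := [/\ Defs.harmonic f,
  forall z, nc z < 1 -> {for z, continuous f}, forall z, nc z < 1 -> nc (f z) <= m,
  lambda f 0 = 1 & f 0 = 0].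

Lemma normalized_bounded_le f (m r : R) z : normalized_bounded f m ->
  0 <= r -> r < 1 -> nc z <= r ->
  nc (f z) <= r * (K1 m + Num.sqrt (2 * m ^+ 2 - 2) * (r / Num.sqrt (1 - r ^+ 2))).
Proof.
move=> [hf cf fm l1 f0] r0 r1 zr.
apply: (le_trans (bounded_harmonic_le hf cf fm l1 f0 r0 r1 zr)).
have x0 : 0 < 1 - r ^+ 2 by rewrite subr_gt0 expr_lt1.
rewrite sqrtrM ?exprn_ge0// sqrtrV ?(ltW x0)// (_ : r ^+ 4 = (r ^+ 2) ^+ 2); last by rewrite -exprM.
by rewrite sqrtr_sqr (ger0_norm (sqr_ge0 r)) expr2 le_eqVlt; apply/orP; left; apply/eqP; ring.
Qed.

(** Splitting into weight times increment and increment of the weight times value yields r^n (K + S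
    q) and n r^n (K + S t), whose sum is exactly [phi_term]. *)
Lemma weighted_lip f (m r : R) n z w : normalized_bounded f m ->
  0 <= r -> r < 1 -> nc z <= r -> nc w <= r ->
  nc ((nc z ^+ n)%:C * f z - (nc w ^+ n)%:C * f w) <= phi_term m n r * nc (z - w).
Proof.
move=> hf r0 r1 zr wr; have hw := normalized_bounded_le hf r0 r1 wr.
case: hf => h1 h2 h3 h4 _.
have hl := bounded_harmonic_lip h1 h2 h3 h4 r0 r1 zr wr.
have -> : (nc z ^+ n)%:C * f z - (nc w ^+ n)%:C * f w =
  (nc z ^+ n)%:C * (f z - f w) + (nc z ^+ n - nc w ^+ n)%:C * f w by rewrite rcB; ring.
apply: (le_trans (ncD _ _)); rewrite !ncM !ncR /phi_term.
move: hl hw; set K := K1 m; set S := Num.sqrt (2 * _ - 2); set q := Num.sqrt (_ / _ - 1).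
set t := r / _ => hl hw.
have e1 : `|nc z ^+ n| * nc (f z - f w) <= r ^+ n * ((K + S * q) * nc (z - w)).
  apply: ler_pM; rewrite ?normr_ge0 ?nc_ge0//.
  by rewrite ger0_norm ?exprn_ge0 ?nc_ge0// lerXn2r ?nnegrE ?nc_ge0.
have ks : 0 <= K + S * t.
  have [r00|r00] := eqVneq r 0.
    rewrite /t r00 mul0r mulr0 addr0 /K /K1 le_min sqrtr_ge0 /=.
    rewrite divr_ge0 ?pi_ge0// mulr_ge0//.
    by apply: le_trans (nc_ge0 _) (h3 0 _); rewrite nc0.
  have rp : 0 < r by rewrite lt_neqAle eq_sym r00.
  by rewrite -(pmulr_rge0 _ rp); apply: le_trans hw; exact: nc_ge0.
have e2 : `|nc z ^+ n - nc w ^+ n| * nc (f w) <= n%:R * r ^+ n * nc (z - w) * (K + S * t).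
  apply: (le_trans (ler_wpM2l (normr_ge0 _) hw)); rewrite mulrA; apply: ler_wpM2r => //.
  apply: (le_trans (exprn_dist_le n (nc_ge0 z) zr (nc_ge0 w) wr)).
  by rewrite ler_wpM2l ?nc_dist// mulr_ge0 ?exprn_ge0.
apply: (le_trans (lerD e1 e2)); rewrite -natr1 le_eqVlt; apply/orP; left; apply/eqP; ring.
Qed.

Lemma weighted_le f (m r : R) n z : normalized_bounded f m ->
  0 <= r -> r < 1 -> nc z <= r ->
  nc ((nc z ^+ n)%:C * f z) <=
  r ^+ n.+1 * (K1 m + Num.sqrt (2 * m ^+ 2 - 2) * (r / Num.sqrt (1 - r ^+ 2))).
Proof.
move=> hf r0 r1 zr; rewrite ncM ncR exprSr -mulrA; apply: ler_pM.
- exact: normr_ge0.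
- exact: nc_ge0.
- by rewrite ger0_norm ?exprn_ge0 ?nc_ge0// lerXn2r ?nnegrE ?nc_ge0.
exact: normalized_bounded_le.
Qed.

Definition normalized_elliptic f (L : R) := [/\ Defs.harmonic f,
  forall z, nc z < 1 -> {for z, continuous f}, forall z, nc z < 1 -> Lambda f z <= L,
  lambda f 0 = 1 & f 0 = 0].

Lemma nc_segment z1 u (l t r : R) : nc z1 <= r -> nc (z1 + l%:C * u) <= r ->
  0 <= t -> t <= l -> nc (z1 + t%:C * u) <= r.
Proof.
move=> h1 h2 t0; rewrite le_eqVlt => /orP[/eqP ->//|tl].
have l0 : 0 < l by lra.
have -> : z1 + t%:C * u = (1 - t / l)%:C * z1 + (t / l)%:C * (z1 + l%:C * u).
  rewrite rcB mulrDr mulrA -rcM divfK ?gt_eqF//; ring.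
apply: (le_trans (ncD _ _)); rewrite !ncM !ncR.
have a0 : 0 <= t / l by rewrite divr_ge0// ltW.
have a1 : t / l <= 1 by rewrite ler_pdivrMr// mul1r ltW.
rewrite (ger0_norm a0) ger0_norm ?subr_ge0//.
have := ler_wpM2l a0 h2; have : (1 - t / l) * nc z1 <= (1 - t / l) * r.
  by rewrite ler_wpM2l// subr_ge0.
by lra.
Qed.

(* The rotation [c] depends on the direction [u] only, not on the base point. *)
Lemma elliptic_direction f (L : R) u : normalized_elliptic f L -> nc u = 1 ->
  exists c : C, [/\ nc c = 1,
    (forall r l z, 0 <= r -> r < 1 -> 0 <= l -> nc z <= r -> nc (z + l%:C * u) <= r ->
      dpsi L r * l <= complex.Re (c * (f (z + l%:C * u) - f z))) &
    forall r, 0 <= r -> r < 1 -> psi L r <= complex.Re (c * f (r%:C * u))].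
Proof.
move=> [hf cf fL l1 f0] u1.
have L1 : 1 <= L by rewrite -l1; apply: le_trans (lambda_le_Lambda _ _) (fL _ _); rewrite nc0.
have [c c1 hc] := harmonic_deriv_lower hf cf fL l1 u1.
pose g z t := complex.Re (c * f (z + t%:C * u)).
pose dg z t := complex.Re (c * (u * dz f (z + t%:C * u) + u^* * dzbar f (z + t%:C * u))).
have hg z t : nc (z + t%:C * u) < 1 -> is_derive t 1 (g z) (dg z t).
  move=> z1; have /(rdiffZ c)/rdiff_line := harmonic_rdiff hf cf z1.
  suff -> : dg z t = complex.Re (c * dz f (z + t%:C * u) * u + c * dzbar f (z + t%:C * u) * u^*) by [].
  by rewrite /dg; congr complex.Re; ring.
exists c; split => //.
- move=> r l z r0 r1; rewrite le_eqVlt => /orP[/eqP <- _ _|l0 zr zlr].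
    by rewrite mul0r addr0 subrr mulr0 mulr0.
  have seg t : 0 <= t <= l -> nc (z + t%:C * u) <= r.
    by move=> /andP[t0 tl]; apply: nc_segment zr zlr t0 tl.
  have [|t /andP[t0 tl]] := @MVT_seg _ (g z) (dg z) 0 l l0.
    by move=> t /seg h; apply: hg; exact: le_lt_trans h r1.
  rewrite subr0 /g mul0r addr0 -reB -mulrBr => ->; rewrite ler_wpM2r ?(ltW l0)//.
  have tr : nc (z + t%:C * u) <= r by apply: seg; rewrite !ltW.
  have t1 := le_lt_trans tr r1.
  apply: le_trans (hc _ t1); exact: dpsi_nincr.
move=> r; rewrite le_eqVlt => /orP[/eqP <- _|r0 r1].
  by rewrite mul0r f0 mulr0 psi0.
have tE t : 0 <= t -> nc (0 + t%:C * u) = t.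
  by move=> t0; rewrite add0r ncM ncR u1 mulr1 ger0_norm.
(* Applying the mean value theorem to the difference with [psi] integrates the pointwise lower bound
   along the radius without an integral. *)
have [|t /andP[t0 tr]] := @MVT_seg _ (fun t => g 0 t - psi L t) (fun t => dg 0 t - dpsi L t) 0 r r0.
  move=> t /andP[t0 tr]; have t1 := le_lt_trans tr r1.
  apply: is_deriveB; last exact: is_derive_psi.
  by apply: hg; rewrite tE.
move=> E; have g00 : g 0 0 = 0 by rewrite /g add0r mul0r f0 mulr0.
have {}E : g 0 r - psi L r = (dg 0 t - dpsi L t) * r.
  by move: E; rewrite /= g00 psi0 !subr0.
have -> : complex.Re (c * f (r%:C * u)) = g 0 r by rewrite /g add0r.
rewrite -subr_ge0 E.
apply: mulr_ge0; last exact: ltW.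
have t1 := lt_trans tr r1.
rewrite subr_ge0; have := hc (0 + t%:C * u); rewrite tE ?(ltW t0)//.
by apply.
Qed.

End PolyharmonicEstimates.

(** * Lower bounds for the polyharmonic mapping *)

Section PolyharmonicMapping.
Variable R : realType.
Local Notation C := R[i].
Implicit Types (f F : C -> C) (z w v c u : C) (p k n : nat).

(** What the univalence and covering arguments use of [landau_class]; ellipticity has been absorbed
    in [L]. *)
Definition landau_form p (M : nat -> R) (L : R) (G : nat -> C -> C) F :=
  [/\ normalized_elliptic (G p) L,
   forall k, (2 <= k <= p)%N -> normalized_bounded (G (p - k + 1)%N) (M (p - k + 1)%N) &
   forall z, nc z < 1 -> F z = G p z +
     \sum_(2 <= k < p.+1) (nc z ^+ (2 * (k - 1)))%:C * G (p - k + 1)%N z].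

Lemma landau_class_form (K K' : R) p M Lp G F : 1 <= K -> 0 <= K' -> (1 <= p)%N ->
  landau_class K K' p M Lp G F -> landau_form p M (Lambda' K K' Lp) G F.
Proof.
move=> K1 K0 p1 [[hG FE] _ hG0 hM hL].
have D z : nc z < 1 -> unit_disk z by rewrite /unit_disk /disk /= subr0.
have p1E : (p - 1 + 1)%N = p by rewrite subnK.
split.
- have := hG 1%N; have := hG0 1%N; rewrite p1 p1E => /(_ isT)[l1 g0] /(_ isT) he.
  split => //; [by case: he|by move=> z /D; case: he => _ [h _ _ _ _]; exact: h|].
  exact: elliptic_Lambda_le he hL.
- move=> k /andP[k2 kp]; have k1p : (1 <= k <= p)%N by rewrite (ltnW k2).
  have [l1 g0] := hG0 k k1p; have [hh [cf _ _ _ _]] := hG k k1p.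
  split => //; first by move=> z /D; exact: cf.
  by move=> z /D; apply: hM; rewrite k2.
move=> z /D/FE ->; rewrite (big_ltn (_ : 1 < p.+1)%N)//.
by rewrite p1E subnn muln0 expr0 mul1r.
Qed.

Section Form.
Variables (p : nat) (M : nat -> R) (L : R) (G : nat -> C -> C) (F : C -> C).
Hypothesis hF : landau_form p M L G F.

Lemma landau_form_ge1 : 1 <= L.
Proof.
case: hF => -[_ _ fL l1 _] _ _.
by rewrite -l1; apply: le_trans (lambda_le_Lambda _ _) (fL _ _); rewrite nc0.
Qed.

Lemma landau_form_bounds : bounds_ge1 p M.
Proof.
move=> k kp; case: hF => _ /(_ k kp)[h1 h2 h3 h4 _] _.
exact: bounded_harmonic_ge1 h1 h2 h3 h4.
Qed.

Lemma landau_form_direction u : nc u = 1 -> exists c : C, [/\ nc c = 1,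
  (forall r l z, 0 <= r -> r < 1 -> 0 <= l -> nc z <= r -> nc (z + l%:C * u) <= r ->
    (dpsi L r - phi p M r) * l <= complex.Re (c * (F (z + l%:C * u) - F z))) &
  forall r, 0 <= r -> r < 1 -> R1 p M L r <= complex.Re (c * F (r%:C * u))].
Proof.
move=> u1; have [hp hk FE] := hF.
have [c [c1 h1 h2]] := elliptic_direction hp u1; exists c; split => //.
- move=> r l z r0 r1 l0 zr zlr; rewrite !FE; [|exact: le_lt_trans zr r1|exact: le_lt_trans zlr r1].
  rewrite opprD addrACA mulrDr reD mulrBl; apply: lerD; first exact: h1.
  set S := _ - _; apply: le_trans (_ : - nc S <= _); last first.
    by rewrite lerNl -reN -mulrN; apply: le_trans (Re_le_ncW _) _; rewrite ncM ncN c1 mul1r.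
  rewrite lerN2 /S phi_termE// -sumrB mulr_suml; apply: (le_trans (nc_sum _ _ _)).
  apply: ler_sum_nat => k kp.
  have := weighted_lip (2 * (k - 1)) (hk k kp) r0 r1 zlr zr.
  by rewrite [z + _]addrC addrK ncM u1 mulr1 ncR (ger0_norm l0).
move=> r r0 r1; have ru : nc (r%:C * u) = r by rewrite ncM u1 mulr1 ncR ger0_norm.
rewrite FE ?ru// mulrDr reD /R1 -/(psi L r) -/(sigma p M r); apply: lerD; first exact: h2.
set S := \sum_(_ <= _ < _) _; apply: le_trans (_ : - nc S <= _); last first.
  by rewrite lerNl -reN -mulrN; apply: le_trans (Re_le_ncW _) _; rewrite ncM ncN c1 mul1r.
rewrite lerN2 /S /sigma; apply: (le_trans (nc_sum _ _ _)).
apply: ler_sum_nat => -[|[|k]]// kp.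
have := @weighted_le _ _ _ r (2 * (k.+2 - 1)) (r%:C * u) (hk k.+2 kp) r0 r1.
rewrite ru => /(_ (lexx _)).
by rewrite (_ : (2 * (k.+2 - 1)).+1 = (2 * k.+2 - 1)%N)// subn1 !mulnS.
Qed.

Lemma landau_form_dist (r : R) z w : r < 1 -> nc z <= r -> nc w <= r ->
  (dpsi L r - phi p M r) * nc (w - z) <= nc (F w - F z).
Proof.
move=> r1 zr wr; have r0 := le_trans (nc_ge0 z) zr.
have [u u1 E] := unit_direction (w - z).
have [c [c1 h _]] := landau_form_direction u1.
have := h r (nc (w - z)) z r0 r1 (nc_ge0 _) zr; rewrite -E addrC subrK => /(_ wr) h1.
by apply: le_trans h1 (le_trans (Re_le_ncW _) _); rewrite ncM c1 mul1r.
Qed.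

Lemma landau_form_lower z : nc z < 1 -> R1 p M L (nc z) <= nc (F z).
Proof.
move=> z1; have [u u1 E] := unit_direction z.
have [c [c1 _ h]] := landau_form_direction u1.
have := h _ (nc_ge0 z) z1; rewrite -E => h1.
by apply: le_trans h1 (le_trans (Re_le_ncW _) _); rewrite ncM c1 mul1r.
Qed.

Lemma landau_form_rdiff z : nc z < 1 -> exists a b, rdiff F z a b.
Proof.
move=> z1; have [[hp cp _ _ _] hk FE] := hF.
have d0 : 0 < 1 - nc z by rewrite subr_gt0.
have hsq m : exists ab : C * C, rdiff (fun w => (nc w ^+ (2 * m))%:C) z ab.1 ab.2.
  (* Only even powers of the modulus occur, and these are polynomials in w and conj w. *)
  rewrite (_ : (fun w => _) = fun w => (w * w^*) ^+ m); last first.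
    by apply/funext => w; rewrite mulcJ -rcX exprM.
  elim: m => [|m [ab IH]]; first by exists (0, 0); exact: (rdiff_cst 1 z).
  rewrite (_ : (fun w => _) = fun w => w * w^* * (w * w^*) ^+ m); last first.
    by apply/funext => w; rewrite exprS.
  have := rdiffM (rdiffM (rdiff_id z) (rdiff_conj (rdiff_id z))) IH.
  by set a := (X in rdiff _ _ X _); set b := (X in rdiff _ _ _ X) => h; exists (a, b).
have ht k : exists ab : C * C, (2 <= k < p.+1)%N ->
    rdiff (fun w => (nc w ^+ (2 * (k - 1)))%:C * G (p - k + 1)%N w) z ab.1 ab.2.
  have [kp|kp] := boolP (2 <= k < p.+1)%N; last by exists (0, 0).
  have [h1 h2 _ _ _] := hk k kp; have [ab hab] := hsq (k - 1)%N.
  have := rdiffM hab (harmonic_rdiff h1 h2 z1).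
  by set a := (X in rdiff _ _ X _); set b := (X in rdiff _ _ _ X) => h; exists (a, b).
have [ab hab] := choice ht.
have hs := rdiff_sum (index_iota 2 p.+1) hab.
have := rdiffD (harmonic_rdiff hp cp z1) hs.
set a := (X in rdiff _ _ X _); set b := (X in rdiff _ _ _ X) => h; exists a, b.
apply: rdiff_ext d0 _ h => v vd /=.
rewrite FE; first by rewrite [in RHS]big_nat.
by have := ncD z v; lra.
Qed.

Lemma landau_root_nontrivial (r : R) : radius_root p M L r -> ~ (p = 1%N /\ L = 1).
Proof.
move=> /radius_rootE[/andP[r0 r1] E] [pE LE]; move: E.
by rewrite pE LE dpsi1// /phi big_geq// => /eqP; rewrite oner_eq0.
Qed.

Lemma landau_root_gt0 (r s : R) : (1 <= p)%N -> radius_root p M L r ->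
  0 <= s -> s < r -> 0 < dpsi L s - phi p M s.
Proof.
move=> p1 root s0 sr; have np := landau_root_nontrivial root.
have [/andP[r0 r1] E] := (radius_rootE p M L r).1 root.
have := radius_fun_decr landau_form_bounds landau_form_ge1 p1 np s0 sr r1.
by rewrite E subrr.
Qed.

(* At radius r itself the lower bound vanishes; since [c] depends only on the
   direction, a midpoint inside the disk makes it strict. *)
Lemma landau_form_inj (r : R) z w : (1 <= p)%N -> radius_root p M L r ->
  nc z < r -> nc w <= r -> F z = F w -> z = w.
Proof.
move=> p1 root zr wr E; have [/andP[r0 r1] Er] := (radius_rootE p M L r).1 root.
apply/eqP; rewrite eq_sym -subr_eq0 -nc_eq0; apply: contraT => l0.
set l := nc (w - z) in l0; have {}l0 : 0 < l by rewrite lt_neqAle eq_sym l0 nc_ge0.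
have [u u1 Eu] := unit_direction (w - z); rewrite -/l in Eu.
pose m := z + (l / 2)%:C * u.
have Ew : w = m + (l / 2)%:C * u.
  by rewrite /m -addrA -mulrDl -rcD -splitr -Eu addrC subrK.
have mr : nc m < r.
  have -> : m = (2^-1)%:C * z + (2^-1)%:C * w.
    have h : (2^-1)%:C + (2^-1)%:C = 1 :> C by rewrite -rcD; congr (_%:C); lra.
    have Ew' : w = z + l%:C * u by rewrite -Eu addrC subrK.
    by rewrite Ew' /m rcM -{1}[z]mul1r -h; ring.
  apply: (le_lt_trans (ncD _ _)); rewrite !ncM !ncR ger0_norm//; lra.
have [c [c1 h _]] := landau_form_direction u1.
pose s := Num.max (nc z) (nc m); have sr : s < r by rewrite gt_max zr mr.
have s0 : 0 <= s by rewrite le_max nc_ge0.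
have l20 : 0 < l / 2 by lra.
have h1 := h s (l / 2) z s0 (lt_trans sr r1) (ltW l20).
have {}h1 : (dpsi L s - phi p M s) * (l / 2) <= complex.Re (c * (F m - F z)).
  by apply: h1; rewrite le_max lexx ?orbT.
have h2 : 0 <= complex.Re (c * (F w - F m)).
  rewrite Ew; have := h r (l / 2) m (ltW r0) r1 (ltW l20) (ltW mr).
  by rewrite -Ew Er subrr mul0r; apply.
have := mulr_gt0 (landau_root_gt0 p1 root s0 sr) l20.
move: h1 h2; rewrite E !mulrBr !reB; lra.
Qed.

End Form.
End PolyharmonicMapping.

(** * Openness from a lower Lipschitz bound *)

Section LocalSurjectivity.
Variable R : realType.
Local Notation C := R[i].
Implicit Types (f F : C -> C) (z w v c u a b : C).

(** The determinant is |a|^2 - |b|^2; if it is nonzero the inverse is explicit. Otherwise conj a - b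
    lies in the kernel, so b = conj a; then i conj a does too, so a = b = 0, and finally 1 does,
    which is absurd. *)
Lemma real_linear_onto a b : (forall v, a * v + b * v^* = 0 -> v = 0) ->
  forall y, exists v, a * v + b * v^* = y.
Proof.
move=> inj y; have [E|D] := eqVneq (a * a^*) (b * b^*); last first.
  have D0 : a * a^* - b * b^* != 0 by rewrite subr_eq0.
  exists ((a^* * y - b * y^*) / (a * a^* - b * b^*)).
  rewrite conjM conjB !conjM !conjcK.
  have -> : ((a * a^* - b * b^*)^-1)^* = (a * a^* - b * b^*)^-1.
    by rewrite conjc_inv !mulcJ -rcB conjR.
  by field.
have h1 : a^* - b = 0.
  by apply: inj; rewrite conjB conjcK !mulrBr E; ring.
have h2 : 'i%C * a^* = 0.
  apply: inj; have -> : b = a^* by apply/eqP; rewrite eq_sym -subr_eq0 h1.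
  have -> : ('i%C * a^*)^* = - 'i%C * a.
    by rewrite conjM conjcK; congr (_ * _); apply/eqP; rewrite eq_complex /= oppr0 !eqxx.
  by ring.
have a0 : a^* = 0.
  have i0 : 'i%C != 0 :> C by rewrite eq_complex /= oner_eq0 andbF.
  by apply/eqP; move/eqP: h2; rewrite mulf_eq0 (negPf i0).
have b0 : b = 0 by move/eqP: h1; rewrite subr_eq0 a0 => /eqP.
have : (1 : C) = 0 by apply: inj; rewrite b0 (_ : a = 0) ?mul0r ?addr0// -[a]conjcK a0 conjc0.
by move/eqP; rewrite oner_eq0.
Qed.

Lemma small_quadratic (x y d : R) : 0 < x -> 0 <= y -> 0 < d ->
  exists2 s, 0 < s < d & y * s < x.
Proof.
move=> x0 y0 d0; exists (Num.min (d / 2) (x / (2 * (y + 1)))).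
  rewrite lt_min divr_gt0//= divr_gt0 ?mulr_gt0 ?ltr_wpDl//=.
  by rewrite gt_min; apply/orP; left; lra.
have y1 : 0 < y + 1 by lra.
apply: (@le_lt_trans _ _ (y * (x / (2 * (y + 1))))).
  by rewrite ler_wpM2l// ge_min lexx orbT.
rewrite mulrA ltr_pdivrMr ?mulr_gt0//; nra.
Qed.

(** Along a kernel vector the increment of [F] is quadratic in the step, against the linear lower
    bound. *)
Lemma rdiff_linear_inj F z (k d : R) a b : rdiff F z a b -> 0 < k -> 0 < d ->
  (forall v, nc v < d -> k * nc v <= nc (F (z + v) - F z)) ->
  forall v, a * v + b * v^* = 0 -> v = 0.
Proof.
move=> [K [d' [K0 d'0 h]]] k0 d0 hk v E; apply/eqP; rewrite -nc_eq0.
apply: contraT => v0; have {}v0 : 0 < nc v by rewrite lt_neqAle eq_sym v0 nc_ge0.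
have m0 : 0 < Num.min d d' / nc v by rewrite divr_gt0// lt_min d0.
have [s /andP[s0 sm] hs] := small_quadratic k0 (mulr_ge0 K0 (nc_ge0 v)) m0.
have sv : nc (s%:C * v) = s * nc v by rewrite ncM ncR gtr0_norm.
move: sm; rewrite ltr_pdivlMr// lt_min -sv => /andP[sd sd'].
have := h _ sd'; have := hk _ sd.
have -> : a * (s%:C * v) + b * (s%:C * v)^* = s%:C * (a * v + b * v^*) by rewrite conjcMr; ring.
rewrite E mulr0 subr0 sv => k1 k2; have := le_trans k1 k2.
rewrite leNgt => /negP[]; rewrite expr2 mulrA ltr_pM2r ?mulr_gt0//.
by rewrite mulrCA mulrC.
Qed.

(* An interior minimum of |F - w| over the closed disk must be a zero, since the
   differential is onto. *)
Lemma rdiff_onto F z0 (d k : R) : 0 < d -> 0 < k ->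
  (forall z, nc (z - z0) <= d -> exists a b, rdiff F z a b) ->
  (forall z w, nc (z - z0) <= d -> nc (w - z0) <= d -> k * nc (w - z) <= nc (F w - F z)) ->
  forall w, nc (w - F z0) < k * d / 2 -> exists2 z, nc (z - z0) < d & F z = w.
Proof.
move=> d0 k0 hF hk w hw.
have [|v1 v1d hmin] := @disk_max R d (fun v => - nc (F (z0 + v) - w)) (ltW d0).
  move=> v vd; have [|a [b h]] := hF (z0 + v); first by rewrite addrC addKr.
  have /continuous_epsP cF := rdiff_continuous h.
  apply/continuousR_epsP => e /cF[e' e'0 he]; exists e' => // v' vv.
  rewrite -opprD normrN.
  apply: le_lt_trans (he (z0 + v') _); last by rewrite opprD addrACA subrr add0r.
  by apply: le_trans (nc_dist _ _) _; rewrite opprB addrA subrK.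
(* On the circle |F - w| >= k d - |F z0 - w| > k d / 2, more than at the centre: the minimum is
   interior. *)
pose z1 := z0 + v1; have z1d : nc (z1 - z0) < d.
  rewrite /z1 addrC addKr lt_neqAle v1d andbT; apply/eqP => v1E.
  have := hmin 0; rewrite nc0 (ltW d0) addr0 => /(_ isT); rewrite lerN2 -/z1.
  have h1 : nc (z1 - z0) = d by rewrite /z1 addrC addKr.
  have := hk z0 z1; rewrite subrr nc0 (ltW d0) h1 lexx => /(_ isT isT).
  have := ncD (F z1 - w) (w - F z0); rewrite addrA subrK [nc (F z0 - w)]ncB; lra.
exists z1 => //; apply/eqP; rewrite eq_sym -subr_eq0 -nc_eq0; apply: contraT => y0.
have {}y0 : 0 < nc (w - F z1) by rewrite lt_neqAle eq_sym y0 nc_ge0.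
have [a [b hab]] := hF z1 (ltW z1d).
have e0 : 0 < d - nc (z1 - z0) by rewrite subr_gt0.
have close v : nc v < d - nc (z1 - z0) -> nc (z1 + v - z0) < d.
  by move=> hv; rewrite addrAC; apply: le_lt_trans (ncD _ _) _; lra.
have inj : forall v, a * v + b * v^* = 0 -> v = 0.
  apply: (rdiff_linear_inj hab k0 e0) => v hv.
  by have := hk z1 (z1 + v) (ltW z1d) (ltW (close v hv)); rewrite [z1 + v]addrC addrK.
(* In direction [v] the differential points straight at [w]: a step [s] multiplies the distance by 1
   - s up to a quadratic error, which undercuts the minimum. *)
have [v Ev] := real_linear_onto inj (w - F z1).
have [K [d' [K0 d'0 h]]] := hab.
have v0 : 0 < nc v + 1 by rewrite ltr_wpDl// nc_ge0.
have m0 : 0 < Num.min 1 (Num.min (d - nc (z1 - z0)) d' / (nc v + 1)).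
  by rewrite lt_min ltr01 divr_gt0// lt_min e0.
have [s /andP[s0 sm] hs] := small_quadratic y0 (mulr_ge0 K0 (sqr_ge0 (nc v))) m0.
move: sm; rewrite lt_min ltr_pdivlMr// lt_min => /and3P[s1 sd sd'].
have sv : nc (s%:C * v) = s * nc v by rewrite ncM ncR gtr0_norm.
have svv : s * nc v <= s * (nc v + 1) by rewrite ler_wpM2l ?ltW//; lra.
have hd : nc (s%:C * v) < d - nc (z1 - z0) by rewrite sv; exact: le_lt_trans svv sd.
have := hmin (z1 + s%:C * v - z0) (ltW (close _ hd)).
have -> : z0 + (z1 + s%:C * v - z0) = z1 + s%:C * v by rewrite addrC subrK.
rewrite lerN2 -/z1 leNgt => /negP[].
have := h (s%:C * v); rewrite sv => /(_ (le_lt_trans svv sd')).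
have -> : a * (s%:C * v) + b * (s%:C * v)^* = s%:C * (a * v + b * v^*) by rewrite conjcMr; ring.
rewrite Ev; set e := _ - _ - s%:C * _ => he.
have -> : F (z1 + s%:C * v) - w = e - (1 - s)%:C * (w - F z1) by rewrite /e rcB; ring.
apply: (le_lt_trans (ncD _ _)); rewrite ncN ncM ncR ger0_norm ?subr_ge0 ?(ltW s1)//.
rewrite [nc (F z1 - w)]ncB; have : s * (K * nc v ^+ 2 * s) < s * nc (w - F z1) by rewrite ltr_pM2l.
move: he; rewrite exprMn !expr2; lra.
Qed.

End LocalSurjectivity.

(** * The schlicht disk *)

Section SchlichtDisk.
Variable R : realType.
Local Notation C := R[i].
Implicit Types (z w v c u a b : C).
Variables (p : nat) (M : nat -> R) (L : R) (G : nat -> C -> C) (F : C -> C) (r : R).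
Hypotheses (hF : landau_form p M L G F) (p1 : (1 <= p)%N) (root : radius_root p M L r).

Let r0 : 0 < r. Proof. by have [/andP[]] := root. Qed.
Let r1 : r < 1. Proof. by have [/andP[]] := root. Qed.

Lemma landau_form_open z0 (e : R) : nc z0 < r -> 0 < e -> exists2 d : R, 0 < d &
  forall w, nc (w - F z0) < d -> exists z, [/\ nc (z - z0) < e, nc z < r & F z = w].
Proof.
move=> z0r e0; pose m := Num.min e (r - nc z0) / 2.
have m0 : 0 < Num.min e (r - nc z0) by rewrite lt_min e0 subr_gt0.
have me0 : Num.min e (r - nc z0) <= e by rewrite ge_min lexx.
have mr0 : Num.min e (r - nc z0) <= r - nc z0 by rewrite ge_min lexx orbT.
have me : m < e by rewrite /m; lra.
have mr : m < r - nc z0 by rewrite /m; lra.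
have {}m0 : 0 < m by rewrite /m; lra.
(* On the closed disk of radius [s < r] the lower Lipschitz constant is positive; at [r] it
   vanishes. *)
pose s := nc z0 + m; have s0 : 0 <= s by rewrite addr_ge0 ?nc_ge0// ltW.
have sr : s < r by rewrite /s; lra.
have s1 : s < 1 := lt_trans sr r1.
have k0 := landau_root_gt0 hF p1 root s0 sr.
have zs z : nc (z - z0) <= m -> nc z <= s.
  by move=> h; have := ncD z0 (z - z0); rewrite addrC subrK /s; lra.
exists ((dpsi L s - phi p M s) * m / 2); first by rewrite divr_gt0// mulr_gt0.
move=> w hw; have [||z zm Ez] := rdiff_onto m0 k0 _ _ hw.
- by move=> z /zs h; apply: (landau_form_rdiff hF); exact: le_lt_trans h s1.
- by move=> z v /zs h1 /zs h2; exact: (landau_form_dist hF).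
by exists z; split => //; [lra|have := zs z (ltW zm); lra].
Qed.

Lemma landau_form_continuous z : nc z <= r -> {for z, continuous F}.
Proof.
move=> zr; have [|a [b h]] := landau_form_rdiff hF (_ : nc z < 1); first exact: le_lt_trans r1.
exact: rdiff_continuous h.
Qed.

Lemma landau_form0 : F 0 = 0.
Proof.
have [[_ _ _ _ g0] hk FE] := hF; rewrite FE ?nc0// g0 add0r big_nat.
by apply: big1 => k kp; have [_ _ _ _ ->] := hk k kp; rewrite mulr0.
Qed.

Lemma landau_form_onto w : nc w < R1 p M L r -> exists2 z, nc z < r & F z = w.
Proof.
move=> wR; pose T := [set t : R | [/\ 0 <= t, t <= 1 & exists2 z, nc z <= r & F z = t%:C * w]].
have T0 : T 0.
  by split => //; exists 0; rewrite ?nc0 ?(ltW r0)// landau_form0 mul0r.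
have hT : has_sup T by split; [exists 0|exists 1 => t []].
pose t1 := sup T; have t10 : 0 <= t1 by exact: sup_upper_bound.
have t11 : t1 <= 1 by apply: ge_sup; [exists 0|move=> t []].
(* The supremum [t1] is attained: [T] comes arbitrarily close to [t1], so the minimum of |F - t1 w|
   over the closed disk is 0. *)
have [|z zr hmin] := @disk_max R r (fun v => - nc (F v - t1%:C * w)) (ltW r0).
  move=> v /landau_form_continuous/continuous_epsP cF.
  apply/continuousR_epsP => e /cF[d d0 hd]; exists d => // v' /hd.
  rewrite -opprD normrN; apply: le_lt_trans.
  by apply: le_trans (nc_dist _ _) _; rewrite opprB addrA subrK.
have w0 := nc_ge0 w; have w1 : 0 < nc w + 1 by rewrite ltr_wpDl.
have Ez : F z = t1%:C * w.
  apply/eqP; rewrite -subr_eq0 -nc_eq0; apply: contraT => y0.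
  set y := nc _ in y0; have {}y0 : 0 < y by rewrite lt_neqAle eq_sym y0 nc_ge0.
  have [t [t0 tt1 [v vr Ev]] ht] := sup_adherent (divr_gt0 y0 w1) hT.
  have tle : t <= t1 by apply: sup_upper_bound => //; split => //; exists v.
  have := hmin v vr; rewrite lerN2 -/y Ev -mulrBl -rcB ncM ncR distrC ger0_norm ?subr_ge0//.
  have : (t1 - t) * (nc w + 1) < y by rewrite -ltr_pdivlMr//; rewrite -/t1 in ht; lra.
  have : (t1 - t) * nc w <= (t1 - t) * (nc w + 1) by rewrite ler_wpM2l ?subr_ge0//; lra.
  lra.
(* On the circle |F| is at least [R1], hence larger than |t1 w|; so [landau_form_open] applies at
   [z] and could push the ray past t1 < 1. *)
have zlt : nc z < r.
  rewrite lt_neqAle zr andbT; apply/eqP => zE.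
  have := landau_form_lower hF (_ : nc z < 1); rewrite zE => /(_ r1).
  rewrite Ez ncM ncR ger0_norm// leNgt => /negP[]; apply: le_lt_trans wR.
  by rewrite ler_piMl.
suff t1E : t1 = 1 by exists z => //; rewrite Ez t1E mul1r.
apply/eqP; rewrite eq_le t11 leNgt; apply/negP => tlt.
have [d d0 hd] := landau_form_open zlt ltr01.
pose s := Num.min 1 (t1 + d / (nc w + 1) / 2).
have ts : t1 < s.
  by rewrite lt_min tlt ltrDl divr_gt0// divr_gt0.
have [|v [_ vr Ev]] := hd (s%:C * w).
  rewrite Ez -mulrBl -rcB ncM ncR ger0_norm ?subr_ge0 ?(ltW ts)//.
  have s1 : s - t1 <= d / (nc w + 1) / 2.
    by rewrite lerBlDl ge_min lexx orbT.
  have : (s - t1) * (nc w + 1) <= d / 2.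
    by rewrite -ler_pdivlMr// mulrAC.
  have : (s - t1) * nc w <= (s - t1) * (nc w + 1) by rewrite ler_wpM2l ?subr_ge0 ?(ltW ts)//; lra.
  lra.
have : s <= t1.
  apply: sup_upper_bound => //; split; [by apply: le_trans t10 (ltW ts)|by rewrite ge_min lexx|].
  by exists v => //; exact: ltW.
by rewrite leNgt ts.
Qed.

(** The region is the preimage of the disk. It is open by continuity of [F]. Connectedness comes
    from pulling back radii by the inverse, whose continuity is [landau_form_open]. *)
Lemma landau_form_schlicht : schlicht_disk F (disk 0 r) 0 (R1 p M L r).
Proof.
have hR := R1_gt0 (landau_form_bounds hF) (landau_form_ge1 hF) p1 root.
pose U := [set z | nc z < r /\ nc (F z) < R1 p M L r].
have inj z w : nc z < r -> nc w < r -> F z = F w -> z = w.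
  by move=> h1 h2; apply: (landau_form_inj hF p1 root) => //; exact: ltW.
have U0 : U 0 by split; rewrite ?landau_form0 nc0.
exists U; split.
- split; first by exists 0.
    rewrite openE => z [zr zR]; apply/nbhs_diskP.
    have e0 : 0 < R1 p M L r - nc (F z) by rewrite subr_gt0.
    have [d d0 hd] := (continuous_epsP _ _).1 (landau_form_continuous (ltW zr)) _ e0.
    exists (Num.min d (r - nc z)); first by rewrite lt_min d0 subr_gt0.
    move=> w; rewrite lt_min => /andP[/hd h1 h2]; split.
      by have := ncD (w - z) z; rewrite subrK; lra.
    by have := ncD (F w - F z) (F z); rewrite subrK; lra.
  pose inv w := xget 0 [set z | nc z < r /\ F z = w].
  have invE z : nc z < r -> inv (F z) = z.
    move=> zr; rewrite /inv; case: xgetP => [v _ [vr Ev]|/(_ z)]; first exact: inj.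
    by case; split.
  pose g z (t : R) := inv (t%:C * F z).
  have gE z t : U z -> 0 <= t <= 1 -> U (g z t) /\ F (g z t) = t%:C * F z.
    move=> [zr zR] /andP[t0 t1].
    have tR : nc (t%:C * F z) < R1 p M L r.
      by rewrite ncM ncR ger0_norm//; apply: le_lt_trans zR; rewrite ler_piMl ?nc_ge0.
    have [v vr Ev] := landau_form_onto tR; have := invE v vr.
    rewrite Ev -/(g z t) => ->; split => //; split => //; by rewrite Ev.
  (* [g z] traces the preimage of the segment from 0 to [F z]; all these arcs start at 0. *)
  have -> : U = \bigcup_(z in U) (g z @` `[0, 1]).
    apply/seteqP; split => [z Uz|w [z Uz [t]]].
      exists z => //; exists 1; first by rewrite /= in_itv /= ler01 lexx.
      by rewrite /g mul1r invE//; case: Uz.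
    by rewrite /= in_itv /= => t01 <-; case: (gE z t Uz t01).
  apply: bigcup_connected.
    exists 0 => z Uz; exists 0; first by rewrite /= in_itv /= lexx ler01.
    by have := invE 0; rewrite nc0 landau_form0 /g mul0r; apply.
  move=> z Uz; apply: connected_continuous_connected; first exact: segment_connected.
  apply: continuous_in_subspaceT => t; rewrite inE /= in_itv /= => t01.
  have [[gr _] Eg] := gE z t Uz t01.
  apply/cvgrPdist_lt => e; rewrite ltcE /= => /andP[/eqP ie e0].
  have [d d0 hd] := landau_form_open gr e0.
  have w1 : 0 < nc (F z) + 1 by rewrite ltr_wpDl// nc_ge0.
  apply/nbhs_ballP; exists (d / (nc (F z) + 1)); first by rewrite /= divr_gt0.
  move=> s; rewrite /ball /= ltr_pdivlMr// => hs.
  have [|v [vz vr Ev]] := hd (s%:C * F z).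
    rewrite Eg -mulrBl -rcB ncM ncR distrC; apply: le_lt_trans hs.
    by rewrite ler_wpM2l// lerDl.
  have -> : g z s = v by rewrite /g -Ev invE.
  rewrite -ncE ncB (_ : e = (complex.Re e)%:C) ?ltcR//.
  by apply/eqP; rewrite eq_complex /= ie !eqxx.
- by move=> z [zr _]; rewrite /disk /mkset subr0.
- by move=> z w; rewrite !inE => -[zr _] [wr _]; exact: inj.
apply/seteqP; split => [w [z [_ h] <-]|w]; rewrite /disk /mkset subr0//.
by move=> wR; have [z zr Ez] := landau_form_onto wR; exists z => //; split; rewrite ?Ez.
Qed.

End SchlichtDisk.

(** * Extremal mappings *)

Section HolomorphicElliptic.
Variable R : realType.
Local Notation C := R[i].
Implicit Types (z w v c : C).

Lemma unit_diskE z : unit_disk z = (nc z < 1).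
Proof. by rewrite /unit_disk /disk /mkset subr0. Qed.

Lemma rdiff_eq_disk (f g : C -> C) z a b : (forall w, nc w < 1 -> f w = g w) ->
  nc z < 1 -> rdiff f z a b -> rdiff g z a b.
Proof.
move=> fg z1; have d0 : 0 < 1 - nc z by rewrite subr_gt0.
apply: rdiff_ext d0 _ => v vd; apply: fg.
by apply: le_lt_trans (ncD _ _) _; rewrite addrC -ltrBrDr.
Qed.

Lemma C1_rdiff (u a : C -> C) : (forall z, nc z < 1 -> rdiff u z (a z) 0) ->
  (forall z, nc z < 1 -> exists a' b', rdiff a z a' b') -> C1 u.
Proof.
move=> hu ha z; rewrite unit_diskE => z1.
have P w : nc w < 1 -> a w = pdx u w /\ 'i%C * a w = pdy u w.
  by move=> /hu/rdiff_partials[_ -> ->]; rewrite addr0 subr0.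
have [hp _ _] := rdiff_partials (hu z z1); have [a' [b' h]] := ha z z1.
split => //.
  by apply: rdiff_continuous (rdiff_eq_disk _ z1 h) => w /P[].
by apply: rdiff_continuous (rdiff_eq_disk _ z1 (rdiffZ 'i%C h)) => w /P[].
Qed.

Section Holomorphic.
Variables g d e : C -> C.
Hypothesis hg : forall z, nc z < 1 -> rdiff g z (d z) 0.
Hypothesis hd : forall z, nc z < 1 -> rdiff d z (e z) 0.
Hypothesis he : forall z, nc z < 1 -> exists a b, rdiff e z a b.

Lemma holomorphic_partials z : nc z < 1 -> pdx g z = d z /\ pdy g z = 'i%C * d z.
Proof. by move=> /hg/rdiff_partials[_ -> ->]; rewrite addr0 subr0. Qed.

Lemma holomorphic_dz z : nc z < 1 -> dz g z = d z /\ dzbar g z = 0.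
Proof. by move=> /hg/rdiff_wirtinger. Qed.

Lemma holomorphic_harmonic : Defs.harmonic g.
Proof.
split; first split.
- by apply: C1_rdiff hg _ => z z1; exists (e z), 0; exact: hd.
- apply: C1_rdiff he => z z1; apply: rdiff_eq_disk z1 (hd z1) => w w1.
  by case: (holomorphic_partials w1).
- apply: (@C1_rdiff _ (fun z => 'i%C * e z)) => z z1.
    have := rdiffZ 'i%C (hd z1); rewrite mulr0; apply: rdiff_eq_disk z1 => w w1.
    by case: (holomorphic_partials w1).
  by have [a [b h]] := he z1; have := rdiffZ 'i%C h; exists ('i%C * a), ('i%C * b).
move=> z; rewrite unit_diskE => z1; rewrite /laplacian.
have h : rdiff (dz g) z (e z) 0.
  by apply: rdiff_eq_disk z1 (hd z1) => w w1; case: (holomorphic_dz w1).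
by have [_ ->] := rdiff_wirtinger h; rewrite mulr0.
Qed.

Lemma holomorphic_lip (s : R) : 0 <= s -> s < 1 -> exists2 B : R, 0 <= B &
  (forall z, nc z <= s -> nc (d z) <= B) /\
  forall z w, nc z <= s -> nc w <= s -> nc (g z - g w) <= B * nc (z - w).
Proof.
move=> s0 s1; have cd z : nc z <= s -> {for z, continuous d}.
  by move=> zs; apply: rdiff_continuous (hd _); exact: le_lt_trans s1.
have [B B0 hB] := disk_bounded s0 cd; exists B => //; split => // z w zs ws.
apply: nc_le_Re => c c1.
have seg (t : R) : 0 <= t <= 1 -> nc (w + t%:C * (z - w)) <= s.
  move=> /andP[t0 t1]; apply: (@nc_segment _ _ _ 1) => //.
  by rewrite mul1r addrC subrK.
have [|t /andP[t0 t1]] := @MVT_seg _ (fun t : R => complex.Re (c * g (w + t%:C * (z - w))))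
  (fun t : R => complex.Re (c * d (w + t%:C * (z - w)) * (z - w) + c * 0 * (z - w)^*))
  0 1 ltr01.
  move=> t /seg h; apply: (@rdiff_line _ (fun x => c * g x)); apply: rdiffZ; apply: hg.
  exact: le_lt_trans s1.
rewrite mul0r addr0 mul1r [w + (z - w)]addrC subrK subr0 mulr1 mulr0 mul0r addr0.
rewrite -reB -mulrBr => ->; apply: le_trans (Re_le_ncW _) _.
rewrite !ncM c1 mul1r ler_wpM2r ?nc_ge0//; apply: hB; apply: seg.
by rewrite !ltW.
Qed.

End Holomorphic.

Lemma abs_cont_lip (a b B : R) (g : R -> C) : 0 <= B ->
  (forall s t, a <= s -> s <= t -> t <= b -> nc (g t - g s) <= B * (t - s)) ->
  abs_cont a b g.
Proof.
move=> B0 hg e e0; have B1 : 0 < B + 1 by rewrite ltr_wpDl.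
exists (e / (B + 1)); first exact: divr_gt0.
move=> n s t hst _; rewrite ltr_pdivlMr// => h; apply: le_lt_trans h.
rewrite mulr_suml; apply: ler_sum => i _; have [h1 h2 h3] := hst i.
apply: le_trans (hg _ _ h1 h2 h3) _; rewrite mulrC ler_wpM2l ?subr_ge0//.
by rewrite lerDl.
Qed.

(** The point of largest modulus is a corner, found by maximizing each coordinate separately; it
    belongs to the rectangle, so its modulus [s] is below 1. *)
Lemma rect_in_smaller_disk (a b c d : R) : rect_in_disk a b c d ->
  exists s : R, [/\ 0 <= s, s < 1 & forall x y, a <= x <= b -> c <= y <= d ->
    nc (x +i* y) <= s].
Proof.
move=> [ab cd hD].
have far (l u : R) : l < u -> exists2 m, l <= m <= u & forall x, l <= x <= u -> x ^+ 2 <= m ^+ 2.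
  move=> lu; have [h|h] := leP `|l| `|u|.
    exists u; first by rewrite lexx andbT ltW.
    move=> x /andP[x1 x2]; rewrite -[x ^+ 2]real_normK ?num_real// -[u ^+ 2]real_normK ?num_real//.
    rewrite lerXn2r ?nnegrE// ler_norml; have := ler_norm u; have := ler_norm (- l).
    by rewrite normrN; lra.
  exists l; first by rewrite lexx ltW.
  move=> x /andP[x1 x2]; rewrite -[x ^+ 2]real_normK ?num_real// -[l ^+ 2]real_normK ?num_real//.
  rewrite lerXn2r ?nnegrE// ler_norml; have := ler_norm u; have := ler_norm (- l).
  by rewrite normrN; lra.
have [x0 x0ab hx] := far a b ab; have [y0 y0cd hy] := far c d cd.
exists (nc (x0 +i* y0)); split; first exact: nc_ge0.
  by rewrite -unit_diskE; exact: hD.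
move=> x y xab ycd; rewrite -(ler_pXn2r (_ : (0 < 2)%N)) ?nnegrE ?nc_ge0// !nc_sqr /=.
by rewrite lerD ?hx ?hy.
Qed.

Lemma lipschitz_ACL (g : C -> C) : (forall s : R, 0 <= s -> s < 1 ->
    exists2 B : R, 0 <= B & forall z w, nc z <= s -> nc w <= s -> nc (g z - g w) <= B * nc (z - w)) ->
  ACL g.
Proof.
move=> hg a b c d /rect_in_smaller_disk[s [s0 s1 hs]]; have [B B0 hB] := hg s s0 s1.
split; apply: aeW => y ycd; apply: (abs_cont_lip B0) => t1 t2 at1 t12 t2b.
  apply: le_trans (hB _ _ _ _) _; [apply: hs => //|apply: hs => //|].
  - by rewrite t2b andbT; lra.
  - by rewrite at1; lra.
  rewrite (_ : _ - _ = (t2 - t1)%:C) ?ncR ?ger0_norm ?subr_ge0//.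
  by apply/eqP; rewrite eq_complex /= subrr !eqxx.
apply: le_trans (hB _ _ _ _) _; [apply: hs => //|apply: hs => //|].
- by rewrite t2b andbT; lra.
- by rewrite at1; lra.
rewrite (_ : _ - _ = 'i%C * (t2 - t1)%:C).
  by rewrite ncM ncR ger0_norm ?subr_ge0// /= expr0n expr1n add0r sqrtr1 mul1r.
by apply/eqP; rewrite eq_complex /=; apply/andP; split; apply/eqP; ring.
Qed.

Local Notation area := (@lebesgue_measure R \x @lebesgue_measure R)%E.

(** The partial derivatives [u] are controlled only inside the disk; measurability is borrowed from
    a formula [v] that is measurable on the whole plane and agrees with [u] on the rectangle. *)
Lemma L2_on_rect (a b c d B : R) (u v : C -> R) : a < b -> c < d ->
  (forall x y, a <= x <= b -> c <= y <= d -> u (x +i* y) = v (x +i* y)) ->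
  measurable_fun setT (fun q : R * R => v (q.1 +i* q.2)) ->
  (forall x y, a <= x <= b -> c <= y <= d -> `|v (x +i* y)| <= B) ->
  L2_on (`[a, b] `*` `[c, d]) u.
Proof.
move=> ab cd uv mv vB.
have mA : measurable (`[a, b]%classic `*` `[c, d]%classic : set (R * R)).
  by apply: measurableX; exact: measurable_itv.
have mu : measurable_fun (`[a, b]%classic `*` `[c, d]%classic) (fun q : R * R => u (q.1 +i* q.2)).
  apply: (eq_measurable_fun (fun q : R * R => v (q.1 +i* q.2))).
    by move=> [x y]; rewrite inE /= !in_itv /= => -[xab ycd]; rewrite uv.
  exact: measurable_funTS.
pose A := `[a, b]%classic : set R; pose A' := `[c, d]%classic : set R.
have fin : (area (A `*` A') < +oo)%E.
  rewrite product_measure1E; [|exact: measurable_itv|exact: measurable_itv].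
  rewrite /A /A' [X in (X * _)%E]lebesgue_measure_itv [X in (_ * X)%E]lebesgue_measure_itv /=.
  by rewrite !lte_fin ab cd -!EFinB -EFinM ltry.
split => //; apply: measurable_bounded_integrable => //.
- exact: measurable_funX.
exists (B ^+ 2); split; first exact: num_real.
move=> M hM [x y] /= [] /=; rewrite !in_itv /= => xab ycd.
rewrite uv// normrX; apply: le_trans (ltW hM).
by rewrite lerXn2r ?nnegrE ?vB//; apply: le_trans (normr_ge0 _) (vB x y xab ycd).
Qed.

End HolomorphicElliptic.

Section HolomorphicIsElliptic.
Variable R : realType.
Local Notation C := R[i].
Implicit Types (z w v c : C).
Variables (g d e : C -> C) (a0 : C).
Hypothesis hg : forall z, nc z < 1 -> rdiff g z (d z) 0.
Hypothesis hd : forall z, nc z < 1 -> rdiff d z (e z) 0.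
Hypothesis he : forall z, nc z < 1 -> exists a b, rdiff e z a b.
(** Makes the Jacobian vanish at one point at most, a null set. The zero is 1/L for the extremal
    mapping, and there is none for -z. *)
Hypothesis d_zero : forall z, nc z < 1 -> d z = 0 -> z = a0.
Hypothesis mRe : measurable_fun setT (fun q : R * R => complex.Re (d (q.1 +i* q.2))).
Hypothesis mIm : measurable_fun setT (fun q : R * R => complex.Im (d (q.1 +i* q.2))).

Lemma holomorphic_modulus z : nc z < 1 ->
  [/\ Lambda g z = nc (d z), lambda g z = nc (d z) & Defs.jacobian g z = nc (d z) ^+ 2].
Proof.
move=> /(holomorphic_dz hg)[E1 E2]; rewrite /Lambda /lambda /Defs.jacobian E1 E2 nc0.
by rewrite addr0 subr0 expr0n subr0 ger0_norm ?nc_ge0.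
Qed.

Lemma ae_disk_except (P : C -> Prop) z0 : (forall z, nc z < 1 -> z <> z0 -> P z) -> ae_disk P.
Proof.
move=> hP; exists ([set complex.Re z0] `*` [set complex.Im z0]); split.
- by apply: measurableX; exact: measurable_set1.
- rewrite product_measure1E; [|exact: measurable_set1|exact: measurable_set1].
  by rewrite [X in (X * _)%E]lebesgue_measure_set1 mul0e.
move=> [x y] /= H; apply: contrapT => h; apply: H; rewrite unit_diskE => z1.
by apply: hP => // E; apply: h; rewrite -E.
Qed.

Lemma holomorphic_locally_L2 : locally_L2 (pdx g) /\ locally_L2 (pdy g).
Proof.
have mNIm : measurable_fun setT (fun q : R * R => - complex.Im (d (q.1 +i* q.2))).
  exact: measurable_funN.
have rect (a b c b' : R) : rect_in_disk a b c b' -> exists B : R, forall x y,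
    a <= x <= b -> c <= y <= b' -> nc (x +i* y) < 1 /\ nc (d (x +i* y)) <= B.
  move=> /rect_in_smaller_disk[s [s0 s1 hs]].
  have [B _ [hB _]] := holomorphic_lip hg hd s0 s1; exists B => x y xab ycd.
  by split; [exact: le_lt_trans (hs x y xab ycd) s1|exact: hB (hs x y xab ycd)].
split=> a b c b' hr; have [B hB] := rect _ _ _ _ hr; have [ab cb _] := hr; split.
- apply: (@L2_on_rect _ _ _ _ _ B _ (fun z => complex.Re (d z)) ab cb _ mRe) => x y /hB h /h[z1 dB].
    by have [-> _] := holomorphic_partials hg z1.
  exact: le_trans (Re_le_nc _) dB.
- apply: (@L2_on_rect _ _ _ _ _ B _ (fun z => complex.Im (d z)) ab cb _ mIm) => x y /hB h /h[z1 dB].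
    by have [-> _] := holomorphic_partials hg z1.
  exact: le_trans (Im_le_nc _) dB.
- apply: (@L2_on_rect _ _ _ _ _ B _ (fun z => - complex.Im (d z)) ab cb _ mNIm) => x y /hB h /h[z1 dB].
    by have [_ ->] := holomorphic_partials hg z1; case: (d _) => p q /=; ring.
  by rewrite normrN; exact: le_trans (Im_le_nc _) dB.
apply: (@L2_on_rect _ _ _ _ _ B _ (fun z => complex.Re (d z)) ab cb _ mRe) => x y /hB h /h[z1 dB].
  by have [_ ->] := holomorphic_partials hg z1; case: (d _) => p q /=; ring.
exact: le_trans (Re_le_nc _) dB.
Qed.

Lemma holomorphic_elliptic : elliptic_harmonic 1 0 g.
Proof.
split; first exact: (holomorphic_harmonic hg hd he).
split.
- by move=> z; rewrite unit_diskE => /hg/rdiff_continuous.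
- by move=> z; rewrite unit_diskE => /holomorphic_modulus[_ _ ->]; exact: sqr_ge0.
- have [h1 h2] := holomorphic_locally_L2; split => //.
  apply: lipschitz_ACL => s s0 s1; have [B B0 [_ hB]] := holomorphic_lip hg hd s0 s1.
  by exists B.
- apply: (@ae_disk_except _ a0) => z z1 za; have [_ _ ->] := holomorphic_modulus z1.
  by rewrite expf_eq0 /= nc_eq0; apply/eqP => /(d_zero z1).
apply: (@ae_disk_except _ a0) => z z1 _; have [-> _ ->] := holomorphic_modulus z1.
by rewrite mul1r addr0.
Qed.

End HolomorphicIsElliptic.

(** * The complex logarithm *)

Section ComplexLogarithm.
Variable R : realType.
Local Notation C := R[i].
Implicit Types (z w v c : C).

(* Principal branch on the right half-plane; elsewhere a junk value. *)
Definition clog w : C :=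
  (ln (complex.Re w ^+ 2 + complex.Im w ^+ 2) / 2) +i* atan (complex.Im w / complex.Re w).

(** The derivative of Re (c clog) along a segment, with c = c1 + i c2: the two quotients are the
    real and imaginary parts of (a + i b) / w at the moving point w. *)
Lemma clog_line (x y a b c1 c2 : R) (t : R) : 0 < x + t * a ->
  is_derive t 1 (fun s : R => c1 * (ln ((x + s * a) ^+ 2 + (y + s * b) ^+ 2) / 2) -
     c2 * atan ((y + s * b) / (x + s * a)))
   (c1 * (((x + t * a) * a + (y + t * b) * b) / ((x + t * a) ^+ 2 + (y + t * b) ^+ 2)) -
    c2 * ((b * (x + t * a) - (y + t * b) * a) / ((x + t * a) ^+ 2 + (y + t * b) ^+ 2))).
Proof.
have lin (p q : R) : is_derive t 1 (fun s : R => p + s * q) q.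
  have : is_derive t 1 (fun s : R => p + q * s) (0 + q * 1) by exact: is_deriveD.
  rewrite add0r mulr1; congr (is_derive _ _ _ _).
  by apply/funext => s; rewrite mulrC.
set X := fun s => x + s * a; set Y := fun s => y + s * b => X0.
have dX : is_derive t 1 X a := lin x a; have dY : is_derive t 1 Y b := lin y b.
have N0 : 0 < X t ^+ 2 + Y t ^+ 2 by rewrite ltr_pwDl ?exprn_gt0// sqr_ge0.
have dN : is_derive t 1 (fun s => X s * X s + Y s * Y s) ((X t * a + X t * a) + (Y t * b + Y t * b)).
  exact: is_deriveD (is_deriveM dX dX) (is_deriveM dY dY).
have dL : is_derive t 1 (fun s => ln (X s * X s + Y s * Y s))
    ((X t * X t + Y t * Y t)^-1 * ((X t * a + X t * a) + (Y t * b + Y t * b))).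
  apply: (@is_derive1_comp _ (@ln R) (fun s => X s * X s + Y s * Y s) t _ _ _ dN).
  by apply: is_derive1_ln; rewrite -!expr2.
have dV : is_derive t 1 (fun s => (X s)^-1) (- (X t) ^- 2 * a).
  by apply: is_deriveV => //; rewrite gt_eqF.
have dQ : is_derive t 1 (fun s => Y s * (X s)^-1) (Y t * (- (X t) ^- 2 * a) + (X t)^-1 * b).
  exact: is_deriveM.
have dA : is_derive t 1 (fun s => atan (Y s * (X s)^-1))
    ((1 + (Y t * (X t)^-1) ^+ 2)^-1 * (Y t * (- (X t) ^- 2 * a) + (X t)^-1 * b)).
  exact: (@is_derive1_comp _ (@atan R) (fun s => Y s * (X s)^-1) t _ _ (is_derive1_atan _) dQ).
have := is_deriveB (is_deriveZ (c1 / 2) dL) (is_deriveZ c2 dA).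
rewrite (_ : (fun s => c1 * _ - _) = (fun s => c1 / 2 * ln (X s * X s + Y s * Y s) - c2 * atan (Y s * (X s)^-1))); last first.
  by apply/funext => s; rewrite /X /Y !expr2; congr (_ - _); ring.
move=> h; apply: (is_derive_eq h); rewrite /GRing.scale /= -/(X t) -/(Y t).
move: X0 N0; rewrite -/(X t); move: (X t) (Y t) => x0 y0 {}h N0.
have N1 : x0 ^+ 2 + y0 ^+ 2 != 0 by rewrite gt_eqF.
have h1 : x0 != 0 by rewrite gt_eqF.
by field; rewrite h1 ?expr2 ?(addrC (y0 * y0)) -?expr2 ?N1.
Qed.

(** The mean value theorem turns the increment of Re (c clog) into Re (c v / wt) with [wt] between w
    and w + v, and v / wt - v / w = -t v^2 / (wt w). Since |wt| >= x/2 and |w| >= x, the constant is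
    2 / x^2. *)
Lemma rdiff_clog w : 0 < complex.Re w -> rdiff clog w w^-1 0.
Proof.
set x := complex.Re w => x0; exists (2 / x ^+ 2), (x / 2); split.
- by rewrite divr_ge0// sqr_ge0.
- by rewrite divr_gt0.
move=> v vx; rewrite mul0r addr0; apply: nc_le_Re => c c1.
have xw : x <= nc w by exact: Re_le_ncW.
have w0 : w != 0 by rewrite -nc_gt0; exact: lt_le_trans xw.
pose a := complex.Re v; pose b := complex.Im v; pose y := complex.Im w.
have av : `|a| < x / 2 by apply: le_lt_trans vx; exact: Re_le_nc.
have X0 (t : R) : 0 <= t <= 1 -> x / 2 <= x + t * a.
  by move=> /andP[t0 t1]; move: av; rewrite ltr_norml => /andP[a1 a2]; nra.
have [|t /andP[t0 t1]] := @MVT_seg _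
  (fun s : R => complex.Re c * (ln ((x + s * a) ^+ 2 + (y + s * b) ^+ 2) / 2) -
     complex.Im c * atan ((y + s * b) / (x + s * a)))
  (fun t : R => complex.Re c * (((x + t * a) * a + (y + t * b) * b) / ((x + t * a) ^+ 2 + (y + t * b) ^+ 2)) -
    complex.Im c * ((b * (x + t * a) - (y + t * b) * a) / ((x + t * a) ^+ 2 + (y + t * b) ^+ 2)))
  0 1 ltr01.
  by move=> t /X0 h; apply: clog_line; apply: lt_le_trans h; rewrite divr_gt0.
have t01 : 0 <= t <= 1 by rewrite !ltW.
pose wt := w + t%:C * v.
have wtx : x / 2 <= nc wt.
  by apply: le_trans (X0 t t01) _; rewrite /x /a -reMr -reD; exact: Re_le_ncW.
have wt0 : wt != 0 by rewrite -nc_gt0; apply: lt_le_trans wtx; rewrite divr_gt0.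
rewrite subr0 mulr1 !mul1r !mul0r !addr0 => E.
have reE2 (z : C) : complex.Re (c * z) = complex.Re c * complex.Re z - complex.Im c * complex.Im z.
  by case: (c) => ? ?; case: z.
rewrite mulrBr reB mulrBr reB.
have -> : complex.Re (c * clog (w + v)) - complex.Re (c * clog w) = complex.Re (c * (v / wt)).
  rewrite !reE2 /clog !reD !imD /= -/x -/y -/a -/b E.
  have -> : v / wt = ((nc wt ^+ 2)^-1)%:C * (v * wt^*).
    rewrite (_ : ((nc wt ^+ 2)^-1)%:C = (wt * wt^*)^-1).
      by rewrite invfM; field; rewrite wt0 -nc_eq0 ncJ nc_eq0 wt0.
    by rewrite mulcJ rcV.
  rewrite reMr imMr nc_sqr.
  have -> : complex.Re wt = x + t * a by rewrite /wt reD reMr.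
  have -> : complex.Im wt = y + t * b by rewrite /wt imD imMr.
  have -> : complex.Re (v * wt^*) = (x + t * a) * a + (y + t * b) * b.
    rewrite /wt /x /y /a /b; case: (w) => ? ?; case: (v) => ? ? /=; ring.
  have -> : complex.Im (v * wt^*) = b * (x + t * a) - (y + t * b) * a.
    rewrite /wt /x /y /a /b; case: (w) => ? ?; case: (v) => ? ? /=; ring.
  ring.
rewrite -reB -mulrBr; apply: le_trans (Re_le_ncW _) _; rewrite ncM c1 mul1r.
have -> : v / wt - w^-1 * v = - (t%:C * (v ^+ 2 / (wt * w))).
  have tv : t%:C * v = wt - w by rewrite /wt addrC addKr.
  by rewrite expr2 !mulrA tv; field; rewrite w0 wt0.
rewrite ncN ncM ncR (ger0_norm (ltW t0)) ncM ncV ncX ncM.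
have h : (nc wt * nc w)^-1 <= 2 / x ^+ 2.
  have -> : 2 / x ^+ 2 = (x / 2 * x)^-1 by field; rewrite gt_eqF.
  by rewrite lef_pV2 ?posrE ?mulr_gt0 ?divr_gt0 ?nc_gt0//; apply: ler_pM => //; lra.
apply: (@le_trans _ _ (nc v ^+ 2 * (nc wt * nc w)^-1)).
  apply: ler_piMl; last exact: ltW.
  by apply: divr_ge0; [exact: sqr_ge0|apply: mulr_ge0; exact: nc_ge0].
by rewrite mulrC ler_wpM2r ?sqr_ge0.
Qed.

End ComplexLogarithm.

(** * The extremal elliptic mapping *)

Section ExtremalFunction.
Variable R : realType.
Local Notation C := R[i].
Implicit Types (z w v c : C) (L : R).

Lemma rdiff_comp_affine (f : C -> C) (al be z a : C) : rdiff f (al + be * z) a 0 ->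
  rdiff (fun w => f (al + be * w)) z (a * be) 0.
Proof.
move=> [K [d [K0 d0 h]]]; exists (K * nc be ^+ 2), (d / (nc be + 1)).
have b1 : 0 < nc be + 1 by rewrite ltr_wpDl// nc_ge0.
split; [by rewrite mulr_ge0// sqr_ge0|exact: divr_gt0|move=> v].
rewrite ltr_pdivlMr// => vd.
have bv : nc (be * v) < d.
  rewrite ncM mulrC; apply: le_lt_trans vd; rewrite ler_wpM2l ?nc_ge0//; lra.
rewrite mul0r mulrDr addrA -[a * be * v]mulrA -[leRHS]mulrA -exprMn -ncM.
by have := h _ bv; rewrite mul0r.
Qed.

Lemma rdiff_inv w : w != 0 -> rdiff (fun z => z^-1) w (- w^-1 ^+ 2) 0.
Proof.
move=> w0; have n0 : 0 < nc w by rewrite nc_gt0.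
exists (2 / nc w ^+ 3), (nc w / 2); split.
- by rewrite divr_ge0// exprn_ge0// ltW.
- by rewrite divr_gt0.
move=> v vw; have h : nc w / 2 <= nc (w + v).
  by have := ncBD w (- v); rewrite opprK ncN; lra.
have wv0 : w + v != 0 by rewrite -nc_gt0; apply: lt_le_trans h; rewrite divr_gt0.
have -> : (w + v)^-1 - w^-1 - (- w^-1 ^+ 2 * v + 0 * v^*) = v ^+ 2 * ((w + v) * w ^+ 2)^-1.
  by rewrite mul0r addr0 expr2; field; rewrite w0 wv0.
rewrite ncM ncV ncM !ncX mulrC ler_wpM2r ?sqr_ge0//.
have -> : 2 / nc w ^+ 3 = (nc w / 2 * nc w ^+ 2)^-1 by field; rewrite gt_eqF.
rewrite lef_pV2 ?posrE ?mulr_gt0 ?exprn_gt0 ?divr_gt0 ?nc_gt0//.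
by rewrite ler_wpM2r// sqr_ge0.
Qed.

(* [extremal'] and [extremal''] are the complex derivatives of [extremal L],
   with [extremal' L z] = L(1 - Lz)/(L - z) on the unit disk. *)
Definition extremal L z : C :=
  (L ^+ 2)%:C * z + (L ^+ 3 - L)%:C * clog (1 + (- L^-1)%:C * z).
Definition extremal' L z : C := (L ^+ 2)%:C + (- (L ^+ 3 - L))%:C * (L%:C + (-1) * z)^-1.
Definition extremal'' L z : C :=
  (- (L ^+ 3 - L))%:C * ((L%:C + (-1) * z)^-1 * (L%:C + (-1) * z)^-1).

Lemma pole_neq0 L z : 1 <= L -> nc z < 1 -> L%:C + (-1) * z != 0.
Proof.
move=> L1 z1; rewrite -nc_gt0 mulN1r; have := ncBD L%:C z.
by rewrite ncR ger0_norm; lra.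
Qed.

Lemma rdiff_pole L z : 1 <= L -> nc z < 1 ->
  rdiff (fun w => (L%:C + (-1) * w)^-1) z ((L%:C + (-1) * z)^-1 * (L%:C + (-1) * z)^-1) 0.
Proof.
move=> L1 z1; have := rdiff_comp_affine (rdiff_inv (pole_neq0 L1 z1)).
by rewrite mulrN1 opprK expr2.
Qed.

Lemma rdiff_extremal L z : 1 <= L -> nc z < 1 -> rdiff (extremal L) z (extremal' L z) 0.
Proof.
move=> L1 z1; have L0 : 0 < L by lra.
have w0 : 0 < complex.Re (1 + (- L^-1)%:C * z).
  rewrite reD reMr /=; have := Re_le_ncW z; have : complex.Re z / L < 1.
    by rewrite ltr_pdivrMr// mul1r; have := Re_le_ncW z; lra.
  by rewrite mulNr mulrC; lra.
have := rdiffD (rdiffZ (L ^+ 2)%:C (rdiff_id z))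
  (rdiffZ (L ^+ 3 - L)%:C (rdiff_comp_affine (rdiff_clog w0))).
rewrite !mulr0 addr0 mulr1; congr (rdiff _ _ _ _); rewrite /extremal'; congr (_ + _).
have p0 := pole_neq0 L1 z1.
have wE : 1 + (- L^-1)%:C * z = (L^-1)%:C * (L%:C + (-1) * z).
  by rewrite mulrDr -rcM mulVf ?gt_eqF// mulN1r mulrN -mulNr; rewrite rcN.
rewrite wE invfM -rcV invrK.
rewrite !rcN.
have LL : L%:C * (L^-1)%:C = 1 :> C by rewrite -rcM mulfV ?gt_eqF.
move: (L%:C + _)^-1 => P; by rewrite !mulrN mulNr mulrAC LL mul1r.
Qed.

Lemma rdiff_extremal' L z : 1 <= L -> nc z < 1 -> rdiff (extremal' L) z (extremal'' L z) 0.
Proof.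
move=> L1 z1.
have := rdiffD (rdiff_cst (L ^+ 2)%:C z) (rdiffZ (- (L ^+ 3 - L))%:C (rdiff_pole L1 z1)).
by rewrite mulr0 !add0r.
Qed.

Lemma rdiff_extremal'' L z : 1 <= L -> nc z < 1 -> exists a b, rdiff (extremal'' L) z a b.
Proof.
move=> L1 z1.
have := rdiffZ (- (L ^+ 3 - L))%:C (rdiffM (rdiff_pole L1 z1) (rdiff_pole L1 z1)).
by set a := (X in rdiff _ _ X _); set b := (X in rdiff _ _ _ X); exists a, b.
Qed.

Lemma extremal'E L z : 1 <= L -> nc z < 1 ->
  extremal' L z = L%:C * (1 - L%:C * z) / (L%:C + (-1) * z).
Proof.
move=> L1 z1; have p0 := pole_neq0 L1 z1.
rewrite /extremal' rcN rcB !rcX; field; move: p0; rewrite mulN1r//.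
Qed.

Lemma extremal'_zero L z : 1 <= L -> nc z < 1 -> extremal' L z = 0 -> z = (L^-1)%:C.
Proof.
move=> L1 z1; rewrite extremal'E// => /eqP.
have L0 : L%:C != 0 :> C by rewrite eq_complex /= negb_and gt_eqF//; lra.
rewrite !mulf_eq0 invr_eq0 (negPf (pole_neq0 L1 z1)) orbF (negPf L0) /= subr_eq0 => /eqP h.
by rewrite rcV -[RHS]mulr1 h mulKf.
Qed.

(** |L - z|^2 - |1 - L z|^2 = (L^2 - 1)(1 - |z|^2); this makes the mapping admissible with
    [Lp = L]. *)
Lemma extremal'_le L z : 1 <= L -> nc z < 1 -> nc (extremal' L z) <= L.
Proof.
move=> L1 z1; rewrite extremal'E// !ncM ncV ncR ger0_norm; last lra.
rewrite -mulrA ler_piMr//; first lra.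
rewrite ler_pdivrMr ?nc_gt0 ?pole_neq0// mul1r.
rewrite -(ler_pXn2r (_ : (0 < 2)%N)) ?nnegrE ?nc_ge0//.
have : nc z ^+ 2 < 1 by rewrite expr_lt1 ?nc_ge0.
rewrite !nc_sqr; case: z {z1} => x y /=; rewrite !expr2 => h.
have : 0 <= (L * L - 1) * (1 - (x * x + y * y)) by apply: mulr_ge0; nra.
by clear; nra.
Qed.

Lemma extremal0 L : extremal L 0 = 0.
Proof. by rewrite /extremal !mulr0 addr0 add0r /clog /= expr0n addr0 expr1n ln1 !mul0r atan0 mulr0. Qed.

Lemma extremal'0 L : 1 <= L -> extremal' L 0 = 1.
Proof.
move=> L1; rewrite extremal'E ?nc0// !mulr0 subr0 addr0 mulr1 mulfV//.
by rewrite eq_complex /= negb_and gt_eqF//; lra.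
Qed.

Lemma extremal_real L (x : R) : 1 <= L -> x < 1 -> extremal L x%:C = (psi L x)%:C.
Proof.
move=> L1 x1; have y0 : 0 < 1 - x / L by rewrite subr_gt0 ltr_pdivrMr; lra.
rewrite /extremal -!rcM -[1]/(1%:C) -rcD mulNr [_ * x]mulrC /clog /= expr0n addr0 mul0r atan0.
rewrite [L^-1 * x]mulrC lnXn//; have -> : ln (1 - x / L) *+ 2 / 2 = ln (1 - x / L).
  by rewrite -[_ *+ 2]mulr_natr mulfK.
by rewrite /psi [RHS]rcD; congr (_ + _); [rewrite mulrC|rewrite [RHS]rcM].
Qed.

Lemma measurable_pole L :
  measurable_fun setT (fun q : R * R => complex.Re ((L%:C + (-1) * (q.1 +i* q.2))^-1)) /\
  measurable_fun setT (fun q : R * R => complex.Im ((L%:C + (-1) * (q.1 +i* q.2))^-1)).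
Proof.
have mx : measurable_fun setT (fun q : R * R => L - q.1).
  by apply: measurable_funB => //; exact: measurable_cst.
have my : measurable_fun setT (fun q : R * R => q.2) by exact: measurable_snd.
have mN : measurable_fun setT (fun q : R * R => ((L - q.1) ^+ 2 + q.2 ^+ 2) `^ (-1)).
  apply: (measurableT_comp (measurable_powR (-1))).
  by apply: measurable_funD; exact: measurable_funX.
(* Inversion of the squared modulus is written as the power -1, a measurable function; at the pole
   both sides are 0. *)
have E (q : R * R) : (L%:C + (-1) * (q.1 +i* q.2))^-1 =
    ((L - q.1) * ((L - q.1) ^+ 2 + q.2 ^+ 2) `^ (-1)) +i*
    (q.2 * ((L - q.1) ^+ 2 + q.2 ^+ 2) `^ (-1)).
  rewrite powR_inv1 ?addr_ge0 ?sqr_ge0// mulN1r; case: q => x y.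
  by apply/eqP; rewrite eq_complex /= sub0r sqrrN mulNr opprK !eqxx.
split; under eq_fun do rewrite E /=; exact: measurable_funM.
Qed.

Lemma extremal_elliptic L : 1 <= L -> elliptic_harmonic 1 0 (extremal L).
Proof.
move=> L1; have [m1 m2] := measurable_pole L.
apply: (@holomorphic_elliptic _ (extremal L) (extremal' L) (extremal'' L) (L^-1)%:C).
- by move=> z; exact: rdiff_extremal.
- by move=> z; exact: rdiff_extremal'.
- by move=> z; exact: rdiff_extremal''.
- by move=> z; exact: extremal'_zero.
- under eq_fun do rewrite reD reMr /=.
  by apply: measurable_funD; [exact: measurable_cst|apply: measurable_funM => //; exact: measurable_cst].
under eq_fun do rewrite imD imMr /=.
by apply: measurable_funD; [exact: measurable_cst|apply: measurable_funM => //; exact: measurable_cst].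
Qed.

Lemma rdiff_opp z : rdiff (fun w => - w) z (-1) 0.
Proof.
have := rdiffZ (-1) (rdiff_id z); rewrite mulr1 mulr0.
by congr (rdiff _ _ _ _); apply/funext => w; rewrite mulN1r.
Qed.

Lemma opp_elliptic : elliptic_harmonic 1 0 (fun z : C => - z).
Proof.
apply: (@holomorphic_elliptic _ (fun z : C => - z) (fun=> -1) (fun=> 0) 0).
- by move=> z _; exact: rdiff_opp.
- by move=> z _; exact: rdiff_cst.
- by move=> z _; exists 0, 0; exact: rdiff_cst.
- by move=> z _ /eqP; rewrite oppr_eq0 oner_eq0.
- exact: measurable_cst.
exact: measurable_cst.
Qed.

End ExtremalFunction.

(** * Sharpness of both radii *)

Section Sharpness.
Variable R : realType.
Local Notation C := R[i].
Implicit Types (z w v c : C).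
Variables (p : nat) (M : nat -> R) (L : R).
Hypotheses (p1 : (1 <= p)%N) (L1 : 1 <= L).
Hypothesis M1 : forall k, (2 <= k <= p)%N -> M (p - k + 1)%N = 1.

Definition extremal_family k z := if k == p then extremal L z else - z.
Definition extremal_sum z := \sum_(1 <= k < p.+1)
  (nc z ^+ (2 * (k - 1)))%:C * extremal_family (p - k + 1)%N z.

Lemma extremal_family_first : extremal_family (p - 1 + 1)%N = extremal L.
Proof. by apply/funext => z; rewrite /extremal_family subnK// eqxx. Qed.

Lemma extremal_family_other k : (2 <= k <= p)%N ->
  extremal_family (p - k + 1)%N = (fun z => - z).
Proof.
move=> /andP[k2 kp]; apply/funext => z; rewrite /extremal_family ifF//.
apply/negP => /eqP E; have : (p - k + 1 == p - k + k)%N by rewrite subnK// E.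
by rewrite eqn_add2l => /eqP kE; rewrite -kE in k2.
Qed.

Lemma extremal_landau_class : landau_class 1 0 p M L extremal_family extremal_sum.
Proof.
have fam (P : (C -> C) -> Prop) : P (extremal L) -> P (fun z => - z) ->
    forall k, (1 <= k <= p)%N -> P (extremal_family (p - k + 1)%N).
  move=> h1 h2 [|[|k]]// kp; first by rewrite extremal_family_first.
  by rewrite extremal_family_other.
have hl z : nc z < 1 -> lambda (extremal L) z = nc (extremal' L z).
  move=> z1; have hg w : nc w < 1 -> rdiff (extremal L) w (extremal' L w) 0.
    exact: rdiff_extremal.
  by have [_ ->] := holomorphic_modulus hg z1.
have n0 : nc (0 : C) < 1 by rewrite nc0.
split.
- split; first exact: fam (extremal_elliptic L1) (@opp_elliptic R).
  by [].
- rewrite /extremal_sum big_nat; apply: big1 => k kp.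
  rewrite (_ : extremal_family _ 0 = 0) ?mulr0//.
  by apply: (fam (fun f => f 0 = 0)) kp; [exact: extremal0|rewrite oppr0].
- apply: (fam (fun f => lambda f 0 = 1 /\ f 0 = 0)); first by rewrite hl// extremal'0// nc1 extremal0.
  split; last by rewrite oppr0.
  have hg w : nc w < 1 -> rdiff (fun z => - z) w (-1) 0 by move=> _; exact: rdiff_opp.
  by have [_ -> _] := holomorphic_modulus hg n0; rewrite ncN nc1.
- move=> k kp z; rewrite unit_diskE => z1.
  by rewrite extremal_family_other// ncN M1// ltW.
move=> z; rewrite unit_diskE => z1.
have -> : extremal_family p = extremal L by apply/funext => w; rewrite /extremal_family eqxx.
by rewrite hl//; exact: extremal'_le.
Qed.

Lemma K1_1 : K1 1 = 1 :> R.
Proof.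
rewrite /K1 expr1n mulr1 (_ : 2 - 1 = 1) ?sqrtr1; last by ring.
by apply/min_idPl; rewrite ler_pdivlMr ?pi_gt0// mul1r; have := @pi_lt4 R; lra.
Qed.

Lemma phi_extremal (r : R) :
  phi p M r = \sum_(2 <= k < p.+1) (2 * k - 1)%:R * r ^+ (2 * (k - 1)).
Proof.
apply: eq_big_nat => k kp; rewrite M1// K1_1 expr1n !mulr1 subrr sqrtr0 mul0r addr0 ?mulr1.
by rewrite mulrC.
Qed.

Lemma R1_extremal (r : R) : R1 p M L r = psi L r - \sum_(2 <= k < p.+1) r ^+ (2 * k - 1).
Proof.
rewrite /R1 -/(psi L r); congr (_ - _); apply: eq_big_nat => k kp.
by rewrite M1// K1_1 expr1n !mulr1 subrr sqrtr0 mul0r addr0 ?mulr1.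
Qed.

Lemma extremal_sum_real (x : R) : 0 <= x -> x < 1 -> extremal_sum x%:C = (R1 p M L x)%:C.
Proof.
move=> x0 x1; rewrite /extremal_sum (big_ltn (_ : 1 < p.+1)%N)// extremal_family_first.
rewrite subnn muln0 expr0 mul1r extremal_real// R1_extremal rcB; congr (_ + _).
rewrite rc_sum -sumrN; apply: eq_big_nat => k kp.
rewrite extremal_family_other// ncR ger0_norm// mulrN -rcM -exprSr.
by case: k kp => [|[|k]]// _; rewrite (_ : (2 * k.+2 - 1)%N = (2 * (k.+2 - 1)).+1)// subn1 subSS subn0 !mulnS.
Qed.

Lemma exprn_tangent_le (r x : R) n : 0 <= r -> r <= x ->
  n%:R * r ^+ n.-1 * (x - r) <= x ^+ n - r ^+ n.
Proof.
move=> r0 rx; rewrite subrXX mulrC; apply: ler_wpM2l; first by rewrite subr_ge0.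
rewrite mulr_natl -[X in _ *+ X]card_ord -sumr_const; apply: ler_sum => i _.
have -> : r ^+ n.-1 = r ^+ (n.-1 - i) * r ^+ i.
  by rewrite -exprD subnK//; case: n i => [|n] [i ilt].
apply: ler_wpM2r; first exact: exprn_ge0.
by rewrite lerXn2r ?nnegrE//; exact: le_trans rx.
Qed.

(** For M = 1 the derivative of [R1] is [dpsi - phi], which is at most 0 beyond the root. The mean
    value theorem for [psi] and tangent lines of the convex powers express this without
    differentiating the sum. *)
Lemma R1_extremal_le (r x : R) : radius_root p M L r -> r < x -> x < 1 ->
  R1 p M L x <= R1 p M L r.
Proof.
move=> /radius_rootE[/andP[r0 r1] E] rx x1; rewrite !R1_extremal.
have [|c /andP[rc cx] Ec] := @MVT_seg _ (psi L) (dpsi L) r x rx.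
  by move=> t /andP[_ tx]; apply: is_derive_psi => //; exact: le_lt_trans tx x1.
have h1 : psi L x - psi L r <= phi p M r * (x - r).
  rewrite Ec -E ler_wpM2r ?subr_ge0 ?(ltW rx)//.
  by apply: dpsi_nincr; [exact: L1|exact: ltW|exact: lt_trans cx x1].
have : phi p M r * (x - r) <=
    \sum_(2 <= k < p.+1) x ^+ (2 * k - 1) - \sum_(2 <= k < p.+1) r ^+ (2 * k - 1).
  rewrite phi_extremal mulr_suml -sumrB; apply: ler_sum_nat => -[|[|k]]// kp.
  have := @exprn_tangent_le r x (2 * k.+2 - 1) (ltW r0) (ltW rx).
  by rewrite (_ : (2 * k.+2 - 1).-1 = (2 * (k.+2 - 1))%N)// !subn1 !mulnS.
lra.
Qed.

Lemma ct_R1_extremal (x : R) : x < 1 -> ctat x (R1 p M L).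
Proof.
move=> x1; rewrite (_ : R1 p M L = fun t => psi L t + - \sum_(2 <= k < p.+1) t ^+ (2 * k - 1)).
  apply: ctD; first exact: is_derive_cont (is_derive_psi L1 x1).
  by apply: ctN; apply: ct_sum => k; ct.
by apply/funext => t; rewrite R1_extremal.
Qed.

Lemma R1_extremal0 : R1 p M L 0 = 0.
Proof.
rewrite R1_extremal psi0 big_nat big1 ?subr0// => -[|[|k]]// _.
by rewrite !mulnS subn1 expr0n.
Qed.

(** Take [x] between [r1] and [r]. If [R1] is nonnegative at [x], this value is already taken on
    [0, r1], where [R1] goes from 0 to at least that value; if it is negative, [R1] vanishes between
    [r1] and [x] as it does at 0. Either way two points of the real axis have the same image. *)
Lemma extremal_not_univalent (r1 r : R) : radius_root p M L r1 -> r1 < r <= 1 ->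
  ~ univalent_on (disk 0 r) extremal_sum.
Proof.
move=> root /andP[r1r r_le1] inj.
have [/andP[r10 r11] _] := (radius_rootE p M L r1).1 root.
pose x := (r1 + r) / 2; have r1x : r1 < x by rewrite /x; lra.
have xr : x < r by rewrite /x; lra.
have gx := R1_extremal_le root r1x (lt_le_trans xr r_le1).
have no (a b : R) : 0 <= a -> a < b -> b < r -> R1 p M L a = R1 p M L b -> False.
  move=> a0 ab br E; have mem (t : R) : 0 <= t -> t < r -> (t%:C : C) \in disk 0 r.
    by move=> t0 tr; rewrite inE /disk /mkset subr0 ncR ger0_norm.
  have := inj a%:C b%:C (mem a a0 (lt_trans ab br)) (mem b (le_trans a0 (ltW ab)) br).
  rewrite !extremal_sum_real ?E//; [|lra|lra|lra].
  by move=> /(_ erefl) [] ab'; rewrite ab' ltxx in ab.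
have [gx0|gx0] := leP 0 (R1 p M L x).
  have [|||a /andP[a0 ar] Ea] := @IVT_ctat _ (fun t => R1 p M L x - R1 p M L t) 0 r1 (ltW r10) _ _ _.
  - move=> t /andP[_ tr]; apply: (@ctD _ _ (fun=> _) (fun t => - _)); first exact: ct_cst.
    by apply: ctN; apply: ct_R1_extremal; exact: le_lt_trans r11.
  - by rewrite subr_le0.
  - by rewrite R1_extremal0 subr0.
  apply: (no a x) => //; first exact: le_lt_trans r1x.
  by apply/eqP; rewrite eq_sym -subr_eq0 Ea.
have [|||b /andP[rb bx] Eb] := @IVT_ctat _ (R1 p M L) r1 x (ltW r1x) _ _ _.
- by move=> t /andP[_ tx]; apply: ct_R1_extremal; lra.
- exact: ltW.
- by apply: ltW; apply: R1_gt0 => // k kp; rewrite M1.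
apply: (no 0 b) => //; [lra|lra|by rewrite R1_extremal0].
Qed.

(** A larger disk would contain the image of the boundary point [r1]. As [landau_form_inj] allows
    one of its two points on the circle, the preimage would be [r1] itself, which is outside the
    open disk. *)
Lemma extremal_schlicht_le (r1 rho : R) : radius_root p M L r1 -> R1 p M L r1 < rho ->
  ~ schlicht_disk extremal_sum (disk 0 r1) 0 rho.
Proof.
move=> root Rrho [U [_ sub _ img]].
have [/andP[r10 r11] _] := (radius_rootE p M L r1).1 root.
have hF := landau_class_form (lexx _) (lexx _) p1 extremal_landau_class.
have L0 : 0 <= L := le_trans ler01 L1.
have LE : Lambda' 1 0 L = L.
  by rewrite /Lambda' expr1n !mul1r mulr0 addr0 sqrtr_sqr ger0_norm//; lra.
rewrite LE in hF.
have R0 : 0 < R1 p M L r1 by apply: R1_gt0 => // k kp; rewrite M1.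
have : disk 0 rho (R1 p M L r1)%:C by rewrite /disk /mkset subr0 ncR gtr0_norm.
rewrite -img => -[z Uz Ez].
have zr : nc z < r1 by have := sub z Uz; rewrite /disk /mkset subr0.
have r1n : nc (r1%:C : C) = r1 by rewrite ncR gtr0_norm.
have zE : z = r1%:C.
  apply: (landau_form_inj hF p1 root zr); first by rewrite r1n.
  by rewrite Ez extremal_sum_real// ltW.
by rewrite zE r1n ltxx in zr.
Qed.

End Sharpness.

Theorem theorem2p1 (R : realType) (K K' : R) (p : nat) (M : nat -> R) (Lp : R)
    (G : nat -> R[i] -> R[i]) (F : R[i] -> R[i]) :
  1 <= K -> 0 <= K' -> (1 <= p)%N ->
  landau_class K K' p M Lp G F ->
  let Lp' := Lambda' K K' Lp in
  (~ (p = 1%N /\ Lp' = 1) -> exists! r, radius_root p M Lp' r) /\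
  (forall r1 : R, radius_root p M Lp' r1 ->
    [/\ univalent_on (disk 0 r1) F,
        exists w : R[i], schlicht_disk F (disk 0 r1) w (R1 p M Lp' r1) &
        K = 1 -> K' = 0 ->
        (forall k, (2 <= k <= p)%N -> M (p - k + 1)%N = 1) ->
        (forall r : R, r1 < r <= 1 ->
           exists G0 F0, landau_class K K' p M Lp G0 F0 /\
             ~ univalent_on (disk 0 r) F0) /\
        (forall rho : R, R1 p M Lp' r1 < rho ->
           exists G0 F0, landau_class K K' p M Lp G0 F0 /\
             ~ schlicht_disk F0 (disk 0 r1) 0 rho)]).
Proof.
move=> K1 K0 p1 hL Lp'; have hF := landau_class_form K1 K0 p1 hL.
have hM := landau_form_bounds hF; have L1 := landau_form_ge1 hF.
split; first exact: radius_root_unique.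
move=> r1 root; split.
- move=> z w; rewrite !inE /disk /mkset !subr0 => zr wr.
  by apply: (landau_form_inj hF p1 root) => //; exact: ltW.
- by exists 0; exact: (landau_form_schlicht hF p1 root).
move=> KE K'E ME; rewrite {}KE {}K'E in hL Lp' root L1 *.
(* For K = 1 and K' = 0, [Lambda'] reduces to [Lp], and [lambda] at 0 gives 1 <= Lp; so the extremal
   mapping with L = Lp belongs to the same class. *)
have Lp1 : 1 <= Lp.
  have [_ _ h1 _ h] := hL; have [<- _] := h1 1%N p1.
  by rewrite subnK//; apply: h; rewrite unit_diskE nc0.
have Lp'E : Lp' = Lp.
  rewrite /Lp' /Lambda' expr1n !mul1r mulr0 addr0 sqrtr_sqr ger0_norm; first by lra.
  exact: le_trans ler01 Lp1.
rewrite Lp'E in root *; split.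
- move=> r hr; exists (extremal_family p Lp), (extremal_sum p Lp).
  by split; [exact: extremal_landau_class|exact: (extremal_not_univalent p1 Lp1 ME root hr)].
move=> rho hrho; exists (extremal_family p Lp), (extremal_sum p Lp).
by split; [exact: extremal_landau_class|exact: (extremal_schlicht_le p1 Lp1 ME root hrho)].
Qed.
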